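(* Let $(X,\mathcal{A},\mu,T)$ be an ergodic probability preserving system, $(A_l)$ an asymptotically rare sequence in $\mathcal{A}$, and $(\psi_{A_l})_{l\ge1}$ a sequence of $\mathfrak{F}$-valued local observables for the $A_l$ such that $\psi_{A_l}\overset{\mu_{A_l}}{\Longrightarrow}\psi$ for some random element $\psi$ of $\mathfrak{F}$. Let $\Psi_{A_l}$ be the corresponding local processes. Assume: (A) for every $s\in[0,\infty)$ there are a compact subset $\mathfrak{K}_s$ of $(\mathfrak{P},d_{\mathfrak{P}})$, measures $\nu_{l,s}\in\mathfrak{P}$ with $d_{\mathfrak{P}}(\nu_{l,s},\mu_{A_l\cap\{\mu(A_l)\varphi_{A_l}>s\}})\to0$, and measurable $\tau_{l,s}:X\to\mathbb{N}_0$ such that $\nu_{l,s}(\tau_{l,s}<\varphi_{A_l})\to1$ as $l\to\infty$, while $T^{\tau_{l,s}}_\ast\nu_{l,s}\in\mathfrak{K}_s$ for $l\ge1$; and (B) there is a $\pi$-system $\mathcal{B}^\pi_{\mathfrak{F}}$ generating the Borel $\sigma$-algebra of $\mathfrak{F}$ with $\mathfrak{F}\in\mathcal{B}^\pi_{\mathfrak{F}}$ and $\Pr[\psi\in\partial F]=0$ for all $F\in\mathcal{B}^\pi_{\mathfrak{F}}$; moreover, for every $F\in\mathcal{B}^\pi_{\mathfrak{F}}$ with $\Pr[\psi\in F]>0$ there are a compact subset $\mathfrak{K}_F$ of $(\mathfrak{P},d_{\mathfrak{P}})$, measures $\nu_{l,F}\in\mathfrak{P}$ with $d_{\mathfrak{P}}(\nu_{l,F},\mu_{A_l\cap\{\psi_{A_l}\in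 F\}})\to0$, and measurable $\tau_{l,F}:X\to\mathbb{N}_0$ such that $\mu(A_l)\tau_{l,F}\to0$ in $\nu_{l,F}$-probability, $\nu_{l,F}(\tau_{l,F}<\varphi_{A_l})\to1$ as $l\to\infty$, and $T^{\tau_{l,F}}_\ast\nu_{l,F}\in\mathfrak{K}_F$ for $l\ge1$. Then, as $l\to\infty$, $$(\mu(A_l)\Phi_{A_l},\Psi_{A_l})\overset{\mu}{\Longrightarrow}(\Phi_{\mathrm{Exp}},\Psi^\ast)\quad\text{and}\quad(\mu(A_l)\Phi_{A_l},\widetilde\Psi_{A_l})\overset{\mu_{A_l}}{\Longrightarrow}(\Phi_{\mathrm{Exp}},\Psi^\ast),$$ where $(\Phi_{\mathrm{Exp}},\Psi^\ast)$ is an independent pair of iid processes, $\Phi_{\mathrm{Exp}}$ iid standard exponential and $\Psi^\ast$ iid in $\mathfrak{F}$ with marginal law equal to $\mathrm{law}(\psi)$.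
   Context: $(\mathfrak{F},d_{\mathfrak{F}})$ compact metric space; $T$ ergodic preserving the probability $\mu$. For $A$ with $\mu(A)>0$: $\varphi_A(x):=\inf\{n\ge1:T^nx\in A\}$, $T_Ax:=T^{\varphi_A(x)}x$, $\mu_B:=\mu(B\cap\cdot)/\mu(B)$, $\Phi_A:=(\varphi_A,\varphi_A\circ T_A,\ldots)$ in $[0,\infty]^{\mathbb{N}_0}$ ($[0,\infty]$ metrized by $|e^{-s}-e^{-t}|$, product metric). Asymptotically rare: $0<\mu(A_l)\to0$. Local observable: measurable $\psi_A:A\to\mathfrak{F}$; $\Psi_A:=(\psi_A\circ T_A,\psi_A\circ T_A^2,\ldots)$ on $X$, $\widetilde\Psi_A:=(\psi_A,\psi_A\circ T_A,\ldots)$ on $A$. $\mathfrak{P}$: probabilities $\nu\ll\mu$, $d_{\mathfrak{P}}(\nu,\nu')=2\sup_A|\nu(A)-\nu'(A)|$. $T^\tau x:=T^{\tau(x)}x$, $T^\tau_\ast\nu:=\nu\circ(T^\tau)^{-1}$. $\overset{\nu}{\Longrightarrow}$: weak convergence of laws under $\nu$. *)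

(* Defs.v *)
From HB Require Import structures.
From mathcomp Require Import all_boot all_order all_algebra.
From mathcomp Require Import all_classical all_reals all_analysis measurable_realfun.
Set Implicit Arguments. Unset Strict Implicit. Unset Printing Implicit Defensive.
Import Order.TTheory GRing.Theory Num.Theory numFieldNormedType.Exports.
Local Open Scope classical_set_scope.
Local Open Scope ring_scope.

Section Defs.
Context {R : realType}.

Definition borel_sets (S : topologicalType) : set (set S) := <<s open >>.

Definition borel_measurable_on d (Om : measurableType d) (S : topologicalType)
  (D : set Om) (f : Om -> S) :=
  forall B, borel_sets B -> measurable (D `&` f @^-1` B).

Context {d : measure_display} {X : measurableType d}.

Definition measure_preserving (mu : set X -> \bar R) (T : X -> X) :=
  measurable_fun setT T /\
  forall A, measurable A -> mu (T @^-1` A) = mu A.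
Definition ergodic (mu : set X -> \bar R) (T : X -> X) :=
  forall A, measurable A -> T @^-1` A = A -> mu A = 0%E \/ mu A = 1%E.

Definition returns (T : X -> X) (A : set X) (x : X) :=
  exists n, (1 <= n)%N /\ A (iter n T x).
Definition phi (T : X -> X) (A : set X) (x : X) : \bar R :=
  ereal_inf [set (n%:R)%:E | n in [set n | (1 <= n)%N /\ A (iter n T x)]].
(* nat-valued first return time; 0 if x never returns (a mu-null event) *)
Definition hit (T : X -> X) (A : set X) (x : X) : nat :=
  match pselect (returns T A x) with
  | left h => ex_minn (P := fun n => (1 <= n)%N && `[< A (iter n T x) >])
      (let: ex_intro n (conj h1 h2) := h in
         ex_intro _ n (introT andP (conj h1 (asboolT h2))))
  | right _ => 0%N
  end.
(* first return map T_A x = T^{phi_A x} x (= x if x never returns) *)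
Definition TA (T : X -> X) (A : set X) (x : X) : X := iter (hit T A x) T x.

Definition muPhi (mu : set X -> \bar R) (T : X -> X) (A : set X)
  (x : X) : {ptws nat -> \bar R} :=
  fun j => (mu A * phi T A (iter j (TA T A) x))%E.
Definition Psi (S : Type) (T : X -> X) (A : set X) (psiA : X -> S)
  (x : X) : {ptws nat -> S} := fun j => psiA (iter j.+1 (TA T A) x).
Definition Psit (S : Type) (T : X -> X) (A : set X) (psiA : X -> S)
  (x : X) : {ptws nat -> S} := fun j => psiA (iter j (TA T A) x).

Definition condm (mu : set X -> \bar R) (B : set X) : set X -> \bar R :=
  fun A => (mu (B `&` A) * (fine (mu B))^-1%:E)%E.

Definition inP (mu nu : set X -> \bar R) :=
  [/\ nu set0 = 0%E, (forall A, measurable A -> (0 <= nu A)%E),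
      semi_sigma_additive nu, nu setT = 1%E &
      forall A, measurable A -> mu A = 0%E -> nu A = 0%E].

Definition dP (nu nu' : set X -> \bar R) : R :=
  2 * sup [set `|fine (nu A) - fine (nu' A)| | A in measurable].

Definition compactP (mu : set X -> \bar R) (K : set (set X -> \bar R)) :=
  K `<=` inP mu /\
  forall nus : nat -> (set X -> \bar R), (forall n, K (nus n)) ->
    exists (h : nat -> nat) (nu : set X -> \bar R),
      {homo h : m n / (m < n)%N >-> (m < n)%N} /\ K nu /\
      (fun n => dP (nus (h n)) nu) @ \oo --> 0.

Definition pushT (T : X -> X) (tau : X -> nat) (nu : set X -> \bar R) :
  set X -> \bar R := fun A => nu ((fun x => iter (tau x) T x) @^-1` A).

Definition measurable_nat (tau : X -> nat) :=
  forall n, measurable (tau @^-1` [set n]).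

Definition wconv (S : topologicalType) (mu : {measure set X -> \bar R})
  (B : nat -> set X) (Z : nat -> X -> S)
  d' (Om : measurableType d') (P : probability Om R) (Z0 : Om -> S) :=
  forall g : S -> R, continuous g -> (exists M, forall s, `|g s| <= M) ->
    (fun l => (fine (mu (B l)))^-1 * Rintegral mu (B l) (g \o Z l))
      @ \oo --> Rintegral P setT (g \o Z0).

End Defs.

Definition std_exp {R : realType} d (Om : measurableType d)
  (P : probability Om R) (E : Om -> \bar R) :=
  forall t : R, 0 <= t -> P (E @^-1` `]t%:E, +oo[%classic) = (expR (- t))%:E.

Definition indep_family {R : realType} d (Om : measurableType d)
  (P : probability Om R) (S : topologicalType)
  (E : nat -> Om -> \bar R) (Y : nat -> Om -> S) :=
  forall (n : nat) (Bs : nat -> set (\bar R)) (Cs : nat -> set S),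
    (forall i, measurable (Bs i)) -> (forall i, borel_sets (Cs i)) ->
    P (\bigcap_(i in [set i | (i < n)%N]) (E i @^-1` Bs i `&` Y i @^-1` Cs i))
    = (\prod_(i < n) (P (E i @^-1` Bs i) * P (Y i @^-1` Cs i)))%E.

(* Main.v *)
Require Import Defs.
From HB Require Import structures.
From mathcomp Require Import all_boot all_order all_algebra.
From mathcomp Require Import all_classical all_reals all_analysis measurable_realfun.
From mathcomp Require Import lra ring zify.
Set Implicit Arguments. Unset Strict Implicit. Unset Printing Implicit Defensive.
Import Order.TTheory GRing.Theory Num.Theory numFieldNormedType.Exports.
Local Open Scope classical_set_scope.
Local Open Scope ring_scope.

(* Write [Q V] for the event that the first return of [x] to [A_l] lies in [V].
   The sets [Q V], and [{phi > n}] intersected with [Q V], are almost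
   [T]-invariant when [mu (A_l)] is small.  By the ergodic theorem (in the weak
   form of a coboundary estimate) every probability [nu << mu] asymptotically
   gives an almost invariant sequence of sets the same mass as [mu], uniformly
   over compact sets of such [nu].  Assumptions (A) and (B) move the conditional
   measures into such a compact set before the next visit to [A_l].
   Consequently, the distribution function [g n = mu {phi > n}], which satisfies
   [g n - g n.+1 = mu (A_l `&` {phi > n})], is close to [exp (- n mu (A_l))],
   and under [mu_{A_l}] the observable, the scaled return time and the first
   return point become asymptotically independent.  Since [T_{A_l}] preserves
   [mu_{A_l}], an induction gives the limit of the probability of every finite
   cylinder built from time intervals and [psi]-continuity sets (the passage from
   the pi-system to all continuity sets being a Dynkin argument).  As
   [[0, oo]^N * F^N] is compact, a continuous function on it is uniformly close
   to a finite combination of such cylinders, which yields weak convergence. *)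

(** The two assumptions enter asymmetrically. An event decided by the first return point alone does
    not change along the orbit until the next visit, so in (A) [tau] may be of any size; an event
    that also involves [{phi > n}] is shifted by [tau], and the smallness of [mu (A_l) tau] in (B)
    makes the shift harmless. (B) for the whole of [F] compares [mu_{A_l}] with [mu], which closes
    the difference equation for [g]; (A) separates the waiting time from the return point, and (B)
    for smaller sets splits off the observable. All this must hold for target sets [V] varying with
    [l], because the induction takes for [V] the cylinder of the remaining returns. Two obstacles
    shape the rest. The integrals defining weak convergence involve functions not known to be
    measurable off the recurrent points, so the approximation by cylinders is made on recurrent
    points, where it also yields measurability. And the limit process must be realised although the
    space carrying [psi] has no topology, so an infinite product measure is built by sections. *)

Section BoundedIntegrals.
Context (R : realType) (d : measure_display) (X : measurableType d).
Variable mu : probability X R.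
Implicit Types (f g : X -> R) (B C : set X).

Definition bounded_measurable f :=
  measurable_fun setT f /\ exists M : R, forall x, `|f x| <= M.

Definition pr B : R := fine (mu B).

Lemma EFin_pr B : measurable B -> (pr B)%:E = mu B.
Proof. by move=> mB; rewrite /pr fineK// fin_num_measure. Qed.

Lemma pr_ge0 B : 0 <= pr B.
Proof. exact: fine_ge0. Qed.

Lemma pr_setT : pr setT = 1.
Proof. by rewrite /pr probability_setT. Qed.

Lemma pr_set0 : pr set0 = 0.
Proof. by rewrite /pr measure0. Qed.

Lemma le_pr B C : measurable B -> measurable C -> B `<=` C -> pr B <= pr C.
Proof.
move=> mB mC BC; rewrite /pr fine_le// ?fin_num_measure//.
by apply: le_measure; rewrite ?inE.
Qed.

Lemma pr_le1 B : measurable B -> pr B <= 1.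
Proof. by move=> mB; rewrite -pr_setT le_pr. Qed.

Lemma prDI B C : measurable B -> measurable C ->
  pr B = pr (B `&` C) + pr (B `\` C).
Proof.
move=> mB mC; rewrite addrC /pr -fineD ?fin_num_measure//; last 2 first.
- exact: measurableD.
- exact: measurableI.
by rewrite -measureDI.
Qed.

Lemma prU_le B C : measurable B -> measurable C ->
  pr (B `|` C) <= pr B + pr C.
Proof.
move=> mB mC; rewrite -lee_fin EFinD !EFin_pr//; last exact: measurableU.
exact: measureU2.
Qed.

Lemma le_prU B C D : measurable B -> measurable C -> measurable D ->
  B `<=` C `|` D -> pr B <= pr C + pr D.
Proof.
move=> mB mC mD BCD; apply: le_trans (prU_le mC mD).
by apply: le_pr => //; exact: measurableU.
Qed.

Lemma prC B : measurable B -> pr (~` B) = 1 - pr B.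
Proof.
move=> mB; rewrite -pr_setT (prDI measurableT mB) setTI setTD; ring.
Qed.

Lemma bounded_measurable_integrable f (D : set X) : measurable D ->
  bounded_measurable f -> mu.-integrable D (EFin \o f).
Proof.
move=> mD [mf [M fM]]; apply: measurable_bounded_integrable => //.
- by apply: (@le_lt_trans _ _ 1%E); [exact: probability_le1|exact: ltry].
- exact: measurable_funTS.
- exists M; split; first exact: num_real.
  by move=> y My x _; exact: le_trans (fM x) (ltW My).
Qed.

Lemma bounded_measurable_cst (c : R) : bounded_measurable (fun=> c).
Proof. by split; [exact: measurable_cst | exists `|c|]. Qed.

Lemma bounded_measurableD f g : bounded_measurable f ->
  bounded_measurable g -> bounded_measurable (fun x => f x + g x).
Proof.
move=> [mf [M fM]] [mg [N gN]]; split; first exact: measurable_funD.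
by exists (M + N) => x; apply: le_trans (ler_normD _ _) _; exact: lerD.
Qed.

Lemma bounded_measurableB f g : bounded_measurable f ->
  bounded_measurable g -> bounded_measurable (fun x => f x - g x).
Proof.
move=> [mf [M fM]] [mg [N gN]]; split; first exact: measurable_funB.
by exists (M + N) => x; apply: le_trans (ler_normB _ _) _; exact: lerD.
Qed.

Lemma bounded_measurableM f g : bounded_measurable f ->
  bounded_measurable g -> bounded_measurable (fun x => f x * g x).
Proof.
move=> [mf [M fM]] [mg [N gN]]; split; first exact: measurable_funM.
by exists (M * N) => x; rewrite normrM; exact: ler_pM.
Qed.

Lemma bounded_measurable_max f g : bounded_measurable f ->
  bounded_measurable g -> bounded_measurable (fun x => Num.max (f x) (g x)).
Proof.
move=> [mf [M fM]] [mg [N gN]]; split; first exact: measurable_maxr.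
exists (M + N) => x.
have M0 := le_trans (normr_ge0 _) (fM x); have N0 := le_trans (normr_ge0 _) (gN x).
have := fM x; have := gN x; rewrite /Num.max; case: ifP => _ ? ?; lra.
Qed.

Lemma bounded_measurable_comp f (S : X -> X) : measurable_fun setT S ->
  bounded_measurable f -> bounded_measurable (fun x => f (S x)).
Proof.
move=> mS [mf [M fM]]; split; last by exists M => x; exact: fM.
exact: (measurableT_comp mf mS).
Qed.

Lemma bounded_measurable_indic B : measurable B ->
  bounded_measurable (\1_B : X -> R).
Proof.
move=> mB; split; first exact: measurable_indic.
by exists 1 => x; rewrite indicE; case: (_ \in _); rewrite ?normr1 ?normr0.
Qed.

Lemma Rint_indic B : measurable B -> \int[mu]_x (\1_B x : R) = pr B.
Proof.
by move=> mB; rewrite /Rintegral integral_indic// setIT.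
Qed.

Lemma Rint_indicM B f : measurable B ->
  \int[mu]_x (f x * \1_B x) = \int[mu]_(x in B) f x.
Proof.
move=> mB; rewrite [RHS]Rintegral_mkcond; apply: eq_Rintegral => x _.
by rewrite patchE indicE; case: (_ \in _); rewrite ?mulr1 ?mulr0.
Qed.

Lemma le_Rint f g : bounded_measurable f -> bounded_measurable g ->
  (forall x, f x <= g x) -> \int[mu]_x f x <= \int[mu]_x g x.
Proof.
move=> bf bg fg; apply: le_Rintegral => //;
  exact: bounded_measurable_integrable.
Qed.

Lemma RintD f g : bounded_measurable f -> bounded_measurable g ->
  \int[mu]_x (f x + g x) = \int[mu]_x f x + \int[mu]_x g x.
Proof.
move=> bf bg; apply: RintegralD => //; exact: bounded_measurable_integrable.
Qed.

Lemma RintB f g : bounded_measurable f -> bounded_measurable g ->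
  \int[mu]_x (f x - g x) = \int[mu]_x f x - \int[mu]_x g x.
Proof.
move=> bf bg; apply: RintegralB => //; exact: bounded_measurable_integrable.
Qed.

Lemma RintZ f (c : R) : bounded_measurable f ->
  \int[mu]_x (c * f x) = c * \int[mu]_x f x.
Proof.
move=> bf; apply: RintegralZl => //; exact: bounded_measurable_integrable.
Qed.

Lemma Rint_cst (c : R) : \int[mu]_x c = c.
Proof. by rewrite Rintegral_cst// -[fine _]/(pr setT) pr_setT mulr1. Qed.

End BoundedIntegrals.

Lemma exists2_and {Y : Type} {A B : Y -> Prop} : (exists2 y, A y & B y) -> exists y, A y /\ B y.
Proof. by case=> y ? ?; exists y. Qed.

(** * Almost invariant sets have asymptotically the same mass under all laws of a compact set *)

Section ErgodicAverages.
Context (R : realType) (d : measure_display) (X : measurableType d).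
Variables (mu : probability X R) (T : X -> X).
Hypotheses (mpT : measure_preserving mu T) (ergT : ergodic mu T).

Local Notation pr_of := pr.
Local Notation pr := (pr mu).

Lemma measurable_preim (B : set X) : measurable B -> measurable (T @^-1` B).
Proof. by move=> mB; rewrite -[X in measurable X]setTI; exact: (proj1 mpT). Qed.

Lemma measurable_fun_iter n : measurable_fun setT (iter n T).
Proof.
elim: n => [|n IH]; first exact: measurable_id.
by rewrite (_ : iter n.+1 T = T \o iter n T)//; exact: measurableT_comp (proj1 mpT) IH.
Qed.

Lemma measurable_preim_iter n (B : set X) :
  measurable B -> measurable (iter n T @^-1` B).
Proof. by move=> mB; rewrite -[X in measurable X]setTI; exact: measurable_fun_iter. Qed.

Lemma pr_preim (B : set X) : measurable B -> pr (T @^-1` B) = pr B.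
Proof. by move=> mB; congr fine; exact: (proj2 mpT). Qed.

Lemma Rint_preim (f : X -> R) : bounded_measurable f ->
  \int[mu]_x f (T x) = \int[mu]_x f x.
Proof.
move=> bf; congr fine.
have mf : measurable_fun setT (EFin \o f) by apply/measurable_EFinP; case: bf.
have := @integral_pushforward _ _ X X R T (proj1 mpT) mu setT (EFin \o f) mf.
rewrite preimage_setT => <-//; last first.
  by apply: bounded_measurable_integrable => //; exact: bounded_measurable_comp (proj1 mpT) bf.
apply: eq_measure_integral; first exact: (proj1 mpT).
by move=> ? B mB _; exact: (proj2 mpT).
Qed.

Section Coboundary.
Variable f : X -> R.
Hypothesis bf : bounded_measurable f.

(** The maximum of 0 and the Birkhoff sums of [f] of length at most [n], as in Garsia's proof of the
    maximal ergodic theorem. *)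
Fixpoint max_sum n : X -> R :=
  if n is n'.+1 then fun x => Num.max 0 (f x + max_sum n' (T x)) else fun=> 0.

Lemma max_sum_bounded_measurable n : bounded_measurable (max_sum n).
Proof.
elim: n => [|n IH] /=; first exact: bounded_measurable_cst.
apply: bounded_measurable_max; first exact: bounded_measurable_cst.
by apply: bounded_measurableD => //; apply: bounded_measurable_comp (proj1 mpT) IH.
Qed.

Lemma max_sum_ge0 n x : 0 <= max_sum n x.
Proof. by case: n => //= n; rewrite le_max lexx. Qed.

Lemma max_sumS_ge n x : f x + max_sum n (T x) <= max_sum n.+1 x.
Proof. by rewrite /= le_max lexx orbT. Qed.

Lemma max_sum_nondecreasing n x : max_sum n x <= max_sum n.+1 x.
Proof.
elim: n x => [|n IH] x; first exact: max_sum_ge0.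
rewrite [leLHS]/= [leRHS]/= ge_max le_max lexx/= le_max; apply/orP; right.
by rewrite lerD2l IH.
Qed.

Lemma max_sum_increment (K : R) n x : (forall x, `|f x| <= K) ->
  max_sum n.+1 x - max_sum n x <= K.
Proof.
move=> fK; elim: n x => [|n IH] x.
  rewrite /= subr0 addr0 ge_max (le_trans (normr_ge0 _) (fK x))/=.
  exact: le_trans (ler_norm _) (fK x).
have := IH (T x); have := max_sum_nondecreasing n (T x).
have := fK x; rewrite ler_norml => /andP[? ?].
rewrite [max_sum n.+2 x]/= [max_sum n.+1 x]/= -/(max_sum n.+1 (T x)).
move: (max_sum n.+1 (T x)) (max_sum n (T x)) => a b ? ?.
rewrite /Num.max; do 2 case: ltP => ?; lra.
Qed.

(* If [max_sum ^~ x] is unbounded for a.e. [x], then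
   [max_sum n.+1 - max_sum n \o T] tends to [f], although its integral is
   nonnegative; hence, by ergodicity, [max_sum ^~ x] converges a.e. *)
Lemma coboundary_bound (e : R) : \int[mu]_x f x < 0 -> 0 < e ->
  exists h k : X -> R, [/\ bounded_measurable h, bounded_measurable k,
    forall x, 0 <= k x, \int[mu]_x k x < e & forall x, f x <= h x - h (T x) + k x].
Proof.
move=> f0 e0; have [mf [K fK]] := bf.
pose k n x := max_sum n.+1 x - max_sum n x.
have bk n : bounded_measurable (k n).
  by apply: bounded_measurableB; exact: max_sum_bounded_measurable.
have k0 n x : 0 <= k n x by rewrite subr_ge0 max_sum_nondecreasing.
have kK n x : k n x <= K by exact: max_sum_increment.
suff [n kn] : exists n, \int[mu]_x k n x < e.
  exists (max_sum n), (k n); split => //; first exact: max_sum_bounded_measurable.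
  by move=> x; have := max_sumS_ge n x; rewrite /k; lra.
pose Z : set X := \bigcap_M \bigcup_n [set x | M%:R <= max_sum n x].
have mZ : measurable Z.
  apply: bigcap_measurable => // M _; apply: bigcup_measurable => n _.
  rewrite -[X in measurable X]setTI.
  by apply: measurable_fun_le => //; case: (max_sum_bounded_measurable n).
(* One application of [T] changes the maximal sums by at most [K]; asking for the level
   [M + truncn K + 1] instead of [M] absorbs this. *)
have TZ : T @^-1` Z = Z.
  apply/seteqP; split => x Zx M _ /=.
  - have [N _] := Zx (M + Num.truncn K).+1 I; rewrite /= => hN; exists N.+1 => //=.
    have K0 : 0 <= K := le_trans (normr_ge0 _) (fK x).
    have /andP[_ Kt] := Num.Theory.truncn_itv K0.
    have := fK x; rewrite ler_norml => /andP[? ?].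
    rewrite le_max; apply/orP; right.
    by move: hN; rewrite -natr1 natrD; move: Kt; rewrite -natr1; lra.
  - have [N _] := Zx (M + Num.truncn K).+1 I; rewrite /= => hN; exists N.-1 => //=.
    have K0 : 0 <= K := le_trans (normr_ge0 _) (fK x).
    have /andP[_ Kt] := Num.Theory.truncn_itv K0.
    have := fK x; rewrite ler_norml => /andP[? ?].
    case: N hN => [|N] /=.
      by have := max_sum_ge0 0 (T x); have := ler0n R (M + Num.truncn K); rewrite -natr1 /=; lra.
    have M0 := max_sum_ge0 N (T x); have := ler0n R M.
    move: Kt; rewrite -!natr1 natrD.
    by rewrite /Num.max; case: (ltP 0 (f x + max_sum N (T x))) => *; lra.
have cK : mu.-integrable setT (EFin \o (fun=> K)).
  by apply: bounded_measurable_integrable => //; exact: bounded_measurable_cst.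
have [Z0|Z1] := ergT mZ TZ.
- have : (\int[mu]_x (k n x)%:E)%E @[n --> \oo] --> (\int[mu]_x (0 : R)%:E)%E.
    have := @dominated_convergence _ X R mu setT measurableT
      (fun n => EFin \o k n) (EFin \o (fun=> 0)) (EFin \o (fun=> K)).
    case=> //.
    + by move=> n; apply/measurable_EFinP; case: (bk n).
    + exact: measurable_cst.
    + exists Z; split => // x /= nx.
      move: nx; apply: contra_notP => nZ _; apply/fine_cvgP.
      split; first by near=> n.
      have [M _ hM] : exists2 M : nat, True & forall n, max_sum n x < M%:R.
        apply: contra_notP nZ => nh M _ /=; apply: contrapT => nM.
        apply: nh; exists M => // n; rewrite ltNge; apply/negP => Mn.
        by apply: nM; exists n.
      have cvm : cvgn (max_sum ^~ x).
        apply: nondecreasing_is_cvgn.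
          by apply/nondecreasing_seqP => n; exact: max_sum_nondecreasing.
        by exists M%:R => _ [n _ <-]; exact: ltW.
      rewrite -[X in _ --> X](subrr (limn (max_sum ^~ x))).
      apply: cvgB => //.
      by rewrite -[X in X @ _ --> _]/((fun n => (max_sum ^~ x) (n.+1))) cvg_shiftS.
    + by exists set0; split => // x /= []; move=> n _; rewrite lee_fin ger0_norm.
  rewrite integral0 => /fine_cvgP[_ /cvgrPdist_lt/(_ _ e0)[n _ /(_ n (leqnn _))]].
  rewrite /= sub0r normrN => kn; exists n; exact: le_lt_trans (ler_norm _) kn.
- pose w n x := max_sum n.+1 x - max_sum n (T x).
  have bw n : bounded_measurable (w n).
    apply: bounded_measurableB; first exact: max_sum_bounded_measurable.
    by apply: bounded_measurable_comp (proj1 mpT) _; exact: max_sum_bounded_measurable.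
  have wk n : \int[mu]_x w n x = \int[mu]_x k n x.
    have bm := max_sum_bounded_measurable.
    rewrite RintB//; last exact: bounded_measurable_comp (proj1 mpT) _.
    by rewrite Rint_preim// -RintB.
  have : (\int[mu]_x (w n x)%:E)%E @[n --> \oo] --> (\int[mu]_x (f x)%:E)%E.
    have := @dominated_convergence _ X R mu setT measurableT
      (fun n => EFin \o w n) (EFin \o f) (EFin \o (fun=> K)).
    case=> //.
    + by move=> n; apply/measurable_EFinP; case: (bw n).
    + exact/measurable_EFinP.
    + have ZC0 : mu (~` Z) = 0%E by rewrite probability_setC// Z1 subee.
      exists (~` Z); split; first exact: measurableC.
        exact: ZC0.
      move=> x /= nx Zx; apply: nx => _; apply/fine_cvgP.
      split; first by near=> n.
      (* Once [max_sum n (T x)] exceeds [K], the 0 in the maximum is inactive, so [w n x] equals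
         [f x] exactly. *)
      apply: (@cvg_near_cst _ _ _ _ \oo).
      have := Zx; rewrite -TZ => /(_ (Num.truncn K).+1 I)[N _ /= hN].
      exists N => // n /= Nn.
      have mon : max_sum N (T x) <= max_sum n (T x).
        apply: (@nondecreasing_seqP _ _ (max_sum ^~ (T x))).1 => // j.
        exact: max_sum_nondecreasing.
      have /andP[_ Kt] := Num.Theory.truncn_itv (le_trans (normr_ge0 _) (fK x)).
      have := fK x; rewrite ler_norml => /andP[? ?].
      rewrite /w /= /Num.max; case: ltP => ?; apply/eqP; lra.
    + exists set0; split => // x /= []; move=> n _; rewrite lee_fin.
      have := fK x; rewrite !ler_norml => /andP[? ?]; have := max_sum_ge0 n (T x).
      by rewrite /w /= /Num.max; case: ltP => ? ?; lra.
  have fin : (\int[mu]_x (f x)%:E)%E \is a fin_num.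
    by apply: integrable_fin_num => //; exact: bounded_measurable_integrable.
  rewrite -(fineK fin) => /fine_cvgP[_ /cvgrPdist_lt] /(_ (- \int[mu]_x f x)).
  rewrite oppr_gt0 => /(_ f0)[n _ /(_ n (leqnn _))] /=.
  rewrite -[fine _]/(\int[mu]_x f x) -[X in `|_ - X|]/(\int[mu]_x w n x) wk ltr_norml => /andP[+ _].
  have : 0 <= \int[mu]_x k n x by apply: Rintegral_ge0 => x _.
  lra.
Unshelve. all: by end_near.
Qed.
End Coboundary.

Definition asymptotically_invariant (E : nat -> set X) :=
  (forall l, measurable (E l)) /\
  pr ((E l `\` T @^-1` E l) `|` (T @^-1` E l `\` E l)) @[l --> \oo] --> 0.

(** After [f] is centred to a negative mean it lies below a coboundary plus a small function. Over
    [E l] the coboundary [h - h \o T] integrates, by invariance of [mu], to the integral of [h \o T]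
    against [\1_(E l) \o T - \1_(E l)], which lives on the small symmetric difference. *)
Lemma asymptotically_invariant_upper (f : X -> R) (E : nat -> set X) (e : R) :
  bounded_measurable f -> asymptotically_invariant E -> 0 < e ->
  \forall l \near \oo,
    \int[mu]_(x in E l) f x - (\int[mu]_x f x) * pr (E l) < e.
Proof.
move=> bf [mE E0] e0; set c := \int[mu]_x f x.
(* The budget [e] is spent as [e / 2] on this shift, [e / 4] on [k] and [e / 4] on the
   coboundary. *)
pose f' x := f x - (c + e / 2).
have bf' : bounded_measurable f'.
  by apply: bounded_measurableB => //; exact: bounded_measurable_cst.
have f'0 : \int[mu]_x f' x < 0.
  rewrite RintB//; last exact: bounded_measurable_cst.
  by rewrite Rint_cst -/c; lra.
have e4 : 0 < e / 4 by lra.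
have [h [k [bh bk k0 ke f'hk]]] := coboundary_bound bf' f'0 e4.
have [_ [M hM]] := bh.
pose D l := (E l `\` T @^-1` E l) `|` (T @^-1` E l `\` E l).
have mD l : measurable (D l).
  by apply: measurableU; apply: measurableD => //; exact: measurable_preim.
have M1 : 0 < `|M| + 1 by have := normr_ge0 M; lra.
have e4M : 0 < e / 4 / (`|M| + 1) by exact: divr_gt0.
move/cvgrPdist_lt : E0 => /(_ _ e4M); apply: filterS => l.
rewrite sub0r normrN ger0_norm ?pr_ge0// -/(D l) ltr_pdivlMr// => DM.
have bE : bounded_measurable (\1_(E l) : X -> R) by exact: bounded_measurable_indic.
have bTE : bounded_measurable (\1_(E l) \o T : X -> R).
  exact: bounded_measurable_comp (proj1 mpT) bE.
have bDl : bounded_measurable (\1_(D l) : X -> R) by exact: bounded_measurable_indic.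
have bhT : bounded_measurable (fun x => h (T x)) := bounded_measurable_comp (proj1 mpT) bh.
have le1 : \int[mu]_x (f' x * \1_(E l) x) <=
    \int[mu]_x ((h x * \1_(E l) x - h (T x) * \1_(E l) x) + k x).
  apply: le_Rint.
  - exact: bounded_measurableM.
  - apply: bounded_measurableD => //.
    by apply: bounded_measurableB; exact: bounded_measurableM.
  - move=> x; have := f'hk x; have := k0 x; rewrite indicE.
    by case: (_ \in _) => /=; lra.
have le2 : \int[mu]_x (h (T x) * \1_(E l) (T x)) - \int[mu]_x (h (T x) * \1_(E l) x)
    <= \int[mu]_x ((`|M| + 1) * \1_(D l) x).
  rewrite -RintB; [|exact: bounded_measurableM|exact: bounded_measurableM].
  apply: le_Rint.
  - by apply: bounded_measurableB; exact: bounded_measurableM.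
  - by apply: bounded_measurableM => //; exact: bounded_measurable_cst.
  - move=> x; rewrite !indicE.
    have := hM (T x); have := ler_norm M; rewrite ler_norml => ? /andP[? ?].
    have [ETx|ETx] := boolP (T x \in E l); have [Ex|Ex] := boolP (x \in E l);
      have [Dx|Dx] := boolP (x \in D l) => /=; try lra.
    + exfalso; move/negP : Dx; apply; rewrite inE; right; split.
        by rewrite inE in ETx.
      by move=> Ex'; move/negP : Ex; apply; rewrite inE.
    + exfalso; move/negP : Dx; apply; rewrite inE; left; split.
        by rewrite inE in Ex.
      by move=> Ex'; move/negP : ETx; apply; rewrite inE.
have fE : \int[mu]_x (f' x * \1_(E l) x) =
    \int[mu]_(x in E l) f x - (c + e / 2) * pr (E l).
  rewrite -(Rint_indicM mu f (mE l)) -(Rint_indic mu (mE l)) -RintZ// -RintB//.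
  - by apply: eq_Rintegral => x _; rewrite mulrBl.
  - exact: bounded_measurableM.
  - by apply: bounded_measurableM => //; exact: bounded_measurable_cst.
move: le1 le2; rewrite fE RintD//; last first.
  by apply: bounded_measurableB; exact: bounded_measurableM.
rewrite RintB; [|exact: bounded_measurableM|exact: bounded_measurableM].
have -> : \int[mu]_x (h (T x) * \1_(E l) (T x)) = \int[mu]_x (h x * \1_(E l) x).
  by rewrite (Rint_preim (f := fun x => h x * \1_(E l) x))//; exact: bounded_measurableM.
rewrite RintZ// Rint_indic//.
have := pr_le1 mu (mE l); have := pr_ge0 mu (E l).
by nra.
Qed.

Lemma asymptotically_invariant_bounded (f : X -> R) (E : nat -> set X) :
  bounded_measurable f -> asymptotically_invariant E ->
  (\int[mu]_(x in E l) f x - (\int[mu]_x f x) * pr (E l)) @[l --> \oo] --> 0.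
Proof.
move=> bf aE; apply/cvgrPdist_lt => e e0.
have bN : bounded_measurable (fun x => (-1) * f x).
  by apply: bounded_measurableM => //; exact: bounded_measurable_cst.
have := asymptotically_invariant_upper bf aE e0.
have := asymptotically_invariant_upper bN aE e0.
apply: filterS2 => l; have mE := aE.1 l.
rewrite RintZ// RintegralZl//; last exact: bounded_measurable_integrable.
by rewrite sub0r normrN ltr_norml => *; apply/andP; split; lra.
Qed.

(** The density [u] of [nu] is cut at a level [K]: the bounded part falls under the previous lemma,
    and [{u > K}] has small [nu]-mass because [u] is finite almost everywhere. *)
Lemma asymptotically_invariant_pr (nu : probability X R) (E : nat -> set X) :
  (forall B, measurable B -> mu B = 0%E -> nu B = 0%E) ->
  asymptotically_invariant E ->
  (pr_of nu (E l) - pr (E l)) @[l --> \oo] --> 0.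
Proof.
move=> numu aE; have mE := aE.1.
have numu' : nu `<< mu.
  by apply/null_content_dominatesP => B mB B0; exact: numu.
have [u [u0 iu nuu]] := radon_nikodym_finite numu'.
have mu_ : measurable_fun setT u by case/integrableP : iu.
pose B (K : nat) := [set x | (u x <= K%:R%:E)%E].
have mB K : measurable (B K).
  by rewrite -[X in measurable X]setTI; exact: emeasurable_fun_infty_c.
pose f (K : nat) x := fine (u x) * \1_(B K) x.
have bf K : bounded_measurable (f K).
  split.
    apply: measurable_funM; last exact: measurable_indic.
    by apply: measurableT_comp => //; exact: measurable_fine.
  exists K%:R => x; rewrite /f indicE; have [xB|_] := boolP (x \in B K); last first.
    by rewrite mulr0 normr0.
  rewrite mulr1; move: xB (u0 x); rewrite inE /B /=.
  by case: (u x) => [r| |]//=; rewrite !lee_fin => rK r0; rewrite ger0_norm.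
have intf K (C : set X) : measurable C ->
    \int[mu]_(x in C) f K x = pr_of nu (C `&` B K).
  move=> mC; rewrite /pr_of nuu; last exact: measurableI.
  congr fine; rewrite integral_mkcondr; apply: eq_integral => x _.
  rewrite /f patchE indicE; case: ifPn => [|_]; last by rewrite mulr0.
  rewrite mulr1 inE /B /=; move: (u0 x).
  by case: (u x) => [r| |].
have BC0 : pr_of nu (~` B K) @[K --> \oo] --> 0.
  have : (nu \o (fun K => ~` B K)) K @[K --> \oo] --> nu (\bigcap_K (~` B K)).
    apply: nonincreasing_cvg_mu.
    - by apply: (le_lt_trans (probability_le1 _ _)); [exact: measurableC|rewrite ltry].
    - by move=> K; exact: measurableC.
    - by apply: bigcap_measurable => // K _; exact: measurableC.
    - move=> m n mn; apply/subsetPset => x /= nB; apply: contra_not nB.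
      by move=> /le_trans; apply; rewrite lee_fin ler_nat.
  rewrite (_ : nu (\bigcap_K (~` B K)) = 0%E).
    by move=> /fine_cvgP[].
  have mI : measurable (\bigcap_K (~` B K)).
    by apply: bigcap_measurable => // K _; exact: measurableC.
  apply: numu => //.
  have [N [mN N0 sN]] := integrable_ae measurableT iu.
  apply: (subset_measure0 (B := N)) => // x /= xB; apply: sN => /= /(_ I).
  have := u0 x; move: xB; rewrite /bigcap /B /=.
  case: (u x) => [r| |]// + r0 _ => /(_ (Num.truncn r).+1 I); apply.
  by rewrite lee_fin ltW// truncnS_gt.
apply/cvgrPdist_lt => e e0.
have e3 : 0 < e / 3 by lra.
move/cvgrPdist_lt : BC0 => /(_ _ e3)[K _ /(_ K (leqnn K))] /=.
rewrite sub0r normrN ger0_norm ?pr_ge0// => BK.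
have := asymptotically_invariant_bounded (bf K) aE.
move/cvgrPdist_lt => /(_ _ e3); apply: filterS => l.
rewrite !sub0r !normrN !intf// setTI.
have := prDI nu (mE l) (mB K); have := prC nu (mB K).
have : pr_of nu (E l `\` B K) <= pr_of nu (~` B K).
  by apply: le_pr; [exact: measurableD|exact: measurableC|move=> x []].
have := pr_ge0 nu (E l `\` B K).
have := pr_le1 mu (mE l); have := pr_ge0 mu (E l).
rewrite !ltr_norml => ? ? ? ? ? -> /andP[? ?]; apply/andP; split; nra.
Qed.

(** [inP] constrains a set function on measurable sets only; setting it to 0 elsewhere gives the
    nonnegativity on all sets that a measure structure demands. *)
Lemma inP_probability (nu : set X -> \bar R) : inP mu nu ->
  exists nu' : probability X R, forall B, measurable B -> nu B = nu' B.
Proof.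
move=> [nu0 nuge0 nuS nuT _].
pose m B := if `[< measurable B >] then nu B else 0%E.
have mE B : measurable B -> m B = nu B by move=> mB; rewrite /m asboolT.
have m0 : m set0 = 0%E by rewrite mE.
have mge0 B : (0 <= m B)%E by rewrite /m; case: asboolP => // /nuge0.
have mS : semi_sigma_additive m.
  move=> F mF tF mUF; rewrite mE//.
  rewrite (_ : (fun n => _) = (fun n => \sum_(0 <= i < n) nu (F i))%E).
    exact: nuS.
  by apply/funext => n; apply: eq_bigr => i _; rewrite mE.
have mT : m setT = 1%E by rewrite mE.
pose m1 := isMeasure.Build d X R m m0 mge0 mS.
pose m2 : {measure set X -> \bar R} := HB.pack m m1.
pose m3 := Measure_isProbability.Build d X R m2 mT.
pose m4 : probability X R := HB.pack m m1 m3.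
by exists m4 => B mB; rewrite -mE.
Qed.

(** A [sup] carries information only for a bounded set; [c] provides the bound. The factor 2 in [dP]
    only gives room. *)
Lemma dP_ge (nu nu' : set X -> \bar R) (B : set X) (c : R) :
  (forall C, measurable C -> `|fine (nu C) - fine (nu' C)| <= c) ->
  measurable B -> `|fine (nu B) - fine (nu' B)| <= dP nu nu'.
Proof.
move=> nc mB; rewrite /dP.
have : `|fine (nu B) - fine (nu' B)| <=
    sup [set `|fine (nu A) - fine (nu' A)| | A in measurable].
  apply: ub_le_sup; last by exists B.
  by exists c => _ [C mC <-]; exact: nc.
have := normr_ge0 (fine (nu B) - fine (nu' B)); lra.
Qed.

Lemma inP_dP_ge (nu nu' : set X -> \bar R) (B : set X) :
  inP mu nu -> inP mu nu' -> measurable B ->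
  `|fine (nu B) - fine (nu' B)| <= dP nu nu'.
Proof.
move=> /inP_probability[n1 n1E] /inP_probability[n2 n2E]; apply: (@dP_ge _ _ _ 1) => C mC.
rewrite n1E// n2E//.
have := pr_le1 n1 mC; have := pr_ge0 n1 C.
have := pr_le1 n2 mC; have := pr_ge0 n2 C.
by rewrite /pr_of ler_norml => *; apply/andP; split; lra.
Qed.

(** Along a subsequence violating the claim, compactness gives a [dP]-limit [nu]. Since [dP]
    controls all measurable sets at once, it controls the moving sets [E l], and the violation
    passes to the single measure [nu]. *)
Lemma asymptotically_invariant_compact (K : set (set X -> \bar R))
    (rho : nat -> set X -> \bar R) (E : nat -> set X) :
  compactP mu K -> (forall l, K (rho l)) -> asymptotically_invariant E ->
  (fine (rho l (E l)) - pr (E l)) @[l --> \oo] --> 0.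
Proof.
move=> [KP cK] Krho aE; have mE := aE.1.
apply: contrapT => ncvg.
have [e e0 bad] : exists2 e : R, 0 < e &
    forall N, exists2 l, (N <= l)%N & e <= `|fine (rho l (E l)) - pr (E l)|.
  apply: contrapT => nex; apply: ncvg; apply/cvgrPdist_lt => e e0.
  apply: contrapT => nN; apply: nex; exists e => // N.
  apply: contrapT => nl; apply: nN; exists N => // l /= Nl.
  rewrite sub0r normrN ltNge; apply/negP => el; apply: nl; by exists l.
have [sel selP] := choice (fun N => exists2_and (bad N)).
(* Strictly increasing indices at which the error is at least [e]. *)
pose h0 := fix h0 n := if n is n'.+1 then sel (h0 n').+1 else sel 0%N.
have h0S n : (h0 n < h0 n.+1)%N by have [+ _] := selP (h0 n).+1.
have h0e n : e <= `|fine (rho (h0 n) (E (h0 n))) - pr (E (h0 n))|.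
  by case: n => [|n]; [have [] := selP 0%N|have [] := selP (h0 n).+1].
have [h [nu [hinc [Knu dnu]]]] := cK (fun n => rho (h0 n)) (fun n => Krho _).
have inc (g : nat -> nat) : (forall n, (g n < g n.+1)%N) -> forall n, (n <= g n)%N.
  by move=> gS; elim=> // n IH; exact: leq_ltn_trans IH (gS n).
have h0n := inc _ h0S; have hn := inc h (fun n => hinc _ _ (ltnSn n)).
have [nu' nuE] := inP_probability (KP _ Knu).
have numu B : measurable B -> mu B = 0%E -> nu' B = 0%E.
  by move=> mB B0; rewrite -nuE//; case: (KP _ Knu) => _ _ _ _; apply.
have := asymptotically_invariant_pr numu aE.
have e2 : 0 < e / 2 by lra.
move/cvgrPdist_lt => /(_ _ e2)[N _ hN].
move/cvgrPdist_lt : dnu => /(_ _ e2)[N' _ hN'].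
pose n := maxn N N'.
have := hN' n (leq_maxr _ _).
have : (N <= h0 (h n))%N.
  by apply: leq_trans (h0n _); apply: leq_trans (hn _); exact: leq_maxl.
move=> /hN; rewrite /= !sub0r !normrN => lt1 lt2.
have := h0e (h n); have := inP_dP_ge (KP _ (Krho (h0 (h n)))) (KP _ Knu) (mE (h0 (h n))).
rewrite nuE// -/(pr_of nu' _).
move: lt1 (le_lt_trans (ler_norm _) lt2).
set a := pr_of nu' _; set b := pr_of mu _; set c := fine _ => lt1 lt3 le1 le2.
have := ler_normD (c - a) (a - b); rewrite (_ : c - a + (a - b) = c - b); last by lra.
by lra.
Qed.

End ErgodicAverages.

(** * Orbits up to and beyond the first visit to a set *)

Section HittingTimes.
Context (R : realType) (d : measure_display) (X : measurableType d).
Variables (T : X -> X) (A : set X).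

Local Notation phi := (phi (R := R) T A).
Local Notation hit := (hit T A).
Local Notation TA := (TA T A).
Local Notation returns := (returns T A).

(** The event [{phi > n}] (see [lt_phi]). The orbit is watched from time 1 on, so [x] itself may lie
    in [A]. *)
Definition nohit n : set X :=
  [set x | forall j, (1 <= j <= n)%N -> ~ A (iter j T x)].

Definition first_hit n : set X := [set x |
  [/\ (1 <= n)%N, A (iter n T x) & forall j, (1 <= j < n)%N -> ~ A (iter j T x)]].

(** The event written [Q V] in the overview. Points without return must be excluded by hand, since
    [TA] fixes them by convention. *)
Definition after_hit (V : set X) : set X :=
  [set x | returns x /\ V (TA x)].

Lemma nohit0 : nohit 0 = setT.
Proof. by apply/seteqP; split => x // _ j /=; lia. Qed.

Lemma nohitS n : nohit n.+1 = T @^-1` (~` A `&` nohit n).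
Proof.
apply/seteqP; split => x /=.
- move=> nh; split; first by have := nh 1%N isT.
  by move=> j jn; rewrite -iterSr; apply: nh; lia.
- move=> [nA nh] [|[|j]] jn //.
  by rewrite iterSr; apply: nh; lia.
Qed.

Lemma nohit_le m n : (m <= n)%N -> nohit n `<=` nohit m.
Proof. by move=> mn x nh j jm; apply: nh; lia. Qed.

Lemma nohitD k n x : nohit k x -> nohit n (iter k T x) <-> nohit (k + n) x.
Proof.
move=> nk; split => nh j jn.
- have [jk|kj] := leqP j k; first by apply: nk; lia.
  by have := nh (j - k)%N; rewrite -iterD subnK; [apply; lia|lia].
- by rewrite -iterD; apply: nh; lia.
Qed.

Lemma first_hit_uniq m n x : first_hit m x -> first_hit n x -> m = n.
Proof.
move=> [m1 Am hm] [n1 An hn]; apply/eqP; rewrite eqn_leq.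
apply/andP; split; rewrite leqNgt; apply/negP => lt.
- by apply: (hm n) => //; lia.
- by apply: (hn m) => //; lia.
Qed.

Lemma first_hit_hit x : returns x -> first_hit (hit x) x.
Proof.
move=> rx; rewrite /Defs.hit; case: pselect => [h|//].
case: ex_minnP => n /andP[n1 /asboolP An] nmin; split => // j /andP[j1 jn] Aj.
have : (n <= j)%N by apply: nmin; rewrite j1; exact/asboolP.
lia.
Qed.

Lemma first_hit_returns n x : first_hit n x -> returns x.
Proof. by move=> [n1 An _]; exists n. Qed.

Lemma first_hitE n x : first_hit n x -> hit x = n.
Proof. by move=> fx; exact: first_hit_uniq (first_hit_hit (first_hit_returns fx)) fx. Qed.

Lemma first_hit_iter k n x : nohit k x ->
  first_hit n (iter k T x) <-> first_hit (n + k) x /\ (0 < n)%N.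
Proof.
move=> nk; split.
- move=> [n1 An hn]; split => //; split; [lia|by rewrite iterD|].
  move=> j jn; have [jk|kj] := leqP j k; first by apply: nk; lia.
  by have := hn (j - k)%N; rewrite -iterD subnK; [apply; lia|lia].
- move=> [[nk1 An hn] n0]; split => //; first by rewrite -iterD.
  by move=> j jn; rewrite -iterD; apply: hn; lia.
Qed.

(** Until [A] is visited, the first return point is the same seen from [x] and from any later point
    of the orbit. This exact invariance is what lets the measures be pushed forward by [T^tau]. *)
Lemma nohit_after_hit k (V : set X) x : nohit k x ->
  after_hit V (iter k T x) <-> after_hit V x.
Proof.
move=> nk; split => -[rx].
- have /(first_hit_iter _ nk)[fx _] := first_hit_hit rx.
  move=> VT; split; first exact: first_hit_returns fx.
  by move: VT; rewrite /Defs.TA (first_hitE fx) iterD.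
- have fx := first_hit_hit rx; have [h1 Ah _] := fx.
  have kh : (k < hit x)%N.
    by rewrite ltnNge; apply/negP => hk; apply: (nk (hit x)) => //; lia.
  have fk : first_hit (hit x - k) (iter k T x).
    by apply/(first_hit_iter _ nk); rewrite subnK; [split => //; lia|lia].
  move=> VT; split; first exact: first_hit_returns fk.
  by rewrite /Defs.TA (first_hitE fk) -iterD subnK//; lia.
Qed.

Lemma phi_returns x : returns x -> phi x = (hit x)%:R%:E.
Proof.
move=> /first_hit_hit[h1 Ah hmin]; apply/eqP; rewrite eq_le; apply/andP; split.
- by apply: ereal_inf_lbound; exists (hit x).
- apply: le_ereal_inf_tmp => _ [n [n1 An] <-]; rewrite lee_fin ler_nat.
  by rewrite leqNgt; apply/negP => lt; apply: (hmin n) => //; lia.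
Qed.

Lemma phi_noreturn x : ~ returns x -> phi x = +oo%E.
Proof.
move=> nr; rewrite /Defs.phi (_ : [set _ | n in _] = set0) ?ereal_inf0//.
by apply/seteqP; split => // y [n hn _]; apply: nr; exists n.
Qed.

Lemma nohit_hit n x : returns x -> nohit n x <-> (n < hit x)%N.
Proof.
move=> /first_hit_hit[h1 Ah hmin]; split.
- by move=> nh; rewrite ltnNge; apply/negP => hn; apply: (nh (hit x)) => //; lia.
- by move=> nh j jn; apply: hmin; lia.
Qed.

Lemma nohit_noreturn n x : ~ returns x -> nohit n x.
Proof. by move=> nr j /andP[j1 _] Aj; apply: nr; exists j. Qed.

Lemma lt_phi n x : (n%:R%:E < phi x)%E <-> nohit n x.
Proof.
have [rx|nr] := pselect (returns x).
- by rewrite phi_returns// lte_fin ltr_nat; split => /(nohit_hit n rx).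
- by rewrite phi_noreturn// ltry; split => // _; exact: nohit_noreturn.
Qed.

Lemma after_hit_bigcup V :
  after_hit V = \bigcup_n (first_hit n.+1 `&` iter n.+1 T @^-1` V).
Proof.
apply/seteqP; split => x /=.
- move=> [rx VT]; have fx := first_hit_hit rx; have [h1 _ _] := fx.
  exists (hit x).-1 => //; rewrite prednK//.
- move=> [n _ [fn Vn]]; split; first exact: first_hit_returns fn.
  by rewrite /Defs.TA (first_hitE fn).
Qed.

(** Has full measure ([pr_recurrent_set]) and is stable under [TA]; on it every iterate of [TA] is a
    genuine return and the default value of [hit] never shows. *)
Definition recurrent_set : set X :=
  [set x | forall n, exists2 m, (n <= m)%N & A (iter m T x)].

Lemma recurrent_setE : recurrent_set = lim_sup_set (fun n => iter n T @^-1` A).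
Proof.
apply/seteqP; split => x.
- by move=> rx n _; have [m nm Am] := rx n; exists m.
- by move=> rx n; have [m /= nm Am] := rx n I; exists m.
Qed.

Lemma recurrent_set_invariant : T @^-1` recurrent_set = recurrent_set.
Proof.
apply/seteqP; split => x rx n.
- have [m nm Am] := rx n; exists m.+1; first by lia.
  by rewrite iterSr.
- have [[|m] nm Am] := rx n.+1; first by lia.
  by exists m; [lia|rewrite -iterSr].
Qed.

Lemma recurrent_set_iter k x : recurrent_set x -> recurrent_set (iter k T x).
Proof.
by elim: k => //= k IH /IH; rewrite -[in X in X -> _]recurrent_set_invariant.
Qed.

Lemma recurrent_set_returns x : recurrent_set x -> returns x.
Proof. by move=> /(_ 1%N)[m m1 Am]; exists m. Qed.

Lemma recurrent_set_TA x : recurrent_set x -> recurrent_set (TA x).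
Proof. exact: recurrent_set_iter. Qed.

Lemma TA_mem x : recurrent_set x -> A (TA x).
Proof. by move=> /recurrent_set_returns/first_hit_hit[]. Qed.

End HittingTimes.

(** * Probabilities of hitting events for one set *)

Section HittingProbabilities.
Context (R : realType) (d : measure_display) (X : measurableType d).
Variables (mu : probability X R) (T : X -> X).
Hypothesis mpT : measure_preserving mu T.
Variable A : set X.
Hypothesis mA : measurable A.

Local Notation pr_of := pr.
Local Notation pr := (pr mu).
Local Notation phi := (phi (R := R) T A).
Local Notation hit := (hit T A).
Local Notation TA := (TA T A).
Local Notation returns := (returns T A).
Local Notation nohit := (nohit T A).
Local Notation first_hit := (first_hit T A).
Local Notation after_hit := (after_hit T A).
Local Notation recurrent_set := (recurrent_set T A).

Lemma measurable_nohit n : measurable (nohit n).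
Proof.
elim: n => [|n IH]; first by rewrite nohit0.
rewrite nohitS; apply: (measurable_preim mpT).
by apply: measurableI => //; exact: measurableC.
Qed.

Lemma pr_nohitS n : pr (nohit n.+1) = pr (nohit n) - pr (A `&` nohit n).
Proof.
have mn := measurable_nohit n.
rewrite nohitS (pr_preim mpT); last by apply: measurableI => //; exact: measurableC.
by rewrite (prDI mu mn mA) setDE (setIC A) (setIC (~` A)); lra.
Qed.

Lemma pr_nohit_step n : pr (nohit n) - pr (nohit n.+1) <= pr A.
Proof.
rewrite pr_nohitS opprB addrC subrK; apply: le_pr => //.
by apply: measurableI => //; exact: measurable_nohit.
Qed.

Lemma pr_nohit_sub n k : pr (nohit (n - k)) - pr (nohit n) <= k%:R * pr A.
Proof.
elim: k => [|k IH]; first by rewrite subn0 subrr mul0r.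
have [nk|kn] := leqP n k.
  have -> : (n - k.+1 = n - k)%N by lia.
  by have := pr_ge0 mu A; rewrite -natr1; nra.
have := pr_nohit_step (n - k.+1); have -> : (n - k.+1).+1 = (n - k)%N by lia.
by rewrite -natr1; lra.
Qed.

Lemma measurable_first_hit n : measurable (first_hit n).
Proof.
case: n => [|n]; first by rewrite (_ : first_hit 0 = set0)//; apply/seteqP; split => x // [].
rewrite (_ : first_hit n.+1 = iter n.+1 T @^-1` A `&` nohit n).
  by apply: measurableI; [exact: (measurable_preim_iter mpT)|exact: measurable_nohit].
apply/seteqP; split => x /=.
- by move=> [_ An hn]; split => // j jn; apply: hn; lia.
- by move=> [An hn]; split => // j jn; apply: hn; lia.
Qed.

Lemma measurable_after_hit V : measurable V -> measurable (after_hit V).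
Proof.
move=> mV; rewrite after_hit_bigcup; apply: bigcup_measurable => n _.
by apply: measurableI; [exact: measurable_first_hit|exact: (measurable_preim_iter mpT)].
Qed.

Lemma pr_bigcup (C : nat -> set X) : (forall n, measurable (C n)) ->
  trivIset setT C -> series (fun n => pr (C n)) @ \oo --> pr (\bigcup_n C n).
Proof.
move=> mC tC; have mU : measurable (\bigcup_n C n) by exact: bigcup_measurable.
have := @measure_semi_sigma_additive _ _ _ mu C mC tC mU.
rewrite -[X in _ --> X](@fineK _ (mu (\bigcup_n C n))) ?fin_num_measure//.
move=> /fine_cvgP[_]; apply: cvg_trans; apply: near_eq_cvg.
near=> n; rewrite /= /series /=.
rewrite (eq_bigr (fun i => (pr (C i))%:E)); last by move=> i _; rewrite EFin_pr.
by rewrite sumEFin.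
Unshelve. all: by end_near.
Qed.

(** Invariance of [mu_A] under [T_A]. Let [C n] say that the first visit occurs at time [n.+1] and
    lands in [V]. As [C n.+1] is the preimage of [C n] minus [A], the masses of [A] intersected with
    [C n] telescope, starting from [pr V]; and [pr (C n)] vanishes in the limit because the [C n]
    are disjoint. *)
Lemma pr_after_hit V : measurable V -> V `<=` A ->
  pr (A `&` after_hit V) = pr V.
Proof.
move=> mV VA; pose C n := first_hit n.+1 `&` iter n.+1 T @^-1` V.
have mC n : measurable (C n).
  by apply: measurableI; [exact: measurable_first_hit|exact: (measurable_preim_iter mpT)].
have tC : trivIset setT C.
  by apply/trivIsetP => i j _ _ /eqP ij; apply/seteqP; split => x // -[[fi _] [fj _]];
    apply: ij; have [] := first_hit_uniq fi fj.
have C0 : C 0%N = T @^-1` V.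
  apply/seteqP; split => x /=; first by move=> [_].
  by move=> Vx; split => //; split => //; [exact: VA|move=> j; lia].
have CS n : C n.+1 = T @^-1` (~` A `&` C n).
  apply/seteqP; split => x /=.
  - move=> [fx Vx]; have nh : nohit 1 x.
      by have [_ _ h] := fx; move=> j j1; apply: h; lia.
    split; first exact: (nh 1%N).
    have := (first_hit_iter n.+1 nh).2; rewrite addn1 => fT; split; first exact: fT.
    by move: Vx; rewrite /= -iterS iterSr.
  - move=> [nA [fx Vx]]; have nh : nohit 1 x by move=> [|[|j]].
    have := (first_hit_iter n.+1 nh).1; rewrite addn1 => fT.
    by split; [have [] := fT fx|rewrite /= -iterS iterSr].
have sumC n : series (fun i => pr (A `&` C i)) n = pr V - pr (C n).
  elim: n => [|n IH].
    by rewrite /series /= big_geq// C0 (pr_preim mpT)// subrr.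
  rewrite /series /= big_nat_recr//= -[X in X + _ = _]/(series _ _) IH CS.
  rewrite (pr_preim mpT); last by apply: measurableI => //; exact: measurableC.
  by have := prDI mu (mC n) mA; rewrite setDE (setIC A) (setIC (~` A)); lra.
have C_0 : pr (C n) @[n --> \oo] --> 0.
  by apply: cvg_series_cvg_0; apply: (cvgP (pr (\bigcup_n C n))); exact: pr_bigcup.
have mAC n : measurable (A `&` C n) by exact: measurableI.
have tAC : trivIset setT (fun n => A `&` C n) by exact: trivIset_setIl.
have -> : A `&` after_hit V = \bigcup_n (A `&` C n).
  by rewrite after_hit_bigcup setI_bigcupr.
have c1 := pr_bigcup mAC tAC.
have c2 : series (fun i => pr (A `&` C i)) @ \oo --> pr V - 0.
  rewrite (_ : series _ = (fun n => pr V - pr (C n))); last exact/funext.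
  by apply: cvgB => //; exact: cvg_cst.
by have := cvg_unique _ c1 c2; rewrite subr0; apply.
Qed.

(** Membership in [E] differs between [x] and [T x] only if [T x] is in [A], or if the first visit
    from [x] falls exactly at time [n.+1]. Each has mass at most [pr A]. *)
Lemma after_hit_near_invariant n V :
  let E := nohit n `&` after_hit V in measurable V ->
  pr ((E `\` T @^-1` E) `|` (T @^-1` E `\` E)) <= 2 * pr A.
Proof.
move=> E mV; have mE : measurable E.
  by apply: measurableI; [exact: measurable_nohit|exact: measurable_after_hit].
have mTE := measurable_preim mpT mE.
have mn := measurable_nohit.
apply: (@le_trans _ _ (pr (T @^-1` A) + pr (nohit n `\` nohit n.+1))).
- apply: le_prU.
  + by apply: measurableU; exact: measurableD.
  + exact: (measurable_preim mpT).
  + exact: measurableD.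
  + move=> x Ex /=; have [Ax|nA] := pselect (A (T x)); [by left|right].
    have nh1 : nohit 1 x by move=> [|[|j]].
    have nD := nohitD n nh1; have aD := nohit_after_hit V nh1.
    case: Ex => -[].
    * move=> [nx ax] nE; split => // nS; apply: nE; split; first exact/nD.
      exact/aD.
    * move=> [/= /nD nx /aD ax] nE; exfalso; apply: nE; split => //.
      by apply: nohit_le nx; lia.
- rewrite (pr_preim mpT)//; have := pr_nohit_step n.
  have := prDI mu (mn n) (mn n.+1).
  rewrite (_ : nohit n `&` nohit n.+1 = nohit n.+1); last first.
    by apply/setIidPr; exact: nohit_le.
  lra.
Qed.

Lemma measurable_recurrent_set : measurable recurrent_set.
Proof.
rewrite recurrent_setE; apply: bigcap_measurable => // n _.
by apply: bigcup_measurable => k _; exact: (measurable_preim_iter mpT).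
Qed.

Hypothesis A0 : (0 < mu A)%E.

Lemma prA_gt0 : 0 < pr A.
Proof. by rewrite -lte_fin EFin_pr. Qed.

(** [phi] takes integer values or [+oo], so the real threshold [t / pr A] can be replaced by its
    integer part. *)
Lemma lt_mu_phi (t : R) x : 0 <= t ->
  (t%:E < mu A * phi x)%E <-> nohit (Num.truncn (t / pr A)) x.
Proof.
move=> t0; have p0 := prA_gt0; rewrite -EFin_pr//.
have [rx|nr] := pselect (returns x).
- rewrite phi_returns// -EFinM lte_fin mulrC -ltr_pdivrMr//.
  rewrite -truncn_lt_nat; last by rewrite divr_ge0// ltW.
  by split => /(nohit_hit _ rx).
- rewrite phi_noreturn// gt0_muley ?lte_fin// ltry.
  by split => // _; exact: nohit_noreturn.
Qed.

Lemma mu_phi_gt0 x : (0 < mu A * phi x)%E.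
Proof. by apply/lt_mu_phi => //; rewrite mul0r truncn0 nohit0. Qed.

(** The recurrent set is the limsup of the preimages of [A], each of mass [mu A]; its mass is thus
    at least [mu A > 0], and ergodicity leaves only 1. *)
Lemma pr_recurrent_set : ergodic mu T -> pr recurrent_set = 1.
Proof.
move=> ergT; have mD := measurable_recurrent_set.
have [D0|D1] := ergT _ mD (recurrent_set_invariant _ _); last by rewrite /pr_of D1.
exfalso; have : (mu A <= mu recurrent_set)%E; last by rewrite D0 leNgt A0.
rewrite recurrent_setE.
have mTn k : measurable (iter k T @^-1` A) by exact: (measurable_preim_iter mpT).
have := @lim_sup_set_cvg _ _ _ mu (fun n => iter n T @^-1` A) mTn.
move=> h; have cv := h _.
rewrite -(cvg_lim _ (cv _))//; last first.
  by apply: (@le_lt_trans _ _ 1%E); [apply: probability_le1; exact: bigcup_measurable|exact: ltry].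
apply: lime_ge.
  apply: (cvgP _ (cv _)); apply: (@le_lt_trans _ _ 1%E); last exact: ltry.
  by apply: probability_le1; exact: bigcup_measurable.
near=> n; rewrite -[leLHS](_ : mu (iter n T @^-1` A) = _).
  apply: le_measure; rewrite ?inE//; first exact: bigcup_measurable.
  by move=> x Ax; exists n => /=.
elim: {+}n => [//|k IH]; rewrite -IH.
by rewrite -(proj2 mpT (iter k T @^-1` A) (mTn k)); congr (mu _); apply/funext => x; rewrite /preimage /= -iterS iterSr.
Unshelve. all: by end_near.
Qed.

Lemma pr_recurrentI (C : set X) : ergodic mu T -> measurable C ->
  pr (recurrent_set `&` C) = pr C.
Proof.
move=> ergT mC; have mD := measurable_recurrent_set.
rewrite (prDI mu mC mD) setIC.
have : pr (C `\` recurrent_set) <= pr (~` recurrent_set).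
  by apply: le_pr; [exact: measurableD|exact: measurableC|move=> x []].
rewrite prC// pr_recurrent_set// subrr.
by have := pr_ge0 mu (C `\` recurrent_set); lra.
Qed.

End HittingProbabilities.

(** * Calculus of real sequences tending to zero *)

Section NullSequences.
Context {R : realType}.
Implicit Types u v : nat -> R.

Lemma cvg0_le u v : (forall n, `|u n| <= v n) -> v @ \oo --> 0 -> u @ \oo --> 0.
Proof.
move=> uv /cvgrPdist_lt v0; apply/cvgrPdist_lt => e /v0; apply: filterS => n.
rewrite !sub0r !normrN; apply: le_lt_trans.
exact: le_trans (uv n) (ler_norm _).
Qed.

Lemma cvg0D u v : u @ \oo --> 0 -> v @ \oo --> 0 -> (u n + v n) @[n --> \oo] --> 0.
Proof. by move=> u0 v0; rewrite -[X in _ --> X](addr0 0); exact: cvgD. Qed.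

Lemma cvg0Z (c : R) u : u @ \oo --> 0 -> (c * u n) @[n --> \oo] --> 0.
Proof. by move=> u0; rewrite -[X in _ --> X](mulr0 c); apply: cvgM => //; exact: cvg_cst. Qed.

Lemma cvg0_ext u v : (forall n, u n = v n) -> v @ \oo --> 0 -> u @ \oo --> 0.
Proof. by move=> /funext ->. Qed.

Lemma cvg0B u v : u @ \oo --> 0 -> v @ \oo --> 0 -> (u n - v n) @[n --> \oo] --> 0.
Proof. by move=> u0 v0; rewrite -(subr0 0); exact: cvgB. Qed.

Lemma cvg0_trans v u w : (u n - v n) @[n --> \oo] --> 0 ->
  (v n - w n) @[n --> \oo] --> 0 -> (u n - w n) @[n --> \oo] --> 0.
Proof.
move=> uv vw; have := cvg0D uv vw; rewrite (_ : (fun n => _) = (fun n => u n - w n))//.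
by apply/funext => n; rewrite addrA subrK.
Qed.

Lemma cvg0_sym u v : (u n - v n) @[n --> \oo] --> 0 -> (v n - u n) @[n --> \oo] --> 0.
Proof.
move=> uv; have := cvg0Z (-1) uv; rewrite (_ : (fun n => _) = (fun n => v n - u n))//.
by apply/funext => n; lra.
Qed.

Lemma cvg0M u u' v v' : (forall n, `|u n| <= 1) -> (forall n, `|v' n| <= 1) ->
  (u n - u' n) @[n --> \oo] --> 0 -> (v n - v' n) @[n --> \oo] --> 0 ->
  (u n * v n - u' n * v' n) @[n --> \oo] --> 0.
Proof.
move=> u1 v1 uu vv; apply: (@cvg0_le _ (fun n => `|v n - v' n| + `|u n - u' n|)).
  move=> n; rewrite (_ : _ - _ = u n * (v n - v' n) + (u n - u' n) * v' n); last by ring.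
  apply: le_trans (ler_normD _ _) _; rewrite !normrM.
  have := u1 n; have := v1 n; have := normr_ge0 (v n - v' n); have := normr_ge0 (u n - u' n).
  by have := normr_ge0 (u n); have := normr_ge0 (v' n); nra.
by apply: cvg0D; rewrite -(normr0 R); exact: cvg_norm.
Qed.

Lemma cvg0P u : u @ \oo --> 0 <->
  forall e : R, 0 < e -> \forall n \near \oo, `|u n| < e.
Proof.
split=> [/cvgrPdist_lt u0 e /u0|u0]; last apply/cvgrPdist_lt => e /u0;
  by apply: filterS => n; rewrite sub0r normrN.
Qed.

Lemma cvg_cvg0 u l : (u n - l) @[n --> \oo] --> 0 <-> u @ \oo --> l.
Proof.
split.
- move=> u0; rewrite -[l]add0r (_ : u = fun n => u n - l + l).
    by apply: cvgD => //; exact: cvg_cst.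
  by apply/funext => n; rewrite subrK.
- by move=> ul; rewrite -[X in _ --> X](subrr l); apply: cvgB => //; exact: cvg_cst.
Qed.

End NullSequences.

(** * Replacing a conditional measure by [mu] on events about the next visit *)

Section Mixing.
Context (R : realType) (d : measure_display) (X : measurableType d).
Variables (mu : probability X R) (T : X -> X).
Hypotheses (mpT : measure_preserving mu T) (ergT : ergodic mu T).
Variable A : nat -> set X.
Hypotheses (mA : forall l, measurable (A l)) (A0 : forall l, (0 < mu (A l))%E).
Hypothesis Arare : (fun l => mu (A l)) @ \oo --> 0%E.

Local Notation pr_of := pr.
Local Notation pr := (pr mu).
Local Notation nohit l := (nohit T (A l)).
Local Notation after_hit l := (after_hit T (A l)).

Lemma measurable_nohits l n : measurable (nohit l n).
Proof. exact: (measurable_nohit mpT (mA l)). Qed.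

Lemma measurable_after_hits l (V : set X) :
  measurable V -> measurable (after_hit l V).
Proof. exact: (measurable_after_hit mpT (mA l)). Qed.

Lemma measurable_nohits_after_hits l n (V : set X) :
  measurable V -> measurable (nohit l n `&` after_hit l V).
Proof.
move=> mV; apply: measurableI; [exact: measurable_nohits|].
exact: measurable_after_hits.
Qed.

Lemma prA_cvg0 : pr (A l) @[l --> \oo] --> 0.
Proof. by have /fine_cvgP[] := Arare. Qed.

Lemma pr_condm (B C : set X) : measurable B -> measurable C ->
  fine (condm mu B C) = pr (B `&` C) / pr B.
Proof.
move=> mB mC; rewrite /condm -(EFin_pr mu (measurableI _ _ mB mC)).
by rewrite -EFinM.
Qed.

Lemma cond_pr_itv (B C : set X) : measurable B -> measurable C ->
  0 <= pr (B `&` C) / pr B <= 1.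
Proof.
move=> mB mC; have mBC := measurableI _ _ mB mC.
have BB : pr (B `&` C) <= pr B by apply: le_pr => // x [].
have b0 := pr_ge0 mu B; rewrite divr_ge0 ?pr_ge0//=.
have [->|bn] := eqVneq (pr B) 0; first by rewrite invr0 mulr0.
by rewrite ler_pdivrMr ?mul1r// lt_neqAle eq_sym bn.
Qed.

Lemma cond_prA_norm l (C : set X) : measurable C ->
  `|pr (A l `&` C) / pr (A l)| <= 1.
Proof. by move=> mC; have /andP[? ?] := cond_pr_itv (mA l) mC; rewrite ger0_norm. Qed.

Lemma dP_condm (nu : set X -> \bar R) (B C : set X) : inP mu nu ->
  measurable B -> measurable C ->
  `|fine (nu C) - pr (B `&` C) / pr B| <= dP nu (condm mu B).
Proof.
move=> /inP_probability[nu' nuE] mB mC; rewrite -pr_condm//.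
apply: (@dP_ge _ _ _ _ _ _ 1) => // D mD; rewrite pr_condm// nuE//.
have := pr_le1 nu' mD; have := pr_ge0 nu' D; have /andP[] := cond_pr_itv mB mD.
by rewrite /pr_of ler_norml => *; apply/andP; split; lra.
Qed.

Lemma measurable_fun_of_nat (tau : X -> nat) (S : nat -> set X) :
  measurable_nat tau -> (forall n, measurable (S n)) ->
  measurable [set x | S (tau x) x].
Proof.
move=> mtau mS; rewrite (_ : [set x | _] = \bigcup_n (tau @^-1` [set n] `&` S n)).
  by apply: bigcup_measurable => n _; exact: measurableI.
apply/seteqP; split => x /=; first by move=> Sx; exists (tau x).
by move=> [n _ [<-]].
Qed.

Section Push.
Variables (nu : probability X R) (tau : X -> nat) (l : nat).
Hypothesis mtau : measurable_nat tau.
Let ok := [set x | ((tau x)%:R%:E < phi (R := R) T (A l) x)%E].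

Let okE : ok = [set x | nohit l (tau x) x].
Proof. by rewrite /ok; apply/seteqP; split => x /= /lt_phi. Qed.

Lemma measurable_before_hit : measurable ok.
Proof. by rewrite okE; apply: measurable_fun_of_nat => // n; exact: measurable_nohits. Qed.

Lemma measurable_push (C : set X) : measurable C ->
  measurable [set x | C (iter (tau x) T x)].
Proof.
move=> mC; apply: (measurable_fun_of_nat (S := fun n => iter n T @^-1` C)) => // n.
exact: (measurable_preim_iter mpT).
Qed.

Lemma measurable_tau_gt k : measurable [set x | (k < tau x)%N].
Proof.
apply: (measurable_fun_of_nat (S := fun n => [set _ | (k < n)%N])) => // n.
case: (ltnP k n) => kn.
  by rewrite (_ : [set _ | _] = setT)//; apply/seteqP; split.
by rewrite (_ : [set _ | _] = set0)//; apply/seteqP; split.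
Qed.

(** If [tau] precedes the first visit, waiting [n] more steps from [T^tau x] means waiting [tau + n]
    steps from [x], a smaller event than waiting [n] steps. *)
Lemma push_le n (V : set X) : measurable V ->
  pr_of nu [set x | (nohit l n `&` after_hit l V) (iter (tau x) T x)] <=
  pr_of nu (nohit l n `&` after_hit l V) + pr_of nu (~` ok).
Proof.
move=> mV.
have mE : measurable (nohit l n `&` after_hit l V).
  by exact: measurable_nohits_after_hits.
apply: le_prU => //.
- exact: measurable_push.
- by apply: measurableC; exact: measurable_before_hit.
- move=> x /= [nx ax]; have [okx|] := pselect (ok x); [left|by right].
  have nt : nohit l (tau x) x by move: okx; rewrite okE.
  move/(nohitD _ nt) : nx => nx; move/(nohit_after_hit _ nt) : ax => ax.
  by split => //; apply: nohit_le nx; exact: leq_addl.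
Qed.

(** The converse bound: when [tau <= k], at most [k] steps of the wait have been used up. *)
Lemma le_push n k (V : set X) : measurable V ->
  pr_of nu (nohit l n `&` after_hit l V) <=
  pr_of nu [set x | (nohit l (n - k) `&` after_hit l V) (iter (tau x) T x)] +
    (pr_of nu (~` ok) + pr_of nu [set x | (k < tau x)%N]).
Proof.
move=> mV.
have mok := measurable_before_hit; have mt := measurable_tau_gt k.
have mE m : measurable (nohit l m `&` after_hit l V).
  by exact: measurable_nohits_after_hits.
have mp := measurable_push (mE (n - k)%N).
have mC : measurable (~` ok) by exact: measurableC.
apply: (@le_trans _ _ (pr_of nu [set x | (nohit l (n - k) `&` after_hit l V)
    (iter (tau x) T x)] + pr_of nu (~` ok `|` [set x | (k < tau x)%N]))); last first.
  by rewrite lerD2l; exact: prU_le.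
apply: le_prU => //; first exact: measurableU.
move=> x /= [nx ax]; have [okx|] := pselect (ok x); last by right; left.
have [tk|tk] := leqP (tau x) k; [left|by right; right].
have nt : nohit l (tau x) x by move: okx; rewrite okE.
split; last exact/(nohit_after_hit _ nt).
apply/(nohitD _ nt); have [nk|kn] := leqP n k.
  by rewrite (_ : (n - k = 0)%N) ?addn0//; lia.
by apply: nohit_le nx; lia.
Qed.

(** With no waiting time involved the event is the same at [x] and at [T^tau x], whatever the size
    of [tau]. *)
Lemma le_push0 (V : set X) : measurable V ->
  pr_of nu (after_hit l V) <=
  pr_of nu [set x | after_hit l V (iter (tau x) T x)] + pr_of nu (~` ok).
Proof.
move=> mV; have mok := measurable_before_hit.
apply: le_prU.
- exact: measurable_after_hits.
- by apply: measurable_push; exact: measurable_after_hits.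
- exact: measurableC.
- move=> x ax /=; have [okx|] := pselect (ok x); [left|by right].
  by apply/nohit_after_hit => //; move: okx; rewrite okE.
Qed.

End Push.

Lemma nohit_after_hit_invariant (n : nat -> nat) (V : nat -> set X) :
  (forall l, measurable (V l)) ->
  asymptotically_invariant mu T (fun l => nohit l (n l) `&` after_hit l (V l)).
Proof.
move=> mV; split.
  by move=> l; exact: measurable_nohits_after_hits.
apply: (@cvg0_le _ _ (fun l => 2 * pr (A l))); last exact: cvg0Z prA_cvg0.
move=> l; rewrite ger0_norm ?pr_ge0//.
exact: after_hit_near_invariant.
Qed.

Variables (K : set (set X -> \bar R)) (nu : nat -> set X -> \bar R)
  (tau : nat -> X -> nat) (B : nat -> set X).
Hypotheses (cK : compactP mu K) (nuP : forall l, inP mu (nu l))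
  (mB : forall l, measurable (B l))
  (dB : (fun l => dP (nu l) (condm mu (B l))) @ \oo --> 0)
  (mtau : forall l, measurable_nat (tau l))
  (nutau : (fun l => nu l [set x | ((tau l x)%:R%:E < phi (R:=R) T (A l) x)%E])
          @ \oo --> 1%E)
  (Kpush : forall l, K (pushT T (tau l) (nu l))).

Let ok l := [set x | ((tau l x)%:R%:E < phi (R := R) T (A l) x)%E].

Lemma pr_not_before_hit (nu' : nat -> probability X R) :
  (forall l C, measurable C -> nu l C = nu' l C) ->
  pr_of (nu' l) (~` ok l) @[l --> \oo] --> 0.
Proof.
move=> nuE; have mok l : measurable (ok l) by exact: measurable_before_hit.
have c1 : pr_of (nu' l) (ok l) @[l --> \oo] --> (1 : R).
  have /fine_cvgP[_] := nutau; apply: cvg_trans; apply: near_eq_cvg.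
  by near=> l; rewrite /pr_of -(nuE l _ (mok l)).
apply: (@cvg0_le _ _ (fun l => - 1 * (pr_of (nu' l) (ok l) - 1))) => [l|].
  by rewrite prC// ger0_norm ?subr_ge0 ?pr_le1//; lra.
by apply: cvg0Z; exact/cvg_cvg0.
Unshelve. all: by end_near.
Qed.

(** The form used with (A). The conditional measure is [dP]-close to [nu l]; [nu l] and its
    push-forward agree on events about the return point, up to the mass where [tau] comes too late;
    the push-forward lies in a compact set, so it sees almost invariant events as [mu] does. *)
Lemma cond_after_hit (V : nat -> set X) : (forall l, measurable (V l)) ->
  (pr (B l `&` after_hit l (V l)) / pr (B l) - pr (after_hit l (V l)))
    @[l --> \oo] --> 0.
Proof.
move=> mV.
have mQ l : measurable (after_hit l (V l)) by exact: measurable_after_hits.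
have E0 l : nohit l 0 `&` after_hit l (V l) = after_hit l (V l).
  by rewrite nohit0 setTI.
have := asymptotically_invariant_compact mpT ergT cK Kpush
  (nohit_after_hit_invariant (fun=> 0%N) mV).
under eq_cvg do rewrite E0.
apply: cvg0_trans.
have [nu' nuE] := choice (fun l => inP_probability (nuP l)).
have mok l : measurable (ok l) by exact: measurable_before_hit.
have ok0 := pr_not_before_hit nuE.
apply: (@cvg0_trans _ (fun l => pr_of (nu' l) (after_hit l (V l)))).
- apply: (@cvg0_le _ _ (fun l => dP (nu l) (condm mu (B l)))) => // l.
  rewrite distrC /pr_of -nuE//; exact: dP_condm.
- apply: (@cvg0_le _ _ _ _ ok0) => l.
  have := le_push0 (nu' l) l (mtau l) (mV l).
  have := push_le (nu' l) l (mtau l) 0 (mV l); rewrite E0 /= => h1 h2.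
  have mp := measurable_push (mtau l) (mQ l).
  rewrite /pushT nuE// -/(pr_of (nu' l) _).
  rewrite ler_norml; apply/andP; split; last by move: h2; rewrite -/(ok l); lra.
  move: h1; rewrite -/(ok l).
  rewrite (_ : [set x | _] = (fun x : X => iter (tau l x) T x) @^-1` after_hit l (V l)).
    by lra.
  by [].
Unshelve. all: by end_near.
Qed.

Hypothesis tau0 : forall eps : R, 0 < eps ->
  (fun l => nu l [set x | (eps%:E < mu (A l) * (tau l x)%:R%:E)%E]) @ \oo --> 0%E.

(** The form used with (B). The argument of [cond_after_hit] now loses [tau] steps of waiting, so
    the event is squeezed between [E] and the version [E'] with [k] steps fewer, both asymptotically
    invariant. *)
Lemma cond_nohit_after_hit (n : nat -> nat) (V : nat -> set X) :
  (forall l, measurable (V l)) ->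
  let E l := nohit l (n l) `&` after_hit l (V l) in
  (pr (B l `&` E l) / pr (B l) - pr (E l)) @[l --> \oo] --> 0.
Proof.
move=> mV E.
have mE k l : measurable (nohit l k `&` after_hit l (V l)).
  by exact: measurable_nohits_after_hits.
have [nu' nuE] := choice (fun l => inP_probability (nuP l)).
have mok l : measurable (ok l) by exact: measurable_before_hit.
have ok0 := pr_not_before_hit nuE.
apply: (@cvg0_trans _ (fun l => pr_of (nu' l) (E l))).
  apply: (@cvg0_le _ _ (fun l => dP (nu l) (condm mu (B l)))) => // l.
  rewrite distrC /pr_of -nuE; last exact: mE.
  by apply: dP_condm => //; exact: mE.
apply/cvg0P => e e0.
have e4 : 0 < e / 4 by lra.
(* The number of steps that fit into rescaled time [e / 4]: dropping them changes the probability of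
   waiting by at most [k l * pr (A l) <= e / 4]. The other three quarters pay for a late [tau], for
   [tau > k], and for the compactness estimate. *)
pose k l := Num.truncn (e / 4 / pr (A l)).
pose E' l := nohit l (n l - k l) `&` after_hit l (V l).
have tauk l : [set x | (k l < tau l x)%N] =
    [set x | ((e / 4)%:E < mu (A l) * (tau l x)%:R%:E)%E].
  have ltE x : (k l < tau l x)%N = (e / 4 < pr (A l) * (tau l x)%:R).
    have p0 : 0 < pr (A l) := prA_gt0 (mA l) (A0 l).
    rewrite /k (mulrC (pr (A l))) -ltr_pdivrMr// truncn_lt_nat//.
    by rewrite divr_ge0 ?pr_ge0// ltW.
  by apply/seteqP; split => x /=; rewrite ltE -(EFin_pr mu (mA l)) -EFinM lte_fin.
have t0 : pr_of (nu' l) [set x | (k l < tau l x)%N] @[l --> \oo] --> 0.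
  have /fine_cvgP[_] := tau0 e4; apply: cvg_trans; apply: near_eq_cvg.
  by near=> l; rewrite /= -tauk nuE//; exact: measurable_tau_gt.
have i1 := asymptotically_invariant_compact mpT ergT cK Kpush
  (nohit_after_hit_invariant n mV).
have i2 := asymptotically_invariant_compact mpT ergT cK Kpush
  (nohit_after_hit_invariant (fun l => (n l - k l)%N) mV).
move/cvg0P : ok0 => /(_ _ e4) ok0; move/cvg0P : t0 => /(_ _ e4) t0.
move/cvg0P : i1 => /(_ _ e4) i1; move/cvg0P : i2 => /(_ _ e4) i2.
near=> l.
have := push_le (nu' l) l (mtau l) (n l) (mV l).
have := le_push (nu' l) l (mtau l) (n l) (k l) (mV l).
have : `|pr_of (nu' l) (~` ok l)| < e / 4 by near: l.
have : `|pr_of (nu' l) [set x | (k l < tau l x)%N]| < e / 4 by near: l.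
have : `|fine (pushT T (tau l) (nu l) (E l)) - pr (E l)| < e / 4 by near: l.
have : `|fine (pushT T (tau l) (nu l) (E' l)) - pr (E' l)| < e / 4 by near: l.
have mp m := measurable_push (mtau l) (mE m l).
rewrite /pushT !nuE ?mE//; [|exact: mp|exact: mp].
rewrite -!/(pr_of (nu' l) _) (ger0_norm (pr_ge0 _ _)) (ger0_norm (pr_ge0 _ _)).
rewrite -/(ok l) -/(E l) -/(E' l).
rewrite -[[set x | E l (iter (tau l x) T x)]]/((fun x : X => iter (tau l x) T x) @^-1` E l).
rewrite -[[set x | E' l (iter (tau l x) T x)]]/((fun x : X => iter (tau l x) T x) @^-1` E' l).
have : pr (E' l) - pr (E l) <= e / 4.
  have : pr (E' l) <= pr (E l) + pr (nohit l (n l - k l) `\` nohit l (n l)).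
    apply: le_prU; [exact: mE|exact: mE| |].
      by apply: measurableD; exact: measurable_nohits.
    move=> x [nx ax]; have [nn|nn] := pselect (nohit l (n l) x); [by left|by right].
  have := pr_nohit_sub mpT (mA l) (n l) (k l).
  have : (k l)%:R * pr (A l) <= e / 4.
    rewrite -ler_pdivlMr; last exact: prA_gt0.
    by have /andP[] := truncn_itv (x := e / 4 / pr (A l)) (divr_ge0 (ltW e4) (pr_ge0 _ _)).
  have mn m : measurable (nohit l m) by exact: measurable_nohits.
  have := prDI mu (mn (n l - k l)%N) (mn (n l)).
  rewrite (_ : nohit l (n l - k l) `&` nohit l (n l) = nohit l (n l)); last first.
    by apply/setIidPr; apply: nohit_le; exact: leq_subr.
  by lra.
by rewrite !ltr_norml => ? /andP[? ?] /andP[? ?] ? ? ? ?; apply/andP; split; lra.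
Unshelve. all: by end_near.
Qed.

End Mixing.

(** * Exponential waiting times and their asymptotic independence of the return point *)

Section Exponential.
Context (R : realType) (d : measure_display) (X : measurableType d).
Variables (mu : probability X R) (T : X -> X).
Hypotheses (mpT : measure_preserving mu T) (ergT : ergodic mu T).
Variable A : nat -> set X.
Hypotheses (mA : forall l, measurable (A l)) (A0 : forall l, (0 < mu (A l))%E).
Hypothesis Arare : (fun l => mu (A l)) @ \oo --> 0%E.

Local Notation pr_of := pr.
Local Notation pr := (pr mu).
Local Notation nohit l := (nohit T (A l)).
Local Notation after_hit l := (after_hit T (A l)).
Local Notation thr t l := (Num.truncn (t / pr (A l))).

(** Supplied by (B) applied to the whole of [F]: starting in [A l] or from [mu] makes no difference
    in the limit. *)
Hypothesis return_hit : forall (n : nat -> nat) (V : nat -> set X),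
  (forall l, measurable (V l)) ->
  (pr (A l `&` (nohit l (n l) `&` after_hit l (V l))) / pr (A l)
    - pr (nohit l (n l) `&` after_hit l (V l))) @[l --> \oo] --> 0.

Let mnh := measurable_nohits mpT mA.
Let mQ := measurable_after_hits mpT mA.
Let mE := measurable_nohits_after_hits mpT mA.
Let pA0 l : 0 < pr (A l) := prA_gt0 (mA l) (A0 l).

Lemma pr_after_hitA l (C : set X) : measurable C ->
  pr (C `&` after_hit l (A l)) = pr C.
Proof.
move=> mC; have mI : measurable (C `&` after_hit l (A l)).
  by apply: measurableI => //; exact: mQ.
have mD := measurable_recurrent_set mpT (mA l).
apply/eqP; rewrite eq_le le_pr//=.
rewrite -(pr_recurrentI mpT (mA l) (A0 l) ergT mC) le_pr//.
- exact: measurableI.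
- move=> x [rx Cx]; split => //; split; first exact: recurrent_set_returns.
  exact: TA_mem.
Qed.

Lemma return_nohit (n : nat -> nat) :
  (pr (A l `&` nohit l (n l)) / pr (A l) - pr (nohit l (n l))) @[l --> \oo] --> 0.
Proof.
have := return_hit n mA.
rewrite (_ : (fun l => _ - _) = (fun l => pr (A l `&` nohit l (n l)) / pr (A l) - pr (nohit l (n l))))//.
apply/funext => l; rewrite setIA !pr_after_hitA//.
exact: measurableI.
Qed.

(** [return_nohit] holds along every choice of [n l], in particular along one that picks a bad [n]
    whenever there is one; this forces uniformity in [n]. *)
Lemma return_nohit_uniform (e : R) : 0 < e -> \forall l \near \oo, forall n,
  `|pr (A l `&` nohit l n) / pr (A l) - pr (nohit l n)| < e.
Proof.
move=> e0.
pose bad l n := e <= `|pr (A l `&` nohit l n) / pr (A l) - pr (nohit l n)|.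
have exn l : exists n, (exists k, bad l k) -> bad l n.
  have [[k bk]|nb] := pselect (exists k, bad l k); first by exists k.
  by exists 0%N => /nb.
have [n nbad] := choice exn.
have /cvg0P/(_ _ e0) := return_nohit n; apply: filterS => l.
move=> ok k; rewrite ltNge; apply/negP => bk.
have : bad l (n l) by apply: nbad; exists k.
by rewrite /bad leNgt ok.
Qed.

(** The upper bound comes from [expR (- m) <= 1 / (1 + m)] and [(1 + m) (1 - m + m ^+ 2) = 1 + m ^+
    3 >= 1]. *)
Lemma expR_quadratic (m : R) : 0 <= m -> 1 - m <= expR (- m) <= 1 - m + m ^+ 2.
Proof.
move=> m0; have := expR_ge1Dx (- m) => ->/=.
have := expR_ge1Dx m; have := expRxMexpNx_1 m; have := expR_gt0 (- m).
by have := expR_gt0 m; nra.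
Qed.

(* [pr (nohit l n)] decreases by [pr (A l `&` nohit l n)] at each step, so it is
   an approximate Euler scheme for [g' = - g] with step [pr (A l)]. *)
Lemma pr_nohit_exp l (eta : R) n :
  (forall n, `|pr (A l `&` nohit l n) / pr (A l) - pr (nohit l n)| <= eta) ->
  `|pr (nohit l n) - expR (- (n%:R * pr (A l)))|
    <= n%:R * pr (A l) * (eta + pr (A l)).
Proof.
move=> le_eta; have m0 := pA0 l; have m1 := pr_le1 mu (mA l).
elim: n => [|n IH].
  by rewrite nohit0 pr_setT !mul0r oppr0 expR0 subrr normr0.
have fE : pr (A l `&` nohit l n) = pr (A l) * (pr (A l `&` nohit l n) / pr (A l)).
  by rewrite mulrCA divff ?mulr1// gt_eqF.
rewrite (pr_nohitS mpT (mA l)) fE.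
have := le_eta n; have : expR (- (n%:R * pr (A l))) <= 1.
  by rewrite -expR0 ler_expR oppr_le0 mulr_ge0// ltW.
have := expR_gt0 (- (n%:R * pr (A l))).
have -> : expR (- (n.+1%:R * pr (A l))) = expR (- (n%:R * pr (A l))) * expR (- pr (A l)).
  by rewrite -expRD -natr1; congr expR; ring.
have /andP[] := expR_quadratic (ltW m0).
rewrite -natr1; move: IH.
move: (pr (A l `&` _) / _) (pr (nohit l n)) (expR (- (n%:R * _))) (expR (- pr (A l))) => f g a b.
move: (pr (A l)) m0 m1 => m m0 m1.
rewrite !ler_norml => /andP[g1 g2] b1 b2 a0 a1 /andP[f1 f2].
have -> : (n%:R + 1) * m * (eta + m) = n%:R * m * (eta + m) + m * (eta + m) by ring.
move: (n%:R * m * (eta + m)) g1 g2 => c g1 g2.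
have c0 : 0 <= c by lra.
(* The three terms are the previous error, contracted by [1 - m]; the discrepancy between [mu] and
   [mu_A], weighted by the step; and the one-step error of the Euler scheme for the exponential. *)
have -> : g - m * f - a * b = (1 - m) * (g - a) + m * (g - f) + a * (1 - m - b) by ring.
have h1 : - c <= (1 - m) * (g - a) <= c by apply/andP; split; nra.
have h2 : - (m * eta) <= m * (g - f) <= m * eta by apply/andP; split; nra.
have h3 : - (m * m) <= a * (1 - m - b) <= m * m by apply/andP; split; nra.
move: h1 h2 h3 => /andP[? ?] /andP[? ?] /andP[? ?].
by apply/andP; split; nra.
Qed.

Lemma cvg_nohit (t : R) : 0 <= t -> pr (nohit l (thr t l)) @[l --> \oo] --> expR (- t).
Proof.
move=> t0; apply/cvg_cvg0.
pose n l := thr t l.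
have nm l : t - pr (A l) <= (n l)%:R * pr (A l) <= t.
  have /andP[n1 n2] := truncn_itv (divr_ge0 t0 (ltW (pA0 l))).
  move: n1 n2; rewrite -/(n l) ler_pdivlMr// -natr1 ltr_pdivrMr// => n1 n2.
  by apply/andP; split; lra.
apply: (@cvg0_trans _ (fun l => expR (- ((n l)%:R * pr (A l))))); last first.
  apply/cvg_cvg0; apply: continuous_cvg; first exact: continuous_expR.
  apply: cvgN; apply/cvg_cvg0; apply: (@cvg0_le _ _ (fun l => pr (A l))); last exact: prA_cvg0.
  by move=> l; have /andP[? ?] := nm l; rewrite ler_norml; apply/andP; split; lra.
apply/cvg0P => e e0.
(* [pr_nohit_exp] bounds the error by [t] times a sum of two terms, each brought below
   [e / (2 * (t + 1))]; [t + 1] instead of [t] covers [t = 0]. *)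
have t1 : 0 < 2 * (t + 1) by lra.
have e1 : 0 < e / (2 * (t + 1)) by exact: divr_gt0.
have /cvg0P/(_ _ e1) := prA_cvg0 Arare.
have := return_nohit_uniform e1; apply: filterS2 => l ueta.
rewrite (ger0_norm (pr_ge0 _ _)) => me.
have := @pr_nohit_exp l (e / (2 * (t + 1))) (n l) (fun k => ltW (ueta k)).
move=> /le_lt_trans; apply.
have /andP[_ n2] := nm l; have nm0 : 0 <= (n l)%:R * pr (A l) by rewrite mulr_ge0// ltW.
apply: (@le_lt_trans _ _ (t * (e / (2 * (t + 1)) + e / (2 * (t + 1))))).
  by apply: ler_pM => //; [have := pA0 l; lra|lra].
rewrite -mulrDl ltr_pdivlMr// in e1 *.
have -> : t * ((e + e) / (2 * (t + 1))) = (t / (t + 1)) * e by field; lra.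
rewrite gtr_pMl// ltr_pdivrMr; lra.
Qed.

(** Supplied by (A): having waited for rescaled time [t] leaves the return point distributed, in the
    limit, as under [mu]. *)
Hypothesis return_indep : forall (t : R) (V : nat -> set X), 0 <= t ->
  (forall l, measurable (V l)) ->
  (pr (A l `&` nohit l (thr t l) `&` after_hit l (V l)) / pr (A l `&` nohit l (thr t l))
    - pr (after_hit l (V l))) @[l --> \oo] --> 0.

(** Although the claim concerns [mu], it passes through [mu_{A_l}], because (A) gives independence
    only there: [return_hit] leads to [A l], [return_indep] factors the probability, and each factor
    has a known limit. *)
Lemma hit_asymptotics (t : R) (V : nat -> set X) : 0 <= t ->
  (forall l, measurable (V l)) -> (forall l, V l `<=` A l) ->
  (pr (nohit l (thr t l) `&` after_hit l (V l)) -
    expR (- t) * (pr (V l) / pr (A l))) @[l --> \oo] --> 0.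
Proof.
move=> t0 mV VA; pose q l C := pr (A l `&` C) / pr (A l).
pose nh l := nohit l (thr t l).
have mN l : measurable (nh l) by exact: mnh.
have mq l C : measurable C -> `|q l C| <= 1 by exact: cond_prA_norm.
apply: (@cvg0_trans _ (fun l => q l (nh l `&` after_hit l (V l)))).
  by apply: cvg0_sym; exact: return_hit.
apply: (@cvg0_trans _ (fun l => q l (nh l) * pr (after_hit l (V l)))).
  have h := return_indep t0 mV.
  apply: (@cvg0_le _ _ (fun l => `|pr (A l `&` nh l `&` after_hit l (V l)) / pr (A l `&` nh l)
    - pr (after_hit l (V l))|)); last by rewrite -(normr0 R); exact: cvg_norm.
  move=> l.
  have -> : q l (nh l `&` after_hit l (V l)) = q l (nh l) *
      (pr (A l `&` nh l `&` after_hit l (V l)) / pr (A l `&` nh l)).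
    (* Division by zero gives zero, so the product formula also holds when the conditioning event is
       null. *)
    rewrite /q setIA; have [z|z] := eqVneq (pr (A l `&` nh l)) 0.
      rewrite z !mul0r; suff -> : pr (A l `&` nh l `&` after_hit l (V l)) = 0 by rewrite mul0r.
      apply/eqP; rewrite eq_le pr_ge0 andbT -z le_pr//; [|exact: measurableI].
      by apply: measurableI; [exact: measurableI|exact: mQ].
    by field; rewrite z gt_eqF.
  rewrite -mulrBr normrM ler_piMl//; exact: mq.
apply: cvg0M.
- by move=> l; exact: mq.
- by move=> l; rewrite -(pr_after_hit mpT (mA l) (mV l) (VA l)); apply: mq; exact: mQ.
- apply: (@cvg0_trans _ (fun l => pr (nh l))); first exact: return_nohit.
  by apply/cvg_cvg0; exact: cvg_nohit.
- apply: cvg0_sym.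
  (* Without a waiting condition, [after_hit l (V l)] has nearly the same mass under [mu] and
     [mu_{A_l}], and the latter mass is exactly [pr (V l) / pr (A l)] since [T_A] preserves
     [mu_A]. *)
  have := return_hit (fun=> 0%N) mV.
  rewrite (_ : (fun l => _ - _) = (fun l => pr (V l) / pr (A l) - pr (after_hit l (V l))))//.
  apply/funext => l; rewrite nohit0 setTI; congr (_ / _ - _).
  exact: (pr_after_hit mpT).
Qed.

(** The set [B l] stands for the part of [A l] where the observable lies in a given set. The case
    [p = 0] covers sets of zero limit law, about which (B) says nothing: there [B l] itself is
    negligible in [A l]. *)
Lemma return_asymptotics (B : nat -> set X) (p : R) (t : R) (V : nat -> set X) :
  0 <= t -> (forall l, measurable (V l)) -> (forall l, V l `<=` A l) ->
  (forall l, measurable (B l)) -> (forall l, B l `<=` A l) ->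
  pr (B l) / pr (A l) @[l --> \oo] --> p ->
  p = 0 \/ (forall (n : nat -> nat) (V : nat -> set X),
    (forall l, measurable (V l)) ->
    (pr (B l `&` (nohit l (n l) `&` after_hit l (V l))) / pr (B l)
      - pr (nohit l (n l) `&` after_hit l (V l))) @[l --> \oo] --> 0) ->
  (pr (B l `&` (nohit l (thr t l) `&` after_hit l (V l))) / pr (A l) -
    p * (expR (- t) * (pr (V l) / pr (A l)))) @[l --> \oo] --> 0.
Proof.
move=> t0 mV VA mB BA Bp pB.
pose E l := nohit l (thr t l) `&` after_hit l (V l).
have mEl l : measurable (E l) by exact: mE.
have mBE l : measurable (B l `&` E l) by exact: measurableI.
have BE l : pr (B l `&` E l) / pr (A l) <= pr (B l) / pr (A l).
  by rewrite ler_pM2r ?invr_gt0// le_pr// => x [].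
case: pB => [p0|hB].
  rewrite p0 in Bp *; apply: (cvg0_le _ Bp) => l.
  by rewrite mul0r subr0 ger0_norm ?divr_ge0 ?pr_ge0 ?BE.
apply: (@cvg0_trans _ (fun l => pr (B l) / pr (A l) * pr (E l))).
  have h := hB (fun l => thr t l) V mV.
  apply: (@cvg0_le _ _ (fun l => `|pr (B l `&` E l) / pr (B l) - pr (E l)|));
    last by rewrite -(normr0 R); exact: cvg_norm.
  move=> l.
  have -> : pr (B l `&` E l) / pr (A l) =
      pr (B l) / pr (A l) * (pr (B l `&` E l) / pr (B l)).
    have [z|z] := eqVneq (pr (B l)) 0.
      rewrite z !mul0r; suff -> : pr (B l `&` E l) = 0 by rewrite mul0r.
      by apply/eqP; rewrite eq_le pr_ge0 andbT -z le_pr// => x [].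
    by field; rewrite z gt_eqF.
  rewrite -mulrBr normrM ler_piMl//.
  rewrite ger0_norm ?divr_ge0 ?pr_ge0// ler_pdivrMr// mul1r.
  exact: le_pr (BA l).
apply: cvg0M.
- move=> l; rewrite ger0_norm ?divr_ge0 ?pr_ge0// ler_pdivrMr// mul1r.
  exact: le_pr (BA l).
- move=> l; rewrite ger0_norm; last first.
    by rewrite mulr_ge0 ?expR_ge0// divr_ge0 ?pr_ge0.
  apply: mulr_ile1; rewrite ?expR_ge0 ?divr_ge0 ?pr_ge0//.
    by rewrite -expR0 ler_expR oppr_le0.
  by rewrite ler_pdivrMr// mul1r; exact: le_pr (VA l).
- exact/cvg_cvg0.
- exact: hit_asymptotics.
Qed.

End Exponential.

(** * Continuous functions separating points from closed sets *)

Section SetDistance.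
Context {R : realType} {F : pseudoMetricType R}.

(* A continuous, [0, 1]-valued substitute for the distance to [C], available
   since a pseudometric space here only comes with balls. *)
Definition set_dist (C : set F) (z : F) : R := contract (edist_inf C z).

Lemma continuous_contract : continuous (@contract R).
Proof.
move=> x; apply/cvgrPdist_lt => e e0.
have : nbhs x (ball x e) by exact: nbhsx_ballx.
by apply: filterS.
Qed.

Lemma continuous_set_dist (C : set F) : continuous (set_dist C).
Proof.
move=> z; apply: continuous_comp; first exact: edist_inf_continuous.
exact: continuous_contract.
Qed.

Lemma set_dist_ge0 (C : set F) z : 0 <= set_dist C z.
Proof. by rewrite -[leLHS](contract0 R) le_contract; exact: edist_inf_ge0. Qed.

Lemma set_dist0 (C : set F) z : C z -> set_dist C z = 0.
Proof. by move=> Cz; rewrite /set_dist edist_inf0// contract0. Qed.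

Lemma set_dist_gt0 (C : set F) z : closed C -> ~ C z -> 0 < set_dist C z.
Proof.
move=> cC nCz.
have : nbhs z (~` C) by apply: open_nbhs_nbhs; split => //; exact: closed_openC.
rewrite -nbhs_ballE => -[r /= r0 zr].
rewrite -[ltLHS](contract0 R) lt_contract (@lt_le_trans _ _ r%:E)// ?lte_fin//.
apply: le_ereal_inf_tmp => _ [a Ca <-]; rewrite leNgt; apply/negP.
by move=> /edist_lt_ball/zr.
Qed.

Lemma set_dist_ball (x z : F) (r : R) : 0 < r ->
  set_dist [set x] z < contract r%:E -> ball x r z.
Proof.
move=> r0; rewrite /set_dist lt_contract => /ereal_inf_lt[_ [_ -> <-]] lt.
by apply: ball_sym; exact: (edist_lt_ball lt).
Qed.

End SetDistance.

(** * Borel sets of a topological space and measurability of compositions *)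

Section BorelSets.
Context {S : topologicalType}.

Lemma borel_sets_open (U : set S) : open U -> borel_sets U.
Proof. by move=> oU; exact: sub_sigma_algebra. Qed.

Lemma borel_setsC (U : set S) : borel_sets U -> borel_sets (~` U).
Proof. by move=> bU; rewrite -setTD; exact: sigma_algebraCD. Qed.

Lemma borel_sets_closed (U : set S) : closed U -> borel_sets U.
Proof.
move=> cU; rewrite -[U]setCK; apply: borel_setsC; apply: borel_sets_open.
exact: closed_openC.
Qed.

Lemma borel_sets_bigcup (U : nat -> set S) :
  (forall n, borel_sets (U n)) -> borel_sets (\bigcup_n U n).
Proof. by move=> bU; exact: sigma_algebra_bigcup. Qed.

Lemma borel_setsT : borel_sets [set: S].
Proof. by apply: borel_sets_open; exact: openT. Qed.

Lemma borel_sets0 : borel_sets (set0 : set S).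
Proof. by apply: borel_sets_open; exact: open0. Qed.

Lemma borel_setsU (U V : set S) : borel_sets U -> borel_sets V -> borel_sets (U `|` V).
Proof.
move=> bU bV; rewrite -bigcup2E; apply: borel_sets_bigcup => -[|[|n]] //=.
exact: borel_sets0.
Qed.

Lemma borel_setsI (U V : set S) : borel_sets U -> borel_sets V -> borel_sets (U `&` V).
Proof.
move=> bU bV; rewrite -[_ `&` _]setCK setCI.
by apply: borel_setsC; apply: borel_setsU; exact: borel_setsC.
Qed.

Lemma borel_setsD (U V : set S) : borel_sets U -> borel_sets V -> borel_sets (U `\` V).
Proof. by move=> bU bV; rewrite setDE; apply: borel_setsI => //; exact: borel_setsC. Qed.

Lemma borel_measurable_continuous {R : realType} (d : measure_display)
    (X : measurableType d) (D : set X) (Z : X -> S) (h : S -> R) :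
  borel_measurable_on D Z -> continuous h -> measurable_fun D (h \o Z).
Proof.
move=> mZ /continuousP ch mD.
apply: (measurability _ (RGenOpens.measurableE R)) => // _ [_ [a [b ->] <-]].
rewrite comp_preimage; apply: mZ; apply: borel_sets_open.
exact/ch/interval_open.
Qed.

Lemma borel_measurable_indic {R : realType} (d : measure_display)
    (X : measurableType d) (D : set X) (Z : X -> S) (C : set S) :
  measurable D -> borel_measurable_on D Z -> borel_sets C ->
  measurable_fun D ((\1_C : S -> R) \o Z).
Proof.
move=> mD mZ bC.
have mC : measurable (D `&` Z @^-1` C) by exact: mZ.
apply: (@eq_measurable_fun _ _ _ _ D (\1_(D `&` Z @^-1` C) : X -> R));
  last exact: measurable_indic.
move=> x; rewrite inE => Dx; rewrite /= !indicE.
have -> // : (x \in D `&` Z @^-1` C) = (Z x \in C).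
by apply/idP/idP; rewrite !inE; [move=> []|].
Qed.

End BorelSets.

(** * From weak convergence of the observables to probabilities of continuity sets *)

Section Portmanteau.
Context (R : realType) (d : measure_display) (X : measurableType d)
  (mu : probability X R) (F : pseudoMetricType R)
  (dO : measure_display) (Om : measurableType dO) (P : probability Om R)
  (psi : Om -> F) (A : nat -> set X) (psiA : nat -> X -> F).
Hypotheses (mpsi : borel_measurable_on setT psi)
  (mA : forall l, measurable (A l)) (A0 : forall l, (0 < mu (A l))%E)
  (mpsiA : forall l, borel_measurable_on (A l) (psiA l))
  (psi_cvg : wconv mu A psiA P psi).

Local Notation prX := (pr mu).
Local Notation law C := (pr P (psi @^-1` C)).

Definition null_boundary (C : set F) :=
  P (psi @^-1` (closure C `\` interior C)) = 0%E.

Definition observable (h : F -> R) := [/\ exists M : R, forall z, `|h z| <= M,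
  measurable_fun setT (h \o psi) & forall l, measurable_fun (A l) (h \o psiA l)].

Let pA0 l : 0 < prX (A l) := prA_gt0 (mA l) (A0 l).

Lemma measurable_psi (C : set F) : borel_sets C -> measurable (psi @^-1` C).
Proof. by move=> bC; have := mpsi bC; rewrite setTI. Qed.

Lemma observable_continuous (h : F -> R) : continuous h ->
  (exists M : R, forall z, `|h z| <= M) -> observable h.
Proof.
by move=> ch bh; split => // [|l]; exact: borel_measurable_continuous.
Qed.

Lemma observable_indic (C : set F) : borel_sets C -> observable (\1_C).
Proof.
move=> bC; split => [||l]; [|exact: borel_measurable_indic..].
by exists 1 => x; rewrite indicE; case: (_ \in _); rewrite ?normr1 ?normr0.
Qed.

Lemma observableB (h g : F -> R) : observable h -> observable g ->
  observable (fun z => h z - g z).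
Proof.
move=> [[M hM] mh mhA] [[N gN] mg mgA]; split => [||l].
- by exists (M + N) => x; apply: le_trans (ler_normB _ _) _; exact: lerD.
- exact: (measurable_funB mh mg).
- exact: (measurable_funB (mhA l) (mgA l)).
Qed.

Lemma observable_norm (h : F -> R) : observable h -> observable (fun z => `|h z|).
Proof.
move=> [[M hM] mh mhA]; split => [||l].
- by exists M => x; rewrite normr_id.
- exact: (measurableT_comp (@normr_measurable R setT) mh).
- exact: (measurableT_comp (@normr_measurable R setT) (mhA l)).
Qed.

Lemma bounded_integrable_on (dX : measure_display) (Y : measurableType dX)
    (m : probability Y R) (D : set Y) (f : Y -> R) (M : R) : measurable D ->
  measurable_fun D f -> (forall x, `|f x| <= M) -> m.-integrable D (EFin \o f).
Proof.
move=> mD mf fM; apply: measurable_bounded_integrable => //.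
- by apply: (@le_lt_trans _ _ 1%E); [exact: probability_le1|exact: ltry].
- exists M; split; first exact: num_real.
  by move=> y My x _; exact: le_trans (fM x) (ltW My).
Qed.

Lemma observable_integrable (h : F -> R) (D : set X) l : observable h ->
  measurable D -> D `<=` A l -> mu.-integrable D (EFin \o (h \o psiA l)).
Proof.
move=> [[M hM] _ mh] mD DA; apply: (@bounded_integrable_on _ _ mu D (h \o psiA l) M) => // [|x]; last exact: hM.
exact: measurable_funS (mh l).
Qed.

Lemma observable_integrableP (h : F -> R) : observable h ->
  P.-integrable setT (EFin \o (h \o psi)).
Proof. by move=> [[M hM] mh _]; apply: (@bounded_integrable_on _ _ P setT (h \o psi) M) => // x; exact: hM. Qed.

Definition Ex (h : F -> R) : R := \int[P]_w h (psi w).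

(** Normalised by [A l] even when [D] is smaller: this is the mean under [mu_{A_l}] of [h] on the
    event [D], and so it is dominated by the mean of [|h|] over all of [A l]. *)
Definition Av (D : set X) l (h : F -> R) : R :=
  (prX (A l))^-1 * \int[mu]_(x in D) h (psiA l x).

Lemma ExB (h g : F -> R) : observable h -> observable g ->
  Ex (fun z => h z - g z) = Ex h - Ex g.
Proof. by move=> oh og; apply: RintegralB => //; exact: observable_integrableP. Qed.

Lemma le_Ex (h g : F -> R) : observable h -> observable g ->
  (forall z, h z <= g z) -> Ex h <= Ex g.
Proof. by move=> oh og hg; apply: le_Rintegral => //; exact: observable_integrableP. Qed.

Lemma Ex_indic (C : set F) : borel_sets C -> Ex (\1_C) = law C.
Proof.
move=> bC; rewrite -(Rint_indic P (measurable_psi bC)); apply: eq_Rintegral => x _.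
by rewrite !indicE; congr (_%:R); apply/idP/idP; rewrite !inE.
Qed.

Lemma Ex_norm (h : F -> R) : observable h -> `|Ex h| <= Ex (fun z => `|h z|).
Proof. by move=> oh; apply: le_normr_Rintegral => //; exact: observable_integrableP. Qed.

Section Average.
Variables (l : nat) (D : set X).
Hypotheses (mD : measurable D) (DA : D `<=` A l).

Lemma AvB (h g : F -> R) : observable h -> observable g ->
  Av D l (fun z => h z - g z) = Av D l h - Av D l g.
Proof.
move=> oh og; rewrite /Av -mulrBr; congr (_ * _).
by apply: RintegralB => //; exact: observable_integrable.
Qed.

Lemma le_Av (h g : F -> R) : observable h -> observable g ->
  (forall z, h z <= g z) -> Av D l h <= Av D l g.
Proof.
move=> oh og hg; rewrite /Av ler_pM2l ?invr_gt0//.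
by apply: le_Rintegral => //; exact: observable_integrable.
Qed.

Lemma Av_indic (C : set F) : borel_sets C ->
  Av D l (\1_C) = prX (D `&` psiA l @^-1` C) / prX (A l).
Proof.
move=> bC; rewrite /Av mulrC; congr (_ / _).
have mC : measurable (D `&` psiA l @^-1` C).
  have := measurableI _ _ mD (mpsiA l bC).
  by rewrite setIA (setIidl DA).
rewrite -(Rint_indic mu mC) Rintegral_mkcond; apply: eq_Rintegral => x _.
rewrite patchE !indicE; case: ifPn => [xD|xD].
  have -> // : (x \in D `&` psiA l @^-1` C) = (psiA l x \in C).
  by apply/idP/idP; rewrite !inE; [case|move=> ?; split => //; exact/set_mem].
rewrite (_ : (x \in _) = false)//; apply/negP; rewrite inE => -[Dx _].
by move/negP : xD; apply; rewrite inE.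
Qed.

Lemma Av_norm (h : F -> R) : observable h ->
  `|Av D l h| <= Av (A l) l (fun z => `|h z|).
Proof.
move=> oh; rewrite /Av normrM ger0_norm ?invr_ge0 ?(ltW (pA0 l))//.
rewrite ler_pM2l ?invr_gt0//.
apply: (le_trans (le_normr_Rintegral mD (observable_integrable oh mD DA))).
rewrite /Rintegral fine_le//.
- apply: integrable_fin_num => //.
  exact: (observable_integrable (observable_norm oh)).
- apply: integrable_fin_num => //.
  exact: (observable_integrable (observable_norm oh)).
- apply: ge0_subset_integral => //.
  by apply/measurable_EFinP; have [_ _ mh] := observable_norm oh; exact: (mh l).
Qed.

End Average.

Lemma Av_cvg (h : F -> R) : continuous h -> (exists M : R, forall z, `|h z| <= M) ->
  Av (A l) l h @[l --> \oo] --> Ex h.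
Proof. by move=> ch bh; exact: psi_cvg. Qed.

(** The neighbourhoods [{s < 1 / (n + 1)}] of [K] decrease to [K], so one of them has law below
    [law K + e]; [h] falls linearly in [s] from 1 on [K] to 0 outside it. *)
Lemma closed_above (K : set F) (e : R) : closed K -> 0 < e ->
  exists h : F -> R, [/\ continuous h, forall z, 0 <= h z <= 1,
    forall z, K z -> h z = 1 & Ex h < law K + e].
Proof.
move=> cK e0; pose s := set_dist K.
pose U n := [set z | s z < n.+1%:R^-1].
have oU n : open (U n).
  rewrite (_ : U n = s @^-1` [set r | r < n.+1%:R^-1])//.
  apply: open_comp; last exact: open_lt.
  by move=> z _; exact: continuous_set_dist.
have bU n : borel_sets (U n) by exact: borel_sets_open.
have mU n := measurable_psi (bU n).
have UK : \bigcap_n (psi @^-1` U n) = psi @^-1` K.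
  apply/seteqP; split => w /=; last first.
    by move=> Kw n _; rewrite /U /= /s set_dist0.
  move=> Uw; apply: contrapT => nK.
  have s0 := set_dist_gt0 cK nK; have := Uw (Num.truncn (s (psi w))^-1) I.
  rewrite /preimage /U /= -[ltLHS]invrK ltf_pV2 ?posrE ?invr_gt0// => lt.
  by have := truncnS_gt (s (psi w))^-1; rewrite ltNge => /negP; apply; exact: ltW.
have : (P \o (fun n => psi @^-1` U n)) n @[n --> \oo] --> P (\bigcap_n (psi @^-1` U n)).
  apply: nonincreasing_cvg_mu => //.
  - by apply: (@le_lt_trans _ _ 1%E); [exact: probability_le1|exact: ltry].
  - by rewrite UK; apply: measurable_psi; exact: borel_sets_closed.
  - move=> m n mn; apply/subsetPset => w /= /lt_le_trans; apply.
    by rewrite lef_pV2 ?posrE// ler_nat.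
have mK := measurable_psi (borel_sets_closed cK).
rewrite UK -(fineK (fin_num_measure P _ mK)) => /fine_cvgP[_ /cvgrPdist_lt/(_ _ e0)].
move=> [n _ /(_ n (leqnn n))] /=; rewrite ltr_norml => /andP[ltU _].
(* [(t + |t|) / 2] is the positive part of [t], written so that continuity follows from that of the
   norm. *)
pose t z := 1 - n.+1%:R * s z; pose h z := (t z + `|t z|) / 2.
have s0 z : 0 <= n.+1%:R * s z by rewrite mulr_ge0//; exact: set_dist_ge0.
have h01 z : 0 <= h z <= 1.
  rewrite /h; have := s0 z; rewrite /t; case: (ger0P (1 - n.+1%:R * s z)) => ? ?;
    by apply/andP; split; lra.
have ct : continuous t.
  move=> z; apply: cvgB; first exact: cvg_cst.
  by apply: cvgM; [exact: cvg_cst|exact: continuous_set_dist].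
have ch : continuous h.
  move=> z; apply: cvgM; last exact: cvg_cst.
  by apply: cvgD; [exact: ct|apply: cvg_norm; exact: ct].
exists h; split => //.
  by move=> z Kz; rewrite /h /t /s set_dist0// mulr0 subr0 normr1; lra.
have oh : observable h.
  apply: observable_continuous => //; exists 1 => z.
  by have /andP[? ?] := h01 z; rewrite ger0_norm.
apply: (@le_lt_trans _ _ (law (U n))); last by rewrite /pr; lra.
rewrite -Ex_indic//; apply: le_Ex => //; first exact: observable_indic.
move=> z; rewrite indicE; have [zU|zU] := boolP (z \in U n).
  by have /andP[] := h01 z.
suff t0 : t z <= 0 by rewrite /h ler0_norm// subrr mul0r.
rewrite /t lerBlDr add0r mulrC -ler_pdivrMr// div1r leNgt.
by apply/negP => lt; move/negP : zU; apply; rewrite inE.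
Qed.

(** [closed_above] is applied to the closure of [C] for the upper function and to the complement of
    its interior for one minus the lower function; the two closed sets overlap in the null boundary,
    so their laws add up to 1. *)
Lemma null_boundary_sandwich (C : set F) (e : R) : null_boundary C -> 0 < e ->
  exists h1 h2 : F -> R, [/\ continuous h1 /\ continuous h2,
    forall z, 0 <= h1 z <= 1 /\ 0 <= h2 z <= 1,
    forall z, h1 z <= \1_C z <= h2 z & Ex h2 - Ex h1 < e].
Proof.
move=> nC e0; have e2 : 0 < e / 2 by lra.
have cC : closed (closure C) by exact: closed_closure.
have cI : closed (~` interior C) by apply: open_closedC; exact: open_interior.
have [h2 [ch2 h201 h2C Eh2]] := closed_above cC e2.
have [h [ch h01 hC Eh]] := closed_above cI e2.
have b01 (g : F -> R) : (forall z, 0 <= g z <= 1) -> exists M : R, forall z, `|g z| <= M.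
  by move=> g01; exists 1 => z; have /andP[? ?] := g01 z; rewrite ger0_norm.
have oh : observable h by apply: observable_continuous => //; exact: b01.
have o1 : observable (\1_setT) by apply: observable_indic; exact: borel_setsT.
have oneE z : \1_(setT : set F) z = 1 :> R by rewrite indicE in_setT.
exists (fun z => \1_(setT : set F) z - h z), h2; split.
- split => // z; apply: cvgB; last exact: ch.
  have -> : (\1_(setT : set F) : F -> R) = cst 1 by apply/funext => y; rewrite oneE.
  exact: cvg_cst.
- by move=> z; split => //; have /andP[? ?] := h01 z; rewrite oneE; apply/andP; split; lra.
- move=> z; rewrite oneE indicE; have [zC|zC] := boolP (z \in C).
    rewrite h2C ?lexx ?andbT; last by apply: subset_closure; exact/set_mem.
    by have /andP[? ?] := h01 z; rewrite /=; lra.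
  rewrite hC; first by have /andP[? ?] := h201 z; rewrite subrr lexx.
  by move=> /interior_subset Cz; move/negP : zC; apply; rewrite inE.
- rewrite ExB// Ex_indic; last exact: borel_setsT.
  rewrite preimage_setT pr_setT.
  have bC := borel_sets_closed cC; have bI := borel_sets_open (open_interior C).
  have mC := measurable_psi bC; have mI := measurable_psi bI.
  have := prDI P mC mI; rewrite -preimage_setI.
  rewrite -[_ `\` _]/(psi @^-1` (closure C `\` interior C)).
  have := prC P mI; rewrite preimage_setC.
  rewrite (_ : closure C `&` interior C = interior C); last first.
    by apply/setIidPr => z /interior_subset; exact: subset_closure.
  rewrite (_ : law (closure C `\` interior C) = 0); last by rewrite /pr nC.
  by move: Eh Eh2; lra.
Qed.

Lemma sandwich_observable (h : F -> R) : continuous h ->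
  (forall z, 0 <= h z <= 1) -> observable h.
Proof.
move=> ch h01; apply: observable_continuous => //; exists 1 => z.
by have /andP[? ?] := h01 z; rewrite ger0_norm.
Qed.

Lemma portmanteau (C : set F) : borel_sets C -> null_boundary C ->
  prX (A l `&` psiA l @^-1` C) / prX (A l) @[l --> \oo] --> law C.
Proof.
move=> bC nC; apply/cvgrPdist_lt => e e0; have e2 : 0 < e / 2 by lra.
have [h1 [h2 [[ch1 ch2] h01 hC Eh]]] := null_boundary_sandwich nC e2.
have o1 : observable h1 by apply: sandwich_observable => // z; have [] := h01 z.
have o2 : observable h2 by apply: sandwich_observable => // z; have [] := h01 z.
have oC := observable_indic bC.
have [b1 _ _] := o1; have [b2 _ _] := o2.
have /cvgrPdist_lt/(_ _ e2) := Av_cvg ch1 b1.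
have /cvgrPdist_lt/(_ _ e2) := Av_cvg ch2 b2; apply: filterS2 => l.
have le1 : Ex h1 <= Ex (\1_C) by apply: le_Ex => // z; have /andP[] := hC z.
have le2 : Ex (\1_C) <= Ex h2 by apply: le_Ex => // z; have /andP[] := hC z.
have le3 : Av (A l) l h1 <= Av (A l) l (\1_C).
  by apply: le_Av => // z; have /andP[] := hC z.
have le4 : Av (A l) l (\1_C) <= Av (A l) l h2.
  by apply: le_Av => // z; have /andP[] := hC z.
move: le1 le2 le3 le4; rewrite Ex_indic// Av_indic//.
by rewrite !ltr_norml => ? ? ? ? /andP[? ?] /andP[? ?]; apply/andP; split; lra.
Qed.

(** * Extension from a pi-system to all continuity sets *)

Section Extension.
Variables (G : set (set F)) (B : nat -> set X) (c : nat -> R).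
Hypotheses (GI : setI_closed G) (GB : <<s G >> = @borel_sets F) (GT : G setT)
  (Gnull : forall C, G C -> null_boundary C)
  (mB : forall l, measurable (B l)) (BA : forall l, B l `<=` A l)
  (c01 : forall l, 0 <= c l <= 1)
  (Gcvg : forall C, G C ->
    (prX (B l `&` psiA l @^-1` C) / prX (A l) - law C * c l) @[l --> \oo] --> 0).

Definition discrepancy l (h : F -> R) : R := Av (B l) l h - Ex h * c l.

Lemma discrepancyB l (h g : F -> R) : observable h -> observable g ->
  discrepancy l (fun z => h z - g z) = discrepancy l h - discrepancy l g.
Proof. by move=> oh og; rewrite /discrepancy AvB// ExB//; ring. Qed.

Lemma discrepancy_indic l (C : set F) : borel_sets C -> discrepancy l (\1_C) =
  prX (B l `&` psiA l @^-1` C) / prX (A l) - law C * c l.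
Proof. by move=> bC; rewrite /discrepancy Av_indic// Ex_indic. Qed.

Lemma discrepancy_le l (h : F -> R) : observable h ->
  `|discrepancy l h| <= Av (A l) l (fun z => `|h z|) + Ex (fun z => `|h z|).
Proof.
move=> oh; apply: (le_trans (ler_normB _ _)); apply: lerD; first exact: Av_norm.
rewrite normrM; have := Ex_norm oh; have /andP[c0 c1] := c01 l.
rewrite (ger0_norm c0); have := normr_ge0 (Ex h); nra.
Qed.

(** Weak convergence says nothing about the possibly discontinuous [h], but it carries the smallness
    of the mean of a continuous majorant over to the averages under [mu_{A_l}]. *)
Lemma discrepancy_le_near (h k : F -> R) (e : R) : observable h -> continuous k ->
  (exists M : R, forall z, `|k z| <= M) -> (forall z, `|h z| <= k z) ->
  Ex k < e -> \forall l \near \oo, `|discrepancy l h| < 2 * e.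
Proof.
move=> oh ck bk hk Eke.
have ok : observable k by exact: observable_continuous.
have on := observable_norm oh.
have e' : 0 < e - Ex k by lra.
have /cvgrPdist_lt/(_ _ e') := Av_cvg ck bk; apply: filterS => l.
rewrite ltr_norml => /andP[lt _].
apply: le_lt_trans (discrepancy_le l oh) _.
have : Av (A l) l (fun z => `|h z|) <= Av (A l) l k by apply: le_Av.
have : Ex (fun z => `|h z|) <= Ex k by apply: le_Ex.
by lra.
Qed.

(** Convergence of the probabilities cannot serve as the Dynkin class: for sets with charged
    boundary it may fail, as the observables converge only in law. Approximation in mean under the
    limit law, by continuous functions of small discrepancy, does survive differences and increasing
    unions. *)
Definition approximable (C : set F) := borel_sets C /\ forall e : R, 0 < e ->
  exists h : F -> R, [/\ continuous h, exists M : R, forall z, `|h z| <= M,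
    Ex (fun z => `|\1_C z - h z|) < e &
    \forall l \near \oo, `|discrepancy l h| < e].

Lemma G_borel (C : set F) : G C -> borel_sets C.
Proof. by move=> GC; rewrite -GB; exact: sub_sigma_algebra. Qed.

Lemma approximable_G (C : set F) : G C -> approximable C.
Proof.
move=> GC; have bC := G_borel GC; split => // e e0; have e4 : 0 < e / 4 by lra.
have [h1 [h2 [[ch1 ch2] h01 hC Eh]]] := null_boundary_sandwich (Gnull GC) e4.
have o1 : observable h1 by apply: sandwich_observable => // z; have [] := h01 z.
have o2 : observable h2 by apply: sandwich_observable => // z; have [] := h01 z.
have oC := observable_indic bC; have [b2 _ _] := o2.
have o21 := observableB o2 o1; have oC2 := observableB oC o2.
have ck : continuous (fun z => h2 z - h1 z) by move=> z; exact: cvgB (ch2 z) (ch1 z).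
have [bk _ _] := o21.
have le21 z : `|\1_C z - h2 z| <= h2 z - h1 z.
  by have /andP[? ?] := hC z; rewrite ler_norml; apply/andP; split; lra.
exists h2; split => //.
  apply: (@le_lt_trans _ _ (Ex (fun z => h2 z - h1 z))); last by rewrite ExB//; lra.
  by apply: le_Ex => //; exact: observable_norm.
have /cvg0P/(_ _ e4) := Gcvg GC.
have Ek : Ex (fun z => h2 z - h1 z) < e / 4 by rewrite ExB.
have := discrepancy_le_near oC2 ck bk le21 Ek; apply: filterS2 => l.
rewrite discrepancyB// -discrepancy_indic//.
by rewrite !ltr_norml => /andP[? ?] /andP[? ?]; apply/andP; split; lra.
Qed.

Lemma approximable_lambda : lambda_system setT approximable.
Proof.
split => //; first exact: approximable_G.
- move=> C D DC [bC aC] [bD aD]; split; first exact: borel_setsD.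
  move=> e e0; have e2 : 0 < e / 2 by lra.
  have [h [ch bh Eh dh]] := aC _ e2; have [k [ck bk Ek dk]] := aD _ e2.
  have oh : observable h by exact: observable_continuous.
  have ok : observable k by exact: observable_continuous.
  have ohk := observableB oh ok; have [bhk _ _] := ohk.
  have oC := observable_indic bC; have oD := observable_indic bD.
  have oCD := observable_indic (borel_setsD bC bD).
  exists (fun z => h z - k z); split => //.
  + by move=> z; exact: cvgB (ch z) (ck z).
  + have oa := observable_norm (observableB oC oh).
    have ob := observable_norm (observableB oD ok).
    (* [\1_set0] is the zero function: writing a sum as [u - (0 - v)] lets [ExB] handle it. *)
    have oz : observable (\1_set0) by apply: observable_indic; exact: borel_sets0.
    have onb := observableB oz ob.
    apply: (@le_lt_trans _ _ (Ex (fun z => `|\1_C z - h z| - (\1_set0 z - `|\1_D z - k z|)))).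
      apply: le_Ex.
      * exact: (observable_norm (observableB oCD ohk)).
      * exact: observableB.
      * move=> z; rewrite [\1_set0 z]indicE in_set0 sub0r opprK.
        have -> : \1_(C `\` D) z = \1_C z - \1_D z :> R.
          rewrite !indicE in_setD; have [zD|] := boolP (z \in D); last first.
            by rewrite andbT subr0.
          rewrite andbF; have -> : z \in C by rewrite inE; apply: DC; exact/set_mem.
          by rewrite subrr.
        apply: le_trans (ler_normB _ _); rewrite (_ : _ - _ - (_ - _) =
          \1_C z - h z - (\1_D z - k z))//; ring.
    rewrite ExB// ExB// (_ : Ex (\1_set0) = 0); first by lra.
    by rewrite Ex_indic ?preimage_set0 ?pr_set0//; exact: borel_sets0.
  + move: dh dk; apply: filterS2 => l; rewrite discrepancyB//.
    by rewrite !ltr_norml => /andP[? ?] /andP[? ?]; apply/andP; split; lra.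
- move=> U ndU aU; have bU i : borel_sets (U i) by have [] := aU i.
  have bUU : borel_sets (\bigcup_i U i) by exact: borel_sets_bigcup.
  split => // e e0; have e2 : 0 < e / 2 by lra.
  have mU i := measurable_psi (bU i); have mUU := measurable_psi bUU.
  (* Some [U n] has nearly the law of the union, so a function approximating [U n] also approximates
     the union, and its discrepancy is already under control. *)
  have : (P \o (fun i => psi @^-1` U i)) i @[i --> \oo] --> P (\bigcup_i (psi @^-1` U i)).
    apply: nondecreasing_cvg_mu => //.
    by move=> m n mn; apply/subsetPset; apply: preimage_subset; apply/subsetPset; exact: ndU.
  rewrite -preimage_bigcup -(fineK (fin_num_measure P _ mUU)).
  move=> /fine_cvgP[_ /cvgrPdist_lt/(_ _ e2)].
  move=> [n _ /(_ n (leqnn n))] /=; rewrite ltr_norml => /andP[_ ltU].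
  have [h [ch bh Eh dh]] := (aU n).2 _ e2.
  have oh : observable h by exact: observable_continuous.
  exists h; split => //; last by apply: filterS dh => l; lra.
  have oU := observable_indic bUU; have oUn := observable_indic (bU n).
  have ob := observable_norm (observableB oUn oh).
  have od := observableB oUn oU.
  apply: (@le_lt_trans _ _ (Ex (fun z => `|\1_(U n) z - h z| -
      (\1_(U n) z - \1_(\bigcup_i U i) z)))).
    apply: le_Ex; [exact: (observable_norm (observableB oU oh))|exact: observableB|].
    move=> z; rewrite !indicE.
    have sub : z \in U n -> z \in \bigcup_i U i by rewrite !inE => ?; exists n.
    have [zn|zn] := boolP (z \in U n); first by rewrite (sub zn)/=; lra.
    have := ler_normD ((z \in \bigcup_i U i)%:R : R) (- h z).
    by rewrite sub0r; case: (_ \in _) => /=; rewrite ?normr1 ?normr0; lra.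
  rewrite ExB// ExB// !Ex_indic//; rewrite /pr; lra.
Qed.

(** The null boundary turns approximability back into convergence. Split [\1_C] as
    [(\1_C - h2) + (h2 - h) + h], with [h2] the upper sandwich function and [h] from
    approximability: the first term is dominated by the continuous [h2 - h1], the second is
    continuous, and both have small mean, so [discrepancy_le_near] applies. The errors sum to
    [7 e / 8]. *)
Lemma null_boundary_extension (C : set F) : borel_sets C -> null_boundary C ->
  (prX (B l `&` psiA l @^-1` C) / prX (A l) - law C * c l) @[l --> \oo] --> 0.
Proof.
move=> bC nC.
have [_ aC] : approximable C.
  by apply: (lambda_system_subset GI approximable_lambda approximable_G) => //; rewrite GB.
apply/cvg0P => e e0; have e8 : 0 < e / 8 by lra.
have [h1 [h2 [[ch1 ch2] h01 hC Eh]]] := null_boundary_sandwich nC e8.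
have o1 : observable h1 by apply: sandwich_observable => // z; have [] := h01 z.
have o2 : observable h2 by apply: sandwich_observable => // z; have [] := h01 z.
have oC := observable_indic bC; have [b2 _ _] := o2.
have o21 := observableB o2 o1; have oC2 := observableB oC o2.
have ck : continuous (fun z => h2 z - h1 z) by move=> z; exact: cvgB (ch2 z) (ch1 z).
have [bk _ _] := o21.
have le21 z : `|\1_C z - h2 z| <= h2 z - h1 z.
  by have /andP[? ?] := hC z; rewrite ler_norml; apply/andP; split; lra.
have Ek : Ex (fun z => h2 z - h1 z) < e / 8 by rewrite ExB.
have [h [ch bh EhC dh]] := aC _ e8.
have oh : observable h by exact: observable_continuous.
have o2h := observableB o2 oh; have [b2h _ _] := observable_norm o2h.
have c2h : continuous (fun z => `|h2 z - h z|).
  by move=> z; apply: cvg_norm; exact: cvgB (ch2 z) (ch z).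
have E2h : Ex (fun z => `|h2 z - h z|) < e / 4.
  have oa := observable_norm (observableB oC oh).
  have oz : observable (\1_set0) by apply: observable_indic; exact: borel_sets0.
  have ob := observableB oz o21.
  apply: (@le_lt_trans _ _ (Ex (fun z => `|\1_C z - h z| - (\1_set0 z - (h2 z - h1 z))))).
    apply: le_Ex; [exact: observable_norm|exact: observableB|].
    move=> z; rewrite [\1_set0 z]indicE in_set0 sub0r opprK.
    have := le21 z; have := ler_normD (\1_C z - h z) (h2 z - \1_C z).
    rewrite (distrC (h2 z)) (_ : _ + (h2 z - _) = h2 z - h z); last by ring.
    by lra.
  rewrite ExB// ExB// (_ : Ex (\1_set0) = 0); first by lra.
  by rewrite Ex_indic ?preimage_set0 ?pr_set0//; exact: borel_sets0.
have h2h z : `|h2 z - h z| <= `|h2 z - h z| by [].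
have n1 := discrepancy_le_near oC2 ck bk le21 Ek.
have n2 := discrepancy_le_near o2h c2h b2h h2h E2h.
near=> l.
have : `|discrepancy l (fun z => \1_C z - h2 z)| < 2 * (e / 8) by near: l.
have : `|discrepancy l (fun z => h2 z - h z)| < 2 * (e / 4) by near: l.
have : `|discrepancy l h| < e / 8 by near: l.
rewrite -discrepancy_indic// !discrepancyB//.
by rewrite !ltr_norml => /andP[? ?] /andP[? ?] /andP[? ?]; apply/andP; split; lra.
Unshelve. all: by end_near.
Qed.

End Extension.
End Portmanteau.

(** * Infinite powers of a probability on an arbitrary measurable space *)

Section InfiniteProduct.
Context (R : realType) (d : measure_display) (S : measurableType d).
Variable Q : probability S R.

Definition coordinate_sets : set (set (nat -> S)) :=
  [set C | exists i B, measurable B /\ C = [set w | B (w i)]].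

Local Notation W := (g_sigma_algebraType coordinate_sets).

Definition consW (p : S * W) : W := fun n => if n is k.+1 then p.2 k else p.1.

Definition section_at (s : S) (C : set W) : set W := [set w | C (consW (s, w))].

Definition depends_on n (C : set W) :=
  forall w w', (forall i, (i < n)%N -> w i = w' i) -> C w -> C w'.

Lemma measurable_coordinate i (B : set S) : measurable B ->
  measurable ([set w | B (w i)] : set W).
Proof. by move=> mB; apply: sub_sigma_algebra; exists i, B. Qed.

Lemma measurable_consW : measurable_fun setT consW.
Proof.
apply: (measurability (coordinate_sets : set (set W))) => // _ [_ [i [B [mB ->]]] <-].
rewrite setTI; case: i => [|k].
  rewrite (_ : _ @^-1` _ = fst @^-1` B)// -[X in measurable X]setTI.
  exact: measurable_fst.
rewrite (_ : _ @^-1` _ = snd @^-1` [set w : W | B (w k)])// -[X in measurable X]setTI.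
by apply: measurable_snd => //; exact: measurable_coordinate.
Qed.

Lemma measurable_preim_consW (C : set W) : measurable C -> measurable (consW @^-1` C).
Proof. by move=> mC; rewrite -[X in measurable X]setTI; exact: measurable_consW. Qed.

Lemma xsection_consW s (C : set W) : xsection (consW @^-1` C) s = section_at s C.
Proof. by apply/seteqP; split => w; rewrite /xsection /= inE. Qed.

Lemma measurable_section_at s (C : set W) : measurable C -> measurable (section_at s C).
Proof.
by move=> mC; rewrite -xsection_consW; apply: measurable_xsection; exact: measurable_preim_consW.
Qed.

Lemma measurable_fun_section_at (m : probability W R) (C : set W) : measurable C ->
  measurable_fun setT (fun s => m (section_at s C)).
Proof.
move=> mC; have := measurable_fun_xsection m (measurable_preim_consW mC).
by congr measurable_fun; apply/funext => s /=; rewrite xsection_consW.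
Qed.

Lemma integral_constant (c : R) : (\int[Q]_s c%:E)%E = c%:E.
Proof.
rewrite integral_cst// -[RHS]mule1; congr (_ * _)%E.
exact: probability_setT.
Qed.

Lemma prepend_probability (m : probability W R) : exists m' : probability W R,
  forall C, measurable C -> m' C = (\int[Q]_s m (section_at s C))%E.
Proof.
pose f (C : set W) := (Q \x m)%E (consW @^-1` C).
have fE C : f C = (\int[Q]_s m (section_at s C))%E.
  by apply: eq_integral => s _ /=; rewrite xsection_consW.
have f0 : f set0 = 0%E by rewrite /f preimage_set0 measure0.
have fge0 C : (0 <= f C)%E by exact: measure_ge0.
have fS : semi_sigma_additive f.
  move=> U mU tU mUU; rewrite /f preimage_bigcup.
  apply: measure_semi_sigma_additive.
  - by move=> i; exact: measurable_preim_consW.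
  - apply/trivIsetP => i j _ _ ij; rewrite -preimage_setI.
    by move/trivIsetP : tU => /(_ _ _ _ _ ij) ->//; rewrite preimage_set0.
  - by rewrite -preimage_bigcup; exact: measurable_preim_consW.
have fT : f setT = 1%E.
  rewrite fE (eq_integral (cst 1%:E)); last by move=> s _; rewrite /= probability_setT.
  exact: integral_constant.
pose m1 := isMeasure.Build _ W R f f0 fge0 fS.
pose m2 : {measure set W -> \bar R} := HB.pack f m1.
pose m3 := Measure_isProbability.Build _ W R m2 fT.
pose m4 : probability W R := HB.pack f m1 m3.
by exists m4 => C mC; rewrite -fE.
Qed.

(** The law of [n] independent coordinates followed by the constant sequence [point]; new
    coordinates are put in front, so that sections in the first coordinate return the preceding
    law. *)
Fixpoint prefix_law n : probability W R :=
  if n is n'.+1 then sval (cid (prepend_probability (prefix_law n')))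
  else dirac (point : W).

Lemma prefix_lawS n (C : set W) : measurable C ->
  prefix_law n.+1 C = (\int[Q]_s prefix_law n (section_at s C))%E.
Proof. by move=> mC /=; case: cid => m' /= ->. Qed.

Lemma depends_on_section n s C : depends_on n.+1 C -> depends_on n (section_at s C).
Proof.
move=> dC w w' ww' Cw; apply: dC Cw => -[|i]//= ilt; exact: ww'.
Qed.

Lemma depends_on_le m n C : (m <= n)%N -> depends_on m C -> depends_on n C.
Proof. by move=> mn dC w w' ww'; apply: dC => i im; apply: ww'; exact: leq_trans im mn. Qed.

Lemma depends_on0 C : depends_on 0 C -> C = set0 \/ C = setT.
Proof.
move=> dC; have [->|/set0P[w Cw]] := eqVneq C set0; [by left|right].
by apply/seteqP; split => // w' _; apply: dC Cw.
Qed.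

Lemma prefix_law_stable n k (C : set W) : measurable C -> depends_on n C ->
  prefix_law (n + k) C = prefix_law n C.
Proof.
elim: n C => [|n IH] C mC dC.
  by have [->|->] := depends_on0 dC; rewrite ?measure0 ?probability_setT.
rewrite addSn !prefix_lawS//; apply: eq_integral => s _.
by apply: IH; [exact: measurable_section_at|exact: depends_on_section].
Qed.

Definition depth (C : set W) := xget 0%N [set n | depends_on n C].

(** By [prefix_law_stable], any admissible depth gives the same value on a cylinder. *)
Definition cylinder_law (C : set W) : \bar R := prefix_law (depth C) C.

Lemma cylinder_lawE n (C : set W) : measurable C -> depends_on n C ->
  cylinder_law C = prefix_law n C.
Proof.
move=> mC dC; have dd : depends_on (depth C) C.
  by rewrite /depth; case: xgetP => [m -> //|/(_ n)].
rewrite /cylinder_law -(prefix_law_stable n mC dd) addnC.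
exact: prefix_law_stable.
Qed.

Definition cylinder (C : set W) := measurable C /\ exists n, depends_on n C.

Lemma cylinder0 : cylinder set0.
Proof. by split => //; exists 0%N. Qed.

Lemma cylinderC C : cylinder C -> cylinder (~` C).
Proof.
move=> [mC [n dC]]; split; first exact: measurableC.
by exists n => w w' ww' nC Cw'; apply: nC; apply: dC Cw' => i /ww'.
Qed.

Lemma cylinderU C D : cylinder C -> cylinder D -> cylinder (C `|` D).
Proof.
move=> [mC [n dC]] [mD [m dD]]; split; first exact: measurableU.
exists (maxn n m) => w w' ww' [Cw|Dw]; [left; apply: dC Cw|right; apply: dD Dw] => i ilt;
  by apply: ww'; rewrite leq_max ilt ?orbT.
Qed.

Lemma cylinderD C D : cylinder C -> cylinder D -> cylinder (C `\` D).
Proof.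
move=> cC cD; rewrite setDE -[_ `&` _]setCK setCI setCK.
by apply: cylinderC; apply: cylinderU => //; exact: cylinderC.
Qed.

Lemma cylinder_section s C : cylinder C -> cylinder (section_at s C).
Proof.
move=> [mC [n dC]]; split; first exact: measurable_section_at.
by exists n; apply: depends_on_section; exact: depends_on_le dC.
Qed.

Lemma cylinder_lawD C D : cylinder C -> cylinder D -> C `&` D = set0 ->
  cylinder_law (C `|` D) = (cylinder_law C + cylinder_law D)%E.
Proof.
move=> [mC [n dC]] [mD [m dD]] CD.
have dC' := depends_on_le (leq_maxl n m) dC; have dD' := depends_on_le (leq_maxr n m) dD.
have dCD : depends_on (maxn n m) (C `|` D).
  by move=> w w' ww' [Cw|Dw]; [left; apply: dC' Cw|right; apply: dD' Dw].
rewrite (cylinder_lawE _ dCD) ?(cylinder_lawE _ dC') ?(cylinder_lawE _ dD')//.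
  by rewrite -measureU.
exact: measurableU.
Qed.

Lemma cylinder_law_le1 C : cylinder C -> (cylinder_law C <= 1)%E.
Proof. by move=> [mC _]; exact: probability_le1. Qed.

Lemma cylinder_law_fin C : cylinder C -> cylinder_law C \is a fin_num.
Proof. by move=> [mC _]; exact: fin_num_measure. Qed.

Lemma cylinder_law_section C : cylinder C -> exists n,
  cylinder_law C = (\int[Q]_s prefix_law n (section_at s C))%E /\
  (forall s, cylinder_law (section_at s C) = prefix_law n (section_at s C)).
Proof.
move=> [mC [n dC]]; exists n.
have dC' := depends_on_le (leqnSn n) dC; split.
  by rewrite (cylinder_lawE mC dC') prefix_lawS.
move=> s; apply: cylinder_lawE; first exact: measurable_section_at.
exact: depends_on_section.
Qed.

(** The failure of continuity at the empty set, in a form inherited by sections; the intersection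
    turns out to be nonempty. *)
Definition heavy (C : nat -> set W) :=
  [/\ forall n, cylinder (C n), forall n, C n.+1 `<=` C n &
    exists2 e : R, 0 < e & forall n, (e%:E <= cylinder_law (C n))%E].

(* The mass of [C n] is the [Q]-average of the masses of its sections, so the
   sets of [s] where the section has mass at least [e / 2] decrease and keep
   measure at least [e / 2]. *)
Lemma heavy_section C : heavy C -> exists s, heavy (fun n => section_at s (C n)).
Proof.
move=> [cC dC [e e0 eC]].
pose f n s := cylinder_law (section_at s (C n)).
have mf n : measurable_fun setT (f n).
  have [N [_ fN]] := cylinder_law_section (cC n).
  rewrite (_ : f n = fun s => prefix_law N (section_at s (C n))); last exact/funext.
  by apply: measurable_fun_section_at; have [] := cC n.
have intf n : cylinder_law (C n) = (\int[Q]_s f n s)%E.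
  by have [N [-> fN]] := cylinder_law_section (cC n); apply: eq_integral => s _; rewrite /f fN.
have f1 n s : (f n s <= 1)%E by apply: cylinder_law_le1; exact: cylinder_section.
have f0 n s : (0 <= f n s)%E by exact: measure_ge0.
have fd n s : (f n.+1 s <= f n s)%E.
  rewrite /f; have [mC [N dN]] := cylinder_section s (cC n).
  have [mC' [N' dN']] := cylinder_section s (cC n.+1).
  rewrite (cylinder_lawE mC (depends_on_le (leq_maxl N N') dN)).
  rewrite (cylinder_lawE mC' (depends_on_le (leq_maxr N N') dN')).
  by apply: le_measure; rewrite ?inE// => w; exact: dC.
pose B n := [set s | ((e / 2)%:E <= f n s)%E].
have mB n : measurable (B n).
  by rewrite -[X in measurable X]setTI; exact: emeasurable_fun_c_infty.
have Be n : ((e / 2)%:E <= Q (B n))%E.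
  have : (e%:E <= Q (B n) + (e / 2)%:E)%E.
    apply: (le_trans (eC n)); rewrite intf.
    apply: (@le_trans _ _ (\int[Q]_s ((\1_(B n) s)%:E + (e / 2)%:E))%E).
      apply: ge0_le_integral => //.
      - apply: emeasurable_funD; last exact: measurable_cst.
        by apply/measurable_EFinP; exact: measurable_indic.
      - move=> s _; rewrite indicE; have [sB|sB] := boolP (s \in B n) => /=.
          apply: (le_trans (f1 n s)); rewrite -EFinD lee_fin lerDl ltW//.
          by rewrite divr_gt0.
        rewrite add0e leNgt; apply/negP => lt; move/negP : sB; apply.
        by rewrite inE /B /= ltW.
    have mi : measurable_fun setT (fun s => (\1_(B n) s : R)%:E).
      by apply/measurable_EFinP; exact: measurable_indic.
    have i0 s : setT s -> (0 <= (\1_(B n) s : R)%:E)%E by rewrite lee_fin.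
    have h0 (s : S) : setT s -> (0 <= (e / 2)%:E)%E.
      by rewrite lee_fin ltW// divr_gt0.
    rewrite (@ge0_integralD _ _ _ Q setT measurableT _ _ i0 mi h0); last exact: measurable_cst.
    by rewrite integral_indic// setIT integral_constant.
  rewrite -(fineK (fin_num_measure Q _ (mB n))) -EFinD !lee_fin; lra.
have Bd : {homo B : n m / (n <= m)%N >-> (m <= n)%O}.
  apply/nonincreasing_seqP => n; apply/subsetPset => s /= /le_trans; apply.
  exact: fd.
have mBI : measurable (\bigcap_n B n) by exact: bigcap_measurable.
have cvB : (Q \o B) n @[n --> \oo] --> Q (\bigcap_n B n).
  apply: nonincreasing_cvg_mu => //.
  by apply: (@le_lt_trans _ _ 1%E); [exact: probability_le1|exact: ltry].
have : ((e / 2)%:E <= Q (\bigcap_n B n))%E.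
  rewrite -(cvg_lim _ cvB)//; apply: lime_ge; first exact: cvgP cvB.
  by apply: nearW => n; exact: Be.
have [->|/set0P[s sB] _] := eqVneq (\bigcap_n B n) set0.
  by rewrite measure0 lee_fin leNgt divr_gt0.
exists s; split.
- by move=> n; exact: cylinder_section.
- by move=> n w; exact: dC.
- by exists (e / 2) => [|n]; [rewrite divr_gt0|exact: (sB n I)].
Qed.

(** Coordinates are chosen one at a time by [heavy_section], which keeps the sections heavy. If
    [C n] depends on the first [N] coordinates, then its section after [N] choices is nonempty, and
    so the chosen sequence itself lies in [C n]. *)
Lemma heavy_nonempty C : heavy C -> (\bigcap_n C n) !=set0.
Proof.
move=> hC.
pose step (D : {C | heavy C}) : S * {C | heavy C} :=
  let s := sval (cid (heavy_section (svalP D))) in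
  (s, exist _ (fun n => section_at s (sval D n)) (svalP (cid (heavy_section (svalP D))))).
pose D := fix D k := if k is k'.+1 then (step (D k')).2 else exist heavy C hC.
pose w k := (step (D k)).1.
have DS k n : sval (D k.+1) n = section_at (w k) (sval (D k) n) by [].
have pref k n v : sval (D k) n v -> C n (fun i => if (i < k)%N then w i else v (i - k)%N).
  elim: k v => [|k IH] v.
    by rewrite (_ : (fun i => _) = v)//; apply/funext => i; rewrite subn0.
  rewrite DS => /IH; congr (C n _); apply/funext => i.
  case: (ltngtP i k) => [ik|ki|->].
  - by rewrite (ltn_trans ik).
  - rewrite ltnS leqNgt ki/= (_ : (i - k)%N = (i - k.+1).+1)//; lia.
  - by rewrite ltnSn subnn.
exists w => n _; have [cC _ _] := hC; have [mC [N dN]] := cC n.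
have [cD _ [e e0 eD]] := svalP (D N).
have [D0|/set0P[v Dv]] := eqVneq (sval (D N) n) set0.
  have := eD n; rewrite D0 (@cylinder_lawE 0) ?measure0 ?lee_fin ?leNgt ?e0//.
by apply: dN (pref _ _ _ Dv) => i iN; rewrite iN.
Qed.

(** A separate name for the sequence space, so that its measurable sets can be declared to be the
    algebra of cylinders, the domain of the Caratheodory extension. *)
Definition cylinder_type := nat -> S.

Definition cylinder_display : measure_display := sigma_display coordinate_sets.

HB.instance Definition _ := Pointed.on cylinder_type.
HB.instance Definition _ := @isAlgebraOfSets.Build cylinder_display cylinder_type
  cylinder cylinder0 cylinderU cylinderC.

(** By finite additivity only the remainders [rest n] matter. They decrease to the empty set, so by
    [heavy_nonempty] their mass cannot stay above a positive constant. *)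
Lemma cylinder_law_semi_sigma_additive :
  semi_sigma_additive (cylinder_law : set cylinder_type -> \bar R).
Proof.
move=> U mU tU mUU.
have cU i : cylinder (U i) := mU i.
pose rest n := (\bigcup_i U i) `\` \big[setU/set0]_(i < n) U i.
have cV n : cylinder (\big[setU/set0]_(i < n) U i).
  elim: n => [|n IH]; first by rewrite big_ord0; exact: cylinder0.
  by rewrite big_ord_recr /=; exact: cylinderU.
have cR n : cylinder (rest n) by exact: cylinderD.
have sumE n : (\sum_(0 <= i < n) cylinder_law (U i))%E =
    cylinder_law (\big[setU/set0]_(i < n) U i).
  elim: n => [|n IH].
    by rewrite big_geq// big_ord0 (@cylinder_lawE 0) ?measure0.
  rewrite big_nat_recr//= IH big_ord_recr /= cylinder_lawD; [by []|exact: cV|exact: cU|].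
  apply/seteqP; split => // w []; rewrite -bigcup_mkord => -[i /= ilt Ui] Un.
  move/trivIsetP : tU => /(_ i n I I); rewrite neq_ltn ilt => /(_ isT).
  by move=> U0; have : (U i `&` U n) w by []; rewrite U0.
have restE n : cylinder_law (\bigcup_i U i) =
    (cylinder_law (\big[setU/set0]_(i < n) U i) + cylinder_law (rest n))%E.
  rewrite -cylinder_lawD; [|exact: cV|exact: cR|]; last first.
    by apply/seteqP; split => // w [Vw [_ nV]].
  congr cylinder_law; apply/seteqP; split => w /=.
    by move=> Uw; have [Vw|nV] := pselect ((\big[setU/set0]_(i < n) U i) w); [left|right].
  by move=> [|[]//]; rewrite -bigcup_mkord => -[i _ Ui]; exists i.
pose r n := fine (cylinder_law (rest n)).
have r0 : r n @[n --> \oo] --> 0.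
  have rge0 n : 0 <= r n by rewrite fine_ge0// measure_ge0.
  have restS n : rest n.+1 `<=` rest n.
    by rewrite /rest big_ord_recr /= => w [Uw nU]; split => // Uw'; apply: nU; left.
  have rd n : r n.+1 <= r n.
    rewrite fine_le ?cylinder_law_fin//.
    have [mC [N dN]] := cR n; have [mC' [N' dN']] := cR n.+1.
    rewrite (cylinder_lawE mC (depends_on_le (leq_maxl N N') dN)).
    rewrite (cylinder_lawE mC' (depends_on_le (leq_maxr N N') dN')).
    by apply: le_measure; rewrite ?inE//; exact: restS.
  apply/cvgrPdist_lt => e e0; apply: contrapT => nr.
  have re n : e <= r n.
    rewrite leNgt; apply/negP => lt; apply: nr; exists n => // m /= nm.
    rewrite sub0r normrN ger0_norm//; apply: le_lt_trans lt.
    have := (nonincreasing_seqP r).1 rd; exact.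
  have [w wR] : (\bigcap_n rest n) !=set0.
    apply: heavy_nonempty; split => //; exists e => // n.
    by rewrite -(fineK (cylinder_law_fin (cR n))) lee_fin re.
  have [[i _ Ui] _] := wR 0%N I; have [_] := wR i.+1 I; apply.
  by rewrite -bigcup_mkord; exists i => //=.
rewrite (_ : (fun n => _) = fun n => (fine (cylinder_law (\bigcup_i U i)) - r n)%:E).
  rewrite -(fineK (cylinder_law_fin mUU)); apply: cvg_EFin; first by near=> n.
  rewrite -[X in _ --> X]subr0 /=; apply: cvgB => //; exact: cvg_cst.
apply/funext => n; rewrite sumE (restE n) /r.
rewrite -(fineK (cylinder_law_fin (cV n))) -(fineK (cylinder_law_fin (cR n))).
by rewrite -EFinD /= addrK.
Unshelve. all: by end_near.
Qed.

Lemma iid_sequence_exists : exists (d' : measure_display) (Y : measurableType d')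
    (P' : probability Y R) (xi : nat -> Y -> S),
  (forall i, measurable_fun setT (xi i)) /\
  forall n (B : nat -> set S), (forall i, measurable (B i)) ->
    P' (\bigcap_(i in [set i | (i < n)%N]) (xi i @^-1` B i)) =
    (\prod_(i < n) Q (B i))%E.
Proof.
have c0 : cylinder_law (set0 : set cylinder_type) = 0%E.
  by rewrite (@cylinder_lawE 0) ?measure0.
have cge0 (C : set cylinder_type) : (0 <= cylinder_law C)%E by exact: measure_ge0.
pose m1 := isMeasure.Build _ cylinder_type R cylinder_law c0 cge0
  cylinder_law_semi_sigma_additive.
pose m : {measure set cylinder_type -> \bar R} := HB.pack (cylinder_law : set cylinder_type -> \bar R) m1.
pose Y : measurableType _ := g_sigma_algebraType (@measurable _ cylinder_type).
have extE (C : set cylinder_type) : cylinder C -> measure_extension m C = cylinder_law C.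
  by move=> cC; exact: (@measurable_mu_extE _ _ cylinder_type m C cC).
have cT : cylinder setT by rewrite -setC0; apply: cylinderC; exact: cylinder0.
have eT : measure_extension m (setT : set Y) = 1%E.
  by rewrite (extE _ cT) (@cylinder_lawE 0) ?probability_setT.
pose m3 := Measure_isProbability.Build _ Y R (measure_extension m) eT.
pose P' : probability Y R := HB.pack (measure_extension m) m3.
have cc i (B : set S) : measurable B -> cylinder [set w | B (w i)].
  move=> mB; split; first exact: measurable_coordinate.
  by exists i.+1 => w w' ww' /=; rewrite ww'.
exists _, Y, P', (fun i w => w i); split.
  move=> i _ B mB; rewrite setTI; apply: sub_sigma_algebra.
  exact: cc.
move=> n B mB.
have cyl k (C : nat -> set S) : (forall i, measurable (C i)) ->
    measurable (\bigcap_(i in [set i | (i < k)%N]) [set w : W | C i (w i)]) /\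
    depends_on k (\bigcap_(i in [set i | (i < k)%N]) [set w : W | C i (w i)]).
  move=> mC; split.
    by apply: fin_bigcap_measurable => // i _; exact: measurable_coordinate.
  by move=> w w' ww' h i /= ik; rewrite -ww'//; exact: h.
have prodE k (C : nat -> set S) : (forall i, measurable (C i)) ->
    prefix_law k (\bigcap_(i in [set i | (i < k)%N]) [set w : W | C i (w i)]) =
    (\prod_(i < k) Q (C i))%E.
  elim: k C => [|k IH] C mC.
    rewrite big_ord0 (_ : \bigcap_(i in _) _ = setT) ?probability_setT//.
    by apply/seteqP; split => // w _ i.
  rewrite prefix_lawS; last by have [] := cyl k.+1 C mC.
  rewrite big_ord_recl /= -(IH (fun i => C i.+1))//.
  set V := \bigcap_(i in [set i | (i < k)%N]) [set w : W | C i.+1 (w i)].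
  have mV : measurable V by have [] := cyl k (fun i => C i.+1) (fun i => mC _).
  rewrite (eq_integral (fun s => (\1_(C 0%N) s)%:E * prefix_law k V)%E).
    rewrite ge0_integralZr//; last by apply/measurable_EFinP; exact: measurable_indic.
    by rewrite integral_indic// setIT.
  move=> s _; rewrite indicE; have [sC|sC] := boolP (s \in C 0%N).
    rewrite mul1e; congr (prefix_law k _); apply/seteqP; split => w /=.
      by move=> h i ik; exact: (h i.+1).
    by move=> h [|i] /= ik; [exact/set_mem|exact: h].
  rewrite mul0e (_ : section_at _ _ = set0) ?measure0//.
  apply/seteqP; split => // w /(_ 0%N isT) /= sC0.
  by move/negP : sC; apply; rewrite inE.
have [mC dC] := cyl n B mB.
rewrite -prodE// -(cylinder_lawE mC dC); apply: extE.
by split => //; exists n.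
Qed.

End InfiniteProduct.

(** * Integrals of arbitrary functions are insensitive to null sets *)

Section NullModification.
Context (d : measure_display) (X : measurableType d) (R : realType)
  (mu : {measure set X -> \bar R}).
Import HBNNSimple.

(* No measurability of [f] is assumed: the integral of a nonnegative function
   is a supremum over the simple functions below it. *)
Lemma ge0_integral_null (N : set X) (f : X -> \bar R) : measurable N ->
  mu N = 0%E -> (forall x, 0 <= f x)%E ->
  (\int[mu]_x f x = \int[mu]_x (f \_ (~` N)) x)%E.
Proof.
move=> mN N0 f0; have mNC : measurable (~` N) by exact: measurableC.
have g0 x : (0 <= (f \_ (~` N)) x)%E by rewrite patchE; case: ifP.
rewrite !ge0_integralTE//; apply/eqP; rewrite eq_le; apply/andP; split.
- apply: ge_ereal_sup => _ [h hf <-].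
  apply: ereal_sup_ubound; exists (proj_nnsfun h mNC).
    move=> x; rewrite -[proj_nnsfun h mNC x]/((proj_nnsfun h mNC : X -> R) x) -mrestrict !patchE.
    by case: ifP => // _; exact: hf.
  rewrite -mrestrict -(integral_nnsfun mu mNC h).
  rewrite -[RHS](_ : (\int[mu]_x (h x)%:E = _)%E); last first.
    by rewrite integral_nnsfun// patch_setT.
  rewrite [RHS](ge0_negligible_integral mN)// ?setTD//.
  - by apply/measurable_EFinP.
  - by move=> x _; rewrite lee_fin.
- apply: le_ereal_sup => _ [h hf <-]; exists h => // x; apply: le_trans (hf x) _.
  by rewrite patchE; case: ifP.
Qed.

(** Lets the integrals in [wconv] be restricted to recurrent points, where the processes can be
    shown to be measurable. *)
Lemma integral_null (B D : set X) (f : X -> \bar R) : measurable B -> measurable D ->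
  D `<=` B -> mu (B `\` D) = 0%E ->
  (\int[mu]_(x in B) f x = \int[mu]_(x in D) f x)%E.
Proof.
move=> mB mD DB BD0.
have mN : measurable (B `\` D) by exact: measurableD.
have key (g : X -> \bar R) : (forall x, 0 <= g x)%E ->
    (\int[mu]_(x in B) g x = \int[mu]_(x in D) g x)%E.
  move=> g0; rewrite integral_mkcond [RHS]integral_mkcond.
  have r0 x : (0 <= (g \_ B) x)%E by rewrite patchE; case: ifP.
  rewrite (ge0_integral_null mN BD0 r0); congr integral; apply/funext => x.
  rewrite !patchE; have [xD|xD] := boolP (x \in D).
    have -> : x \in B by rewrite inE; apply: DB; exact/set_mem.
    by rewrite ifT// inE => -[_]; apply; exact/set_mem.
  case: ifPn => // xBD; case: ifPn => // xB; exfalso.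
  move: xBD; rewrite inE; apply; split; first exact/set_mem.
  by move=> Dx; move/negP : xD; apply; rewrite inE.
by rewrite integralE [RHS]integralE !key// => x; rewrite ?funepos_ge0 ?funeneg_ge0.
Qed.

End NullModification.

(** * Finite partitions of [F] into small continuity sets *)

Section ContinuityCells.
Context (R : realType) (F : pseudoMetricType R)
  (dO : measure_display) (Om : measurableType dO) (P : probability Om R)
  (psi : Om -> F).
Hypothesis mpsi : borel_measurable_on setT psi.

Local Notation nullb := (null_boundary P psi).

(** Level sets are disjoint, so for each [n] only finitely many have mass at least [1 / (n + 1)]; if
    all levels in []0, c[] were charged, that interval would be countable, hence Lebesgue null. *)
Lemma null_level (f : Om -> R) (c : R) : measurable_fun setT f -> 0 < c ->
  exists2 r : R, 0 < r < c & P (f @^-1` [set r]) = 0%E.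
Proof.
move=> mf c0; apply: contrapT => nex.
have ml r : measurable (f @^-1` [set r]).
  by rewrite -[X in measurable X]setTI; exact: mf.
have pos r : 0 < r < c -> 0 < pr P (f @^-1` [set r]).
  move=> rc; rewrite lt_neqAle pr_ge0 andbT eq_sym; apply/eqP => p0; apply: nex.
  by exists r => //; rewrite -(EFin_pr P (ml r)) p0.
pose S (n : nat) := [set r : R | 0 < r < c /\ n.+1%:R^-1 <= pr P (f @^-1` [set r])].
have finS n : finite_set (S n).
  apply: contrapT => /infiniteP/pcard_leP/injfunPex[g gS ginj].
  have tri : trivIset setT (fun i => f @^-1` [set g i]).
    apply/trivIsetP => i j _ _ /eqP ij; apply/seteqP; split => // w [/= fi fj].
    by apply: ij; apply: ginj; rewrite ?inE// -fi -fj.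
  have cv := @pr_bigcup _ _ _ P _ (fun i => ml (g i)) tri.
  have : pr P (f @^-1` [set g i]) @[i --> \oo] --> 0.
    by apply: cvg_series_cvg_0; apply: cvgP cv.
  have n0 : 0 < n.+1%:R^-1 :> R by rewrite invr_gt0.
  move=> /cvg0P/(_ _ n0)[i _ /(_ i (leqnn i))] /=.
  by rewrite ger0_norm ?pr_ge0// ltNge; have [_ ->] := gS i I.
have cS : countable `]0, c[%classic.
  apply: (@sub_countable _ _ _ (\bigcup_n S n)); last first.
    by apply: bigcup_countable => // n _; exact: finite_set_countable.
  apply: subset_card_le => r /=; rewrite in_itv /= => rc.
  have p0 := pos _ rc; exists (Num.truncn (pr P (f @^-1` [set r]))^-1) => //; split => //.
  by rewrite -[leRHS]invrK lef_pV2 ?posrE ?invr_gt0// ltW// truncnS_gt.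
have := countable_lebesgue_measure0 cS.
by rewrite lebesgue_measure_itv /= lte_fin c0 -EFinD subr0 => -[c00]; move: c0; rewrite c00 ltxx.
Qed.

Lemma null_boundary_measurable C : measurable (psi @^-1` (closure C `\` interior C)).
Proof.
have := mpsi (borel_setsD (borel_sets_closed (@closed_closure _ C))
  (borel_sets_open (@open_interior _ C))).
by rewrite setTI.
Qed.

Lemma null_boundaryC C : nullb C -> nullb (~` C).
Proof.
rewrite /null_boundary closure_setC interiorC => <-; congr (P _).
by rewrite setDE setCK setIC.
Qed.

Lemma null_boundaryU C D : nullb C -> nullb D -> nullb (C `|` D).
Proof.
move=> nC nD.
apply: (@subset_measure0 _ _ _ P _ (psi @^-1` (closure C `\` interior C) `|`
    psi @^-1` (closure D `\` interior D))).
- exact: null_boundary_measurable.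
- by apply: measurableU; exact: null_boundary_measurable.
- move=> w [/=]; rewrite closureU => cCD nI.
  have nCw : ~ interior C (psi w).
    by move=> iC; apply: nI; apply: interiorS iC; exact: subsetUl.
  have nDw : ~ interior D (psi w).
    by move=> iD; apply: nI; apply: interiorS iD; exact: subsetUr.
  by case: cCD => ?; [left|right].
- by apply: null_set_setU => //; exact: null_boundary_measurable.
Qed.

Lemma null_boundaryD C D : nullb C -> nullb D -> nullb (C `\` D).
Proof.
move=> nC nD; rewrite setDE -[_ `&` _]setCK setCI setCK.
by apply: null_boundaryC; apply: null_boundaryU => //; exact: null_boundaryC.
Qed.

Lemma null_boundary0 : nullb set0.
Proof. by rewrite /null_boundary closure0 set0D preimage_set0 measure0. Qed.

(** The boundary of [{s < r}] lies in the level set [{s = r}], which [null_level] makes null for a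
    suitable [r]. *)
Lemma small_continuity_nbhd (x : F) (e : R) : 0 < e -> exists U : set F,
  [/\ open U, U x, nullb U & U `<=` ball x e].
Proof.
move=> e0; pose s := set_dist [set x].
have cs : continuous s := continuous_set_dist (C := [set x]).
have ms : measurable_fun setT (s \o psi) := borel_measurable_continuous mpsi cs.
have c0 : 0 < contract e%:E by rewrite -(contract0 R) lt_contract lte_fin.
have [r /andP[r0 rc] Pr] := null_level ms c0.
exists [set z | s z < r]; split.
- rewrite (_ : [set z | _] = s @^-1` [set y | y < r])//.
  by apply: open_comp; [move=> z _; exact: cs|exact: open_lt].
- by rewrite /= /s set_dist0.
- apply: (@subset_measure0 _ _ _ P _ (psi @^-1` (s @^-1` [set r]))) => //.
  + exact: null_boundary_measurable.
  + by rewrite -comp_preimage -[X in measurable X]setTI; exact: ms.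
  + move=> w [cl nI] /=.
    have oU : open [set z | s z < r].
      rewrite (_ : [set z | _] = s @^-1` [set y | y < r])//.
      by apply: open_comp; [move=> z _; exact: cs|exact: open_lt].
    have clr : closed [set z | s z <= r].
      rewrite (_ : [set z | _] = s @^-1` [set y | y <= r])//.
      by apply: closed_comp; [move=> z _; exact: cs|exact: closed_le].
    have le_r : s (psi w) <= r.
      have : closure [set z | s z <= r] (psi w).
        by apply: closureS cl => z /=; exact: ltW.
      by move/closure_id : clr => clr; rewrite -clr.
    apply/eqP; rewrite eq_le le_r leNgt; apply/negP => lt; apply: nI.
    by move/interior_id : oU => ->.
- by move=> z /= /lt_trans/(_ rc); exact: set_dist_ball.
Qed.

Lemma small_continuity_partition (e : R) : compact [set: F] -> 0 < e ->
  exists (m : nat) (C : nat -> set F), [/\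
    forall i, borel_sets (C i) /\ nullb (C i),
    forall z, exists i : 'I_m.+1, C i z,
    forall i i' z, C i z -> C i' z -> i = i' &
    forall i z z', C i z -> C i z' -> ball z e z'].
Proof.
move=> cF e0; have e2 : 0 < e / 2 by rewrite divr_gt0.
have [U UP] := choice (fun x => small_continuity_nbhd x e2).
pose Fp : ptopologicalType := HB.pack F (isPointed.Build F (psi point)).
have cc : @cover_compact Fp setT by rewrite -compact_cover; exact: cF.
case: (cc F setT U) => [x _|x _|D _ cov]; [by have [] := UP x|by exists x => //; have [] := UP x|].
pose s : seq F := finmap.enum_fset D; pose m := size s; pose x0 := psi point.
(* Indices from [m] on give empty cells; using [m.+1] cells keeps the index type inhabited. *)
pose V i := if (i < m)%N then U (nth x0 s i) else set0.
have VP i : borel_sets (V i) /\ nullb (V i).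
  rewrite /V; case: ifP => _; last by split; [exact: borel_sets0|exact: null_boundary0].
  by have [oU _ nU _] := UP (nth x0 s i); split => //; exact: borel_sets_open.
have WP i : borel_sets (\big[setU/set0]_(j < i) V j) /\ nullb (\big[setU/set0]_(j < i) V j).
  elim: i => [|i [b1 n1]].
    by rewrite big_ord0; split; [exact: borel_sets0|exact: null_boundary0].
  have [b2 n2] := VP i; rewrite big_ord_recr /=.
  by split; [exact: borel_setsU|exact: null_boundaryU].
exists m, (fun i => V i `\` \big[setU/set0]_(j < i) V j); split.
- move=> i; have [b1 n1] := VP i; have [b2 n2] := WP i.
  by split; [exact: borel_setsD|exact: null_boundaryD].
- move=> z; have [x /= xD Uz] := cov z I.
  have exV : exists i, `[< V i z >].
    exists (index x s); apply/asboolP; have xs : x \in s by [].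
    by rewrite /V index_mem xs nth_index.
  have [i /asboolP Vi imin] := ex_minnP exV.
  have im : (i < m.+1)%N.
    by move: Vi; rewrite /V; case: ifP => // im _; exact: ltnW.
  exists (Ordinal im) => /=; split => //; rewrite -bigcup_mkord => -[j /= ji Vj].
  have : (i <= j)%N by apply: imin; exact/asboolP.
  by rewrite leqNgt ji.
- move=> i i' z [Vi nVi] [Vi' nVi']; apply/eqP; rewrite eqn_leq.
  apply/andP; split; rewrite leqNgt; apply/negP => lt.
    by apply: nVi; rewrite -bigcup_mkord; exists i'.
  by apply: nVi'; rewrite -bigcup_mkord; exists i.
- move=> i z z' [Vz _] [Vz' _]; move: Vz Vz'; rewrite /V; case: ifP => // _.
  have [_ _ _ Ub] := UP (nth x0 s i) => /Ub bz /Ub bz'.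
  by rewrite (splitr e); apply: ball_triangle bz'; exact: ball_sym.
Qed.

End ContinuityCells.

(** * Time intervals as cells of []0, +oo]] *)

Section TimeCells.
Context {R : realType}.

(** [(a, Some b)] encodes []a, b]], and [(a, None)] encodes []a, +oo]] with [+oo] included. Cells
    are open on the left because the tractable events are [{t < mu (A) phi}]. *)
Definition cell_valid (I : R * option R) :=
  0 <= I.1 /\ (forall b, I.2 = Some b -> I.1 <= b).

Definition in_cell (I : R * option R) (x : \bar R) :=
  (I.1%:E < x)%E /\ (forall b, I.2 = Some b -> (x <= b%:E)%E).

Definition cell_mass (I : R * option R) : R :=
  expR (- I.1) - (if I.2 is Some b then expR (- b) else 0).

Lemma small_cells (e : R) : 0 < e -> exists (N : nat) (I : nat -> R * option R), [/\
  forall k, cell_valid (I k),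
  forall x, (0 < x)%E -> exists k : 'I_N.+1, in_cell (I k) x,
  forall (k k' : 'I_N.+1) x, in_cell (I k) x -> in_cell (I k') x -> k = k' &
  forall (k : 'I_N.+1) x y, in_cell (I k) x -> in_cell (I k) y -> ball x e y].
Proof.
move=> e0; pose N := Num.truncn e^-1; pose M : R := N.+1%:R.
have M0 : 0 < M by rewrite ltr0n.
have Me : 1 < M * e.
  have := truncnS_gt e^-1; rewrite -/N -/M => lt.
  by rewrite -(mulVf (lt0r_neq0 e0)) ltr_pM2r.
(* [contract] sends [r >= 0] to [r / (1 + r)], so [a k] is the preimage of [k / M]: in the metric of
   the extended reals all cells have length at most [1 / M < e]. The last endpoint would be [+oo],
   whence [None]. *)
pose a (k : nat) : R := (k%:R / M) / (1 - k%:R / M).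
have kM (k : nat) : (k < N.+1)%N -> k%:R / M < 1.
  by move=> kN; rewrite ltr_pdivrMr// mul1r ltr_nat.
have a0 (k : nat) : (k < N.+1)%N -> 0 <= a k.
  move=> kN; rewrite divr_ge0// ?subr_ge0; last exact: ltW (kM _ kN).
  by rewrite divr_ge0// ltW.
have ca (k : nat) : (k < N.+1)%N -> contract (a k)%:E = k%:R / M.
  move=> kN; have lt := kM _ kN; rewrite /contract ger0_norm ?a0// /a.
  move: (k%:R / M) lt => p lt; field; lra.
pose I (k : nat) : R * option R := if (k < N.+1)%N then
  (a k, if (k.+1 < N.+1)%N then Some (a k.+1) else None) else (0, None).
have ccE k x : (k < N.+1)%N -> in_cell (I k) x <->
    k%:R < M * contract x /\ M * contract x <= k.+1%:R.
  move=> kN; rewrite /in_cell /I kN /= -lt_contract ca// ltr_pdivrMr// (mulrC M).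
  split => -[-> h]; split => //.
  - case: ifP h => [kN' /(_ _ erefl)|kN' _].
      by rewrite -le_contract ca// ler_pdivlMr.
    have -> : k.+1 = N.+1 by apply/eqP; rewrite eqn_leq kN ltnNge -ltnS kN'.
    rewrite -/M -[leRHS]mul1r ler_pM2r//.
    exact: le_trans (ler_norm _) (contract_le1 _).
  - move=> b; case: ifP => // kN' [<-].
    by rewrite -le_contract ca// ler_pdivlMr.
exists N, I; split.
- move=> k; rewrite /I; case: ifP => kN; split => //=; first exact: a0.
  move=> b; case: ifP => // kN' [<-].
  rewrite -lee_fin -le_contract !ca// ler_pM2r ?invr_gt0// ler_nat.
  exact: leqnSn.
- move=> x x0.
  have c0 : 0 < M * contract x by rewrite mulr_gt0// -(contract0 R) lt_contract.
  have exk : exists k : nat, M * contract x <= k.+1%:R.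
    exists N; rewrite -/M -[leRHS]mulr1 ler_pM2l//.
    exact: le_trans (ler_norm _) (contract_le1 _).
  have [k kx kmin] := ex_minnP exk.
  have kN : (k < N.+1)%N.
    rewrite ltnS; apply: kmin; rewrite -/M -[leRHS]mulr1 ler_pM2l//.
    exact: le_trans (ler_norm _) (contract_le1 _).
  exists (Ordinal kN); apply/ccE => //=; split => //.
  case: k kx kmin kN => [//|k] _ kmin _; rewrite ltNge; apply/negP => /kmin.
  by rewrite ltnn.
- move=> k k' x /(ccE _ _ (ltn_ord k))[k1 k2] /(ccE _ _ (ltn_ord k'))[k1' k2'].
  have := lt_le_trans k1 k2'; have := lt_le_trans k1' k2; rewrite !ltr_nat !ltnS => h1 h2.
  by apply/val_inj/eqP; rewrite /= eqn_leq h1 h2.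
- move=> k x y /(ccE _ _ (ltn_ord k))[x1 x2] /(ccE _ _ (ltn_ord k))[y1 y2].
  rewrite /ball /= /ereal_ball -(ltr_pM2l M0); apply: le_lt_trans Me.
  rewrite -[M in M * `|_|]gtr0_norm// -normrM mulrBr.
  by move: x1 x2 y1 y2; rewrite -natr1 ler_norml => *; apply/andP; split; lra.
Qed.

End TimeCells.

(** * Compactness and uniform continuity on the space of paths *)

Section ProductSpace.
Context (R : realType) (F : pseudoMetricType R).

Local Notation SZ := ({ptws nat -> \bar R} * {ptws nat -> F})%type.

Definition coord_close (n : nat) (e : R) (z z' : SZ) := forall j, (j < n)%N ->
  ball (z.1 j) e (z'.1 j) /\ ball (z.2 j) e (z'.2 j).

Lemma coord_close_nbhs n e (z : SZ) : 0 < e -> nbhs z (coord_close n e z).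
Proof.
move=> e0; have FF : Filter (nbhs z) by exact: nbhs_filter.
elim: n => [|n IH]; first by apply: filterE => z' j; rewrite ltn0.
have c1 : nbhs z [set z' : SZ | ball (z.1 n) e (z'.1 n)].
  have : (fun z' : SZ => z'.1 n) @ z --> z.1 n.
    apply: (@continuous_comp _ _ _ (fst : SZ -> _) (fun f : {ptws nat -> \bar R} => f n)).
      exact: cvg_fst.
    exact: (@proj_continuous _ (fun=> \bar R) n).
  by apply; exact: nbhsx_ballx.
have c2 : nbhs z [set z' : SZ | ball (z.2 n) e (z'.2 n)].
  have : (fun z' : SZ => z'.2 n) @ z --> z.2 n.
    apply: (@continuous_comp _ _ _ (snd : SZ -> _) (fun f : {ptws nat -> F} => f n)).
      exact: cvg_snd.
    exact: (@proj_continuous _ (fun=> F) n).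
  by apply; exact: nbhsx_ballx.
apply: filterS (filterI IH (filterI c1 c2)) => z' [h [h1 h2]] j.
by rewrite ltnS leq_eqVlt => /orP[/eqP->|/h].
Qed.

(** The same [n] counts the coordinates and sets the radius, so a counterexample for each [n] gives
    a sequence converging coordinatewise to [z]. *)
Lemma coord_close_base (g : SZ -> R) (z : SZ) (e : R) : continuous g -> 0 < e ->
  exists n, forall z', coord_close n n.+1%:R^-1 z z' -> `|g z - g z'| < e.
Proof.
move=> cg e0; apply: contrapT => nex.
have bad n : exists z', coord_close n n.+1%:R^-1 z z' /\ e <= `|g z - g z'|.
  apply: contrapT => nz; apply: nex; exists n => z' cz; rewrite ltNge; apply/negP => le.
  by apply: nz; exists z'.
have [y yP] := choice bad.
have small (eps : R) : 0 < eps -> \forall n \near \oo, n.+1%:R^-1 < eps.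
  by move=> eps0; have := near_infty_natSinv_lt (PosNum eps0).
have y1 : (fun n => (y n).1) @ \oo --> z.1.
  apply/(@pointwise_cvgP nat (\bar R)) => j.
  suff : (fun n => (y n).1 j) @ \oo --> z.1 j by [].
  apply/cvg_ballP => eps eps0.
  near=> n; have [h _] := yP n; have [|b _] := h j; first by near: n; exists j.+1.
  by apply: le_ball b; apply/ltW; near: n; exact: small.
have y2 : (fun n => (y n).2) @ \oo --> z.2.
  apply/(@pointwise_cvgP nat F) => j.
  suff : (fun n => (y n).2 j) @ \oo --> z.2 j by [].
  apply/cvg_ballP => eps eps0.
  near=> n; have [h _] := yP n; have [|_ b] := h j; first by near: n; exists j.+1.
  by apply: le_ball b; apply/ltW; near: n; exact: small.
have yz : y @ \oo --> z.
  rewrite (_ : y = fun n => ((y n).1, (y n).2)); last by apply/funext => n; case: (y n).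
  by move=> V zV; exact: (cvg_pair y1 y2 zV).
have : (g \o y) @ \oo --> g z by apply: cvg_comp yz _; exact: cg.
move=> /cvgrPdist_lt/(_ _ e0)[n _ /(_ n (leqnn n))] /=.
by rewrite ltNge; have [_ ->] := yP n.
Unshelve. all: by end_near.
Qed.

(** A cluster point is found in [[-1, 1]] through [contract] and pulled back by [expand]. *)
Lemma compact_ereal : compact [set: \bar R].
Proof.
move=> G PG _.
have [c [cI cl]] : `[-1, 1]%classic `&` cluster ((@contract R) @ G) !=set0.
  apply: segment_compact; suff : G (@contract R @^-1` `[-1, 1]%classic) by [].
  apply: filterE => x /=; rewrite in_itv /= -ler_norml.
  exact: contract_le1.
exists (expand c); split => // B U GB; rewrite -nbhs_ballE => -[e /= e0 bU].
have [_ [[b Bb <-] cb]] : ((@contract R) @` B `&` ball c e) !=set0.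
  apply: cl; last exact: nbhsx_ballx.
  suff : G (@contract R @^-1` (@contract R @` B)) by [].
  by apply: filterS GB => x Bx; exists x.
exists b; split => //; apply: bU; rewrite /ball /= /ereal_ball expandK//.
by rewrite inE ler_norml; move: cI; rewrite /= in_itv.
Qed.

Lemma compact_SZ : compact [set: F] -> compact [set: SZ].
Proof.
move=> cF; have c1 : compact [set: {ptws nat -> \bar R}].
  have := @tychonoff nat (fun=> \bar R) (fun=> setT) (fun=> compact_ereal).
  by rewrite (_ : [set f | _] = setT)//; apply/seteqP; split.
have c2 : compact [set: {ptws nat -> F}].
  have := @tychonoff nat (fun=> F) (fun=> setT) (fun=> cF).
  by rewrite (_ : [set f | _] = setT)//; apply/seteqP; split.
by rewrite -setXTT; exact: compact_setX.
Qed.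

(** The Heine-Cantor argument: the first members of bad pairs have a cluster point [z], and
    continuity at [z] bounds both members of a late pair. *)
Lemma coord_close_uniform (g : SZ -> R) (e : R) : compact [set: F] ->
  continuous g -> 0 < e -> exists n e', 0 < e' /\
  forall z z', coord_close n e' z z' -> `|g z - g z'| < e.
Proof.
move=> cF cg e0; have e2 : 0 < e / 2 by rewrite divr_gt0.
apply: contrapT => nex.
have bad n : exists zz' : SZ * SZ, coord_close n n.+1%:R^-1 zz'.1 zz'.2 /\
    e <= `|g zz'.1 - g zz'.2|.
  apply: contrapT => nz; apply: nex; exists n, n.+1%:R^-1; split; first by rewrite invr_gt0.
  move=> z z' cz; rewrite ltNge; apply/negP => le.
  by apply: nz; exists (z, z').
have [y yP] := choice bad.
have := @compact_SZ cF (fmap (fst \o y) \oo) _ _.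
case; first by apply: filterS filterT.
move=> z [_ clz].
have [n nP] := coord_close_base z cg e2.
(* Half of the radius goes from [z] to the first member, the other half from the first member to the
   second. *)
have h0 : 0 < n.+1%:R^-1 / 2 :> R by rewrite divr_gt0.
have small : \forall k \near \oo, k.+1%:R^-1 < n.+1%:R^-1 / 2 :> R.
  by have := near_infty_natSinv_lt (PosNum h0).
have ev : \forall k \near \oo, k.+1%:R^-1 < n.+1%:R^-1 / 2 :> R /\ (n <= k)%N.
  by near=> k; split; near: k => //; exists n.
have [_ [[k [ks nk] <-] cz]] : ((fst \o y) @` [set k | k.+1%:R^-1 < n.+1%:R^-1 / 2 :> R /\ (n <= k)%N]
    `&` coord_close n (n.+1%:R^-1 / 2) z) !=set0.
  apply: clz; last exact: coord_close_nbhs.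
  by apply: filterS ev => k kP; exists k.
have [ck ek] := yP k.
have lt1 : `|g z - g (y k).1| < e / 2.
  apply: nP => j jn; have [b1 b2] := cz j jn; split; [apply: le_ball b1|apply: le_ball b2];
    by rewrite ler_pdivrMr// ler_peMr// ?invr_ge0// ler1n.
have lt2 : `|g z - g (y k).2| < e / 2.
  apply: nP => j jn; have [b1 b2] := cz j jn.
  have [d1 d2] := ck j (leq_trans jn nk).
  rewrite (splitr n.+1%:R^-1); split.
  - by apply: (ball_triangle b1); apply: le_ball d1; exact: ltW.
  - by apply: (ball_triangle b2); apply: le_ball d2; exact: ltW.
move: ek; rewrite leNgt => /negP; apply.
have := ler_distD (g z) (g (y k).1) (g (y k).2); rewrite (distrC (g (y k).1) (g z)).
by move: lt1 lt2; lra.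
Unshelve. all: by end_near.
Qed.

End ProductSpace.

(** * Uniform approximation of continuous functions by step functions on cells *)

Section CellApproximation.
Context (R : realType) (F : pseudoMetricType R).

Local Notation SZ := ({ptws nat -> \bar R} * {ptws nat -> F})%type.

Definition in_cells n (I : nat -> R * option R) (C : nat -> set F) (z : SZ) :=
  forall j, (j < n)%N -> in_cell (I j) (z.1 j) /\ C j (z.2 j).

(** Only paths with positive times are considered, as the time cells cover []0, +oo]]; uniqueness of
    the cell makes the step function a sum with a single nonzero indicator. *)
Definition cell_approx (K : finType) n (I : K -> nat -> R * option R)
    (C : K -> nat -> set F) (v : K -> R) (g : SZ -> R) (e : R) :=
  forall z : SZ, (forall j, (0 < z.1 j)%E) -> exists c0,
    [/\ in_cells n (I c0) (C c0) z,
        forall c, in_cells n (I c) (C c) z -> c = c0 & `|g z - v c0| < e].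

Lemma cell_approximation (good : set F -> Prop) (g : SZ -> R) (e : R) :
  (forall e : R, 0 < e -> exists (m : nat) (C : nat -> set F), [/\
    forall i, good (C i), forall z, exists i : 'I_m.+1, C i z,
    forall i i' z, C i z -> C i' z -> i = i' &
    forall i z z', C i z -> C i z' -> ball z e z']) ->
  compact [set: F] -> continuous g -> 0 < e ->
  exists (K : finType) (n : nat) (I : K -> nat -> R * option R)
    (C : K -> nat -> set F) (v : K -> R),
  [/\ forall c j, cell_valid (I c j), forall c j, good (C c j) &
      cell_approx n I C v g e].
Proof.
move=> part cF cg e0.
have [n [e' [e'0 unif]]] := coord_close_uniform cF cg e0.
have [m [C0 [C0P C0cov C0uniq C0ball]]] := part _ e'0.
have [N [I0 [I0v I0cov I0uniq I0ball]]] := small_cells e'0.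
pose K : finType := (n.-tuple ('I_N.+1 * 'I_m.+1))%type.
pose df : 'I_N.+1 * 'I_m.+1 := (ord0, ord0).
pose I (c : K) j := I0 (nth df c j).1; pose C (c : K) j := C0 (nth df c j).2.
pose pos (z : SZ) := forall j, (0 < z.1 j)%E.
(* A sample value of [g] on the cell, with an arbitrary 0 when there is no point to sample. *)
pose v (c : K) : R :=
  if pselect (exists z, pos z /\ in_cells n (I c) (C c) z) is left h
  then g (sval (cid h)) else 0.
exists K, n, I, C, v; split; [by move=> c j; exact: I0v|by move=> c j; exact: C0P|].
move=> z zpos.
have exI x : exists k : 'I_N.+1, (0 < x)%E -> in_cell (I0 k) x.
  have [x0|x0] := pselect (0 < x)%E; last by exists ord0 => /x0.
  by have [k kx] := I0cov x x0; exists k.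
have [kI kIP] := choice exI; have [kC kCP] := choice C0cov.
pose c0 : K := [tuple (kI (z.1 j), kC (z.2 j)) | j < n].
have c0E j : (j < n)%N -> nth df c0 j = (kI (z.1 j), kC (z.2 j)).
  by move=> jn; rewrite -[j in LHS]/(nat_of_ord (Ordinal jn)) -tnth_nth tnth_mktuple.
have cz : in_cells n (I c0) (C c0) z.
  by move=> j jn; rewrite /I /C c0E//=; split; [apply: kIP; exact: zpos|exact: kCP].
exists c0; split => //.
- move=> c cc; apply: eq_from_tnth => j; have jn := ltn_ord j.
  have [iI iC] := cc j jn; rewrite !(tnth_nth df) c0E//.
  rewrite [LHS]surjective_pairing; congr pair.
    by apply: (I0uniq _ _ _ iI); apply: kIP; exact: zpos.
  by apply: val_inj; exact: (C0uniq _ _ _ iC (kCP (z.2 j))).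
- rewrite /v; case: pselect => [h|[]]; last by exists z.
  case: cid => z' /= [_ cz']; apply: unif => j jn.
  have [a1 a2] := cz j jn; have [b1 b2] := cz' j jn.
  by split; [exact: I0ball a1 b1|exact: C0ball a2 b2].
Qed.

End CellApproximation.

(** * Integrals of continuous functionals through cell probabilities *)

Section CellIntegral.
Context (R : realType) (F : pseudoMetricType R).
Local Notation SZ := ({ptws nat -> \bar R} * {ptws nat -> F})%type.
Context (d : measure_display) (Y : measurableType d) (m : probability Y R).
Variables (B D : set Y) (Z : Y -> SZ) (good : set F -> Prop).
Hypotheses (mB : measurable B) (mD : measurable D) (DB : D `<=` B)
  (BD0 : m (B `\` D) = 0%E)
  (Zpos : forall x, D x -> forall j, (0 < (Z x).1 j)%E)
  (mcell : forall n I C, (forall j, cell_valid (I j)) -> (forall j, good (C j)) ->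
    measurable (D `&` [set x | in_cells n I C (Z x)])).

Definition step_fun (K : finType) n (I : K -> nat -> R * option R)
    (C : K -> nat -> set F) (v : K -> R) (x : Y) : R :=
  \sum_(c : K) v c * \1_(D `&` [set x | in_cells n (I c) (C c) (Z x)]) x.

Lemma bounded_measurable_sum (K : Type) (r : seq K) (h : K -> Y -> R) :
  (forall c, bounded_measurable (h c)) ->
  bounded_measurable (fun x => \sum_(c <- r) h c x) /\
  \int[m]_x (\sum_(c <- r) h c x) = \sum_(c <- r) \int[m]_x h c x.
Proof.
move=> bh; elim: r => [|c r [b1 i1]].
  under [fun x => _]eq_fun do rewrite big_nil.
  by rewrite big_nil Rint_cst; split => //; exact: bounded_measurable_cst.
under [fun x => _]eq_fun do rewrite big_cons.
split; first exact: bounded_measurableD.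
by rewrite big_cons RintD// i1.
Qed.

Section Approx.
Variables (K : finType) (n : nat) (I : K -> nat -> R * option R)
  (C : K -> nat -> set F) (v : K -> R) (g : SZ -> R) (e : R).
Hypotheses (vI : forall c j, cell_valid (I c j)) (gC : forall c j, good (C c j))
  (app : cell_approx n I C v g e).

Let mc c : measurable (D `&` [set x | in_cells n (I c) (C c) (Z x)]).
Proof. exact: mcell. Qed.

Lemma bounded_measurable_step :
  bounded_measurable (step_fun n I C v) /\
  \int[m]_x step_fun n I C v x =
  \sum_c v c * pr m (D `&` [set x | in_cells n (I c) (C c) (Z x)]).
Proof.
have bc c : bounded_measurable
    (fun x => v c * \1_(D `&` [set x | in_cells n (I c) (C c) (Z x)]) x).
  apply: bounded_measurableM; first exact: bounded_measurable_cst.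
  exact: bounded_measurable_indic.
have [b1 i1] := bounded_measurable_sum (index_enum K) bc; split => //.
rewrite /step_fun i1; apply: eq_bigr => c _.
by rewrite RintZ ?Rint_indic//; exact: bounded_measurable_indic.
Qed.

Lemma step_fun_approx x : D x -> `|g (Z x) - step_fun n I C v x| < e.
Proof.
move=> Dx; have [c0 [cz cu ce]] := app (Zpos Dx).
rewrite /step_fun (bigD1 c0)//= big1 ?addr0.
  rewrite indicE (_ : x \in _) ?mulr1//.
  by rewrite inE; split.
move=> c cc0; rewrite indicE (_ : (x \in _) = false) ?mulr0//.
by apply/negP; rewrite inE => -[_ /= /cu cc]; rewrite cc eqxx in cc0.
Qed.

Lemma step_fun_out x : ~ D x -> step_fun n I C v x = 0.
Proof.
move=> nD; rewrite /step_fun big1// => c _; rewrite indicE (_ : (x \in _) = false) ?mulr0//.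
by apply/negP; rewrite inE => -[].
Qed.

End Approx.

Variable (g : SZ -> R) (M : R).
Hypotheses (gM : forall z, `|g z| <= M)
  (gapp : forall e : R, 0 < e -> exists (K : finType) (n : nat)
    (I : K -> nat -> R * option R) (C : K -> nat -> set F) (v : K -> R),
    [/\ forall c j, cell_valid (I c j), forall c j, good (C c j) &
        cell_approx n I C v g e]).

Let f := (g \o Z) \_ D.

(** Only the cells are assumed measurable. On [D] the composite [g \o Z] is a uniform limit of step
    functions on cells, and off [D] both [f] and the step functions vanish. *)
Lemma bounded_measurable_cell_limit : bounded_measurable f.
Proof.
split; last first.
  exists M => x; rewrite /f patchE; case: ifP => _; first exact: gM.
  have -> : (point : R) = 0 by [].
  by rewrite normr0; apply: le_trans (gM (Z x)); exact: normr_ge0.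
have ex k : exists s : Y -> R, measurable_fun setT s /\
    forall x, `|f x - s x| < k.+1%:R^-1.
  have k0 : 0 < k.+1%:R^-1 :> R by rewrite invr_gt0.
  have [K [n [I [C [v [vI gC app]]]]]] := gapp k0.
  exists (step_fun n I C v); split.
    by have [[]] := bounded_measurable_step n v vI gC.
  move=> x; rewrite /f patchE; have [xD|xD] := boolP (x \in D).
    by apply: step_fun_approx => //; exact/set_mem.
  rewrite step_fun_out ?subrr ?normr0// => Dx; move/negP : xD; apply.
  by rewrite inE.
have [s sP] := choice ex.
apply: (@measurable_fun_cvg _ _ _ setT s) => [k|x _]; first by have [] := sP k.
apply/cvgrPdist_lt => eps eps0.
have := near_infty_natSinv_lt (PosNum eps0); apply: filterS => k /=.
by apply: lt_trans; have [_ ->] := sP k.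
Qed.

Lemma cell_integral (K : finType) n (I : K -> nat -> R * option R)
    (C : K -> nat -> set F) (v : K -> R) (e : R) : 0 < e ->
  (forall c j, cell_valid (I c j)) -> (forall c j, good (C c j)) ->
  cell_approx n I C v g e ->
  `|\int[m]_(x in B) g (Z x) -
    \sum_c v c * pr m (D `&` [set x | in_cells n (I c) (C c) (Z x)])| <= e * pr m B.
Proof.
move=> e0 vI gC app.
have -> : \int[m]_(x in B) g (Z x) = \int[m]_x f x.
  rewrite -[RHS]Rintegral_mkcond; congr fine; exact: integral_null.
have [bs <-] := bounded_measurable_step n v vI gC.
have bf := bounded_measurable_cell_limit.
have bB : bounded_measurable (fun x => e * (\1_B x : R)).
  by apply: bounded_measurableM; [exact: bounded_measurable_cst|exact: bounded_measurable_indic].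
have bd x : `|f x - step_fun n I C v x| <= e * \1_B x.
  rewrite /f patchE indicE; have [xD|xD] := boolP (x \in D).
    have Dx := set_mem xD; rewrite (_ : x \in B) ?mulr1; last by rewrite inE; exact: DB.
    by apply: ltW; exact: step_fun_approx.
  rewrite step_fun_out; last by move=> Dx; move/negP : xD; apply; rewrite inE.
  by rewrite subrr normr0 mulr_ge0// ltW.
rewrite -RintB// -(Rint_indic m mB) -RintZ; last exact: bounded_measurable_indic.
rewrite ler_norml; apply/andP; split.
  rewrite -mulN1r -RintZ//; apply: le_Rint => //.
  - by apply: bounded_measurableM => //; exact: bounded_measurable_cst.
  - exact: bounded_measurableB.
  - by move=> x; have := bd x; rewrite ler_norml => /andP[? _]; lra.
apply: le_Rint => //; first exact: bounded_measurableB.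
by move=> x; have := bd x; rewrite ler_norml => /andP[].
Qed.

End CellIntegral.

(** * Weak convergence from convergence of cell probabilities *)

Section CellConvergence.
Context (R : realType) (F : pseudoMetricType R).
Local Notation SZ := ({ptws nat -> \bar R} * {ptws nat -> F})%type.
Context (d : measure_display) (X : measurableType d) (mu : probability X R)
  (d' : measure_display) (Y : measurableType d') (P' : probability Y R)
  (B D : nat -> set X) (Z : nat -> X -> SZ) (Z0 : Y -> SZ) (good : set F -> Prop).
Hypotheses (cF : compact [set: F])
  (part : forall e : R, 0 < e -> exists (m : nat) (C : nat -> set F), [/\
    forall i, good (C i), forall z, exists i : 'I_m.+1, C i z,
    forall i i' z, C i z -> C i' z -> i = i' &
    forall i z z', C i z -> C i z' -> ball z e z'])
  (mB : forall l, measurable (B l)) (B0 : forall l, 0 < pr mu (B l))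
  (mD : forall l, measurable (D l)) (DB : forall l, D l `<=` B l)
  (BD0 : forall l, mu (B l `\` D l) = 0%E)
  (Zpos : forall l x, D l x -> forall j, (0 < (Z l x).1 j)%E)
  (Z0pos : forall w j, (0 < (Z0 w).1 j)%E)
  (mcell : forall l n I C, (forall j, cell_valid (I j)) -> (forall j, good (C j)) ->
    measurable (D l `&` [set x | in_cells n I C (Z l x)]))
  (mcell0 : forall n I C, (forall j, cell_valid (I j)) -> (forall j, good (C j)) ->
    measurable [set w | in_cells n I C (Z0 w)])
  (cell_cvg : forall n I C, (forall j, cell_valid (I j)) -> (forall j, good (C j)) ->
    pr mu (D l `&` [set x | in_cells n I C (Z l x)]) / pr mu (B l) @[l --> \oo]
      --> pr P' [set w | in_cells n I C (Z0 w)]).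

Lemma cvg_finite_sum (K : Type) (r : seq K) (u : K -> nat -> R) (a : K -> R) :
  (forall c, u c @ \oo --> a c) ->
  (\sum_(c <- r) u c l) @[l --> \oo] --> \sum_(c <- r) a c.
Proof.
move=> ua; elim: r => [|c r IH].
  by rewrite big_nil; under eq_fun do rewrite big_nil; exact: cvg_cst.
by rewrite big_cons; under eq_fun do rewrite big_cons; exact: cvgD.
Qed.

(** The same cells and values [v] approximate [g] within [e / 4] along the processes and along the
    limit, so only finitely many cell probabilities have to converge. *)
Lemma wconv_cells : wconv mu B Z P' Z0.
Proof.
move=> g cg [M gM]; apply/cvgrPdist_lt => e e0; have e4 : 0 < e / 4 by rewrite divr_gt0.
have gapp (eps : R) : 0 < eps -> exists (K : finType) (n : nat)
    (I : K -> nat -> R * option R) (C : K -> nat -> set F) (v : K -> R),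
    [/\ forall c j, cell_valid (I c j), forall c j, good (C c j) &
        cell_approx n I C v g eps] by exact: cell_approximation.
have [K [n [I [C [v [vI gC app]]]]]] := gapp _ e4.
have D0 : measurable [set: Y] by [].
have TT : P' ([set: Y] `\` [set: Y]) = 0%E by rewrite setDv measure0.
have mcell0' n' I' C' : (forall j, cell_valid (I' j)) -> (forall j, good (C' j)) ->
    measurable ([set: Y] `&` [set w | in_cells n' I' C' (Z0 w)]).
  by move=> vI' gC'; rewrite setTI; exact: mcell0.
have := @cell_integral _ _ _ _ P' setT setT Z0 good D0 D0 (fun _ h => h) TT
  (fun w _ => Z0pos w) mcell0' g M gM gapp K n I C v _ e4 vI gC app.
rewrite pr_setT mulr1; under eq_bigr do rewrite setTI.
move=> lim0.
have cv : (\sum_c v c * (pr mu (D l `&` [set x | in_cells n (I c) (C c) (Z l x)]) / pr mu (B l)))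
    @[l --> \oo] --> \sum_c v c * pr P' [set w | in_cells n (I c) (C c) (Z0 w)].
  apply: cvg_finite_sum => c; apply: cvgM; first exact: cvg_cst.
  exact: cell_cvg.
move/cvgrPdist_lt : cv => /(_ _ e4); apply: filterS => l lt1.
have := @cell_integral _ _ _ _ mu (B l) (D l) (Z l) good (mB l) (mD l) (@DB l) (BD0 l)
  (@Zpos l) (@mcell l) g M gM gapp K n I C v _ e4 vI gC app.
have b0 := B0 l; rewrite -ler_pdivrMr// => lim1.
have lim2 : `|(pr mu (B l))^-1 * \int[mu]_(x in B l) g (Z l x) -
    \sum_c v c * (pr mu (D l `&` [set x | in_cells n (I c) (C c) (Z l x)]) / pr mu (B l))|
    <= e / 4.
  apply: le_trans lim1; rewrite -[X in _ / X]gtr0_norm// -normf_div mulrBl.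
  rewrite mulrC big_distrl /=; under eq_bigr do rewrite mulrA.
  exact: lexx.
rewrite -[fine (mu (B l))]/(pr mu (B l)).
rewrite -[Rintegral P' setT (g \o Z0)]/(\int[P']_w g (Z0 w)).
rewrite -[Rintegral mu (B l) (g \o Z l)]/(\int[mu]_(x in B l) g (Z l x)).
move: lt1 lim0 lim2; rewrite !ltr_norml !ler_norml => /andP[? ?] /andP[? ?] /andP[? ?].
by apply/andP; split; lra.
Qed.

End CellConvergence.

Lemma probability_of_measure (R : realType) (d : measure_display)
    (S : measurableType d) (m : {measure set S -> \bar R}) : m setT = 1%E ->
  exists Q : probability S R, forall C, Q C = m C.
Proof.
move=> mT; pose f : set S -> \bar R := m.
pose m1 := isMeasure.Build d S R f (measure0 m) (@measure_ge0 _ _ _ m)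
  (@measure_semi_sigma_additive _ _ _ m).
pose m2 : {measure set S -> \bar R} := HB.pack f m1.
pose m3 := Measure_isProbability.Build d S R m2 mT.
by pose m4 : probability S R := HB.pack f m1 m3; exists m4.
Qed.

(** * Construction of the limit process *)

Section LimitProcess.
Context (R : realType).

Lemma exponential_law_exists :
  exists e : probability (measurableTypeR R) R,
    forall t, 0 <= t -> e `]t, +oo[%classic = (expR (- t))%:E.
Proof.
pose e : probability (measurableTypeR R) R :=
  exponential_distribution_exponential_prob__canonical__probability_measure_Probability ltr01.
exists e => t t0.
have eE (V : set R) : e V = (\int[lebesgue_measure]_(x in V) (exponential_pdf 1 x)%:E)%E by [].
have neg : e `]-oo, 0[%classic = 0%E.
  rewrite eE; apply: integral0_eq => x /=; rewrite in_itv/= => x0.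
  by rewrite lt0_exponential_pdf.
have zero : e [set 0] = 0%E by rewrite eE integral_set1.
have mI (i : interval R) : measurable [set` i] by [].
have le0t : e `]-oo, t]%classic = (1 - (expR (- t))%:E)%E.
  have split_neg : `]-oo, t]%classic = `]-oo, 0[%classic `|` `[0, t]%classic :> set R.
    apply/seteqP; split => x /=; rewrite !in_itv/=.
      by move=> xt; have [x0|x0] := ltP x 0; [left|right; rewrite xt].
    by move=> [x0|/andP[]//]; apply/ltW/(lt_le_trans x0).
  rewrite split_neg measureU//; last first.
    by apply/seteqP; split => x //= []; rewrite !in_itv/= => x0 /andP[/le_lt_trans/(_ x0)]; rewrite ltxx.
  transitivity (0 + e `[0%R, t]%classic)%E; first by congr (_ + _)%E.
  rewrite add0e; move: t0; rewrite le_eqVlt => /predU1P[<-|t0].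
    by rewrite set_itv1 oppr0 expR0 zero subee.
  by rewrite [LHS]exponential_prob_itv0c// mulN1r.
rewrite -setCitvl probability_setC//= le0t.
transitivity ((1 - (1 - expR (- t)))%:E : \bar R); first by [].
by congr EFin; ring.
Qed.

Context (F : topologicalType) (dO : measure_display) (Om : measurableType dO)
  (P : probability Om R) (psi : Om -> F).
Hypothesis mpsi : borel_measurable_on setT psi.

Lemma limit_process_exists :
  exists (d' : measure_display) (Om' : measurableType d') (P' : probability Om' R)
         (E : nat -> Om' -> \bar R) (Y : nat -> Om' -> F),
    (forall i, measurable_fun setT (E i)) /\ (forall i w, (0 < E i w)%E) /\
    (forall i, borel_measurable_on setT (Y i)) /\
    (forall i, std_exp P' (E i)) /\
    (forall i B, borel_sets B -> P' (Y i @^-1` B) = P (psi @^-1` B)) /\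
    indep_family P' E Y.
Proof.
have [e eP] := exponential_law_exists.
(* An iid sequence is drawn from the product of [P] and the exponential law: both the independence
   of the two processes and the independence within each are then built in. *)
pose Q0 : {measure set (Om * measurableTypeR R) -> \bar R} := (P \x e)%E.
have Q0T : Q0 setT = 1%E.
  transitivity ((P \x e)%E (setT `*` setT)); first by rewrite setXTT.
  transitivity (P setT * e setT)%E; last by rewrite !probability_setT mule1.
  by apply: product_measure1E; exact: measurableT.
have [Q QQ0] := probability_of_measure Q0T.
have QE C D : measurable C -> measurable D -> Q (C `*` D) = (P C * e D)%E.
  by move=> mC mD; rewrite QQ0 -[LHS]/((P \x e)%E (C `*` D)) product_measure1E.
have [d' [Om' [P' [xi [mxi xiP]]]]] := iid_sequence_exists Q.
have xi1 i B : measurable B -> P' (xi i @^-1` B) = Q B.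
  move=> mB; have := xiP i.+1 (fun j => if j == i then B else setT).
  rewrite big_ord_recr/= eqxx big1 ?mul1e; last first.
    by move=> j _; rewrite ltn_eqF ?ltn_ord// probability_setT.
  move=> <-; last by move=> j; case: ifP.
  congr (P' _); apply/seteqP; split => w /=.
    by move=> Bw j _ /=; case: eqP => [->|].
  by move=> /(_ i (ltnSn i)) /=; rewrite eqxx.
(* Nonpositive values, of probability zero, are replaced by 1, so that the times are positive
   everywhere and every path falls into a cell. *)
pose g (s : R) : \bar R := (if 0 < s then s else 1)%:E.
have mg : measurable_fun (setT : set (measurableTypeR R)) g.
  apply/measurable_EFinP; apply: measurable_fun_ifT => //.
  exact: measurable_fun_ltr.
have mgB B : measurable B -> measurable (g @^-1` B : set (measurableTypeR R)).
  by move=> mB; rewrite -[X in measurable X]setTI; exact: mg.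
have mps C : borel_sets C -> measurable (psi @^-1` C).
  by move=> bC; rewrite -[X in measurable X]setTI; exact: mpsi.
pose E i w := g (xi i w).2; pose Y i w := psi (xi i w).1.
have EE i B : E i @^-1` B = xi i @^-1` (setT `*` g @^-1` B).
  by apply/seteqP; split => w //= [].
have YE i C : Y i @^-1` C = xi i @^-1` (psi @^-1` C `*` setT).
  by apply/seteqP; split => w //= [].
have PE i B : measurable B -> P' (E i @^-1` B) = e (g @^-1` B).
  move=> mB; rewrite EE xi1; last by apply: measurableX => //; exact: mgB.
  by rewrite QE//; [rewrite probability_setT mul1e|exact: mgB].
have PY i C : borel_sets C -> P' (Y i @^-1` C) = P (psi @^-1` C).
  move=> bC; rewrite YE xi1; last by apply: measurableX => //; exact: mps.
  by rewrite QE//; [rewrite probability_setT mule1|exact: mps].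
exists d', Om', P', E, Y; split=> [i|]; last split=> [i w|]; last split=> [i C bC|];
  last split=> [i t t0|]; last split=> [//|n Bs Cs mBs bCs].
- by apply: measurableT_comp => //; apply: measurableT_comp.
- by rewrite /E /g lte_fin; case: ifP.
- rewrite setTI YE -[X in measurable X]setTI; apply: mxi => //.
  by apply: measurableX => //; exact: mps.
- rewrite PE; last exact: emeasurable_itv.
  have e0 : e (~` `]0, +oo[%classic) = 0%E.
    by rewrite probability_setC// eP// oppr0 expR0 subee.
  rewrite -(eP t t0) [in RHS](_ : `]t, +oo[%classic =
      g @^-1` `]t%:E, +oo[%classic `&` `]0, +oo[%classic); last first.
    apply/seteqP; split => x /=; rewrite /g !in_itv/= !andbT lte_fin.
      by move=> tx; rewrite (le_lt_trans t0 tx).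
    by move=> [+ x0]; rewrite x0.
  have mgt : measurable (g @^-1` `]t%:E, +oo[%classic : set (measurableTypeR R)).
    by apply: mgB; exact: emeasurable_itv.
  have mN : measurable (~` `]0, +oo[%classic : set (measurableTypeR R)).
    exact: measurableC.
  set H := g @^-1` _ in mgt *; set J := [set` _] in e0 mN *.
  have mJ : measurable J by rewrite -(setCK J); exact: measurableC.
  transitivity (e (H `\` J) + e (H `&` J))%E; first exact: measureDI.
  rewrite [X in (X + _)%E](_ : _ = 0%E) ?add0e//.
  apply/eqP; rewrite eq_le measure_ge0 andbT -e0 le_measure ?inE//.
  exact: measurableD.
- transitivity (P' (\bigcap_(i in [set i | (i < n)%N])
      (xi i @^-1` (psi @^-1` Cs i `*` g @^-1` Bs i)))).
    congr (P' _); apply/seteqP; split => w h i /= ni; have /= [] := h i ni; by [].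
  rewrite xiP; last by move=> i; apply: measurableX; [exact: mps|exact: mgB].
  apply: eq_bigr => i _; rewrite QE; [|exact: mps|exact: mgB].
  by rewrite PE// PY// muleC.
Qed.

End LimitProcess.

(** * Cell probabilities of the limit process *)

Section LimitCells.
Context (R : realType) (F : pseudoMetricType R)
  (d' : measure_display) (Om' : measurableType d') (P' : probability Om' R)
  (E : nat -> Om' -> \bar R) (Y : nat -> Om' -> F).
Hypotheses (mE : forall i, measurable_fun setT (E i))
  (mY : forall i, borel_measurable_on setT (Y i))
  (expE : forall i, std_exp P' (E i)) (indEY : indep_family P' E Y).

Local Notation SZ := ({ptws nat -> \bar R} * {ptws nat -> F})%type.

Lemma in_cellE (I : R * option R) : [set y | in_cell I y] =
  `]I.1%:E, +oo[%classic `\` (if I.2 is Some b then `]b%:E, +oo[%classic else set0).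
Proof.
apply/seteqP; split => y /=; rewrite /in_cell in_itv/= andbT.
- move=> [ay yb]; split => //; case: I.2 yb => [b /(_ b erefl)|_ []].
  by rewrite leNgt => /negP yb /=; rewrite in_itv/= andbT.
- move=> [ay yb]; split => // b Ib; move: yb; rewrite Ib /= in_itv/= andbT.
  by rewrite leNgt => /negP.
Qed.

Lemma measurable_in_cell (I : R * option R) : measurable [set y | in_cell I y].
Proof.
rewrite in_cellE; apply: measurableD; first exact: emeasurable_itv.
by case: I.2 => [b|]; [exact: emeasurable_itv|exact: measurable0].
Qed.

Let mEB i B : measurable B -> measurable (E i @^-1` B).
Proof. by move=> mB; rewrite -[X in measurable X]setTI; exact: mE. Qed.

Let mYC i C : borel_sets C -> measurable (Y i @^-1` C).
Proof. by move=> bC; rewrite -[X in measurable X]setTI; exact: mY. Qed.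

Lemma pr_in_cell i (I : R * option R) : cell_valid I ->
  pr P' (E i @^-1` [set y | in_cell I y]) = cell_mass I.
Proof.
move=> [I1 I2]; rewrite in_cellE.
have mt t : measurable (E i @^-1` `]t%:E, +oo[%classic).
  by apply: mEB; exact: emeasurable_itv.
have prt t : 0 <= t -> pr P' (E i @^-1` `]t%:E, +oo[%classic) = expR (- t).
  by move=> t0; rewrite /pr expE.
rewrite /cell_mass; case: I.2 I2 => [b /(_ b erefl) Ib|_]; last first.
  by rewrite setD0 prt// subr0.
have := prDI P' (mt I.1) (mt b); rewrite prt// (_ : _ `&` _ = E i @^-1` `]b%:E, +oo[%classic).
  by rewrite prt ?(le_trans I1)// => ->; ring.
apply/setIidPr => w /=; rewrite !in_itv/= !andbT; apply: le_lt_trans.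
by rewrite lee_fin.
Qed.

Let limit_cellsE n (I : nat -> R * option R) (C : nat -> set F) :
  [set w | in_cells n I C ((fun j => E j w, fun j => Y j w) : SZ)] =
  \bigcap_(i in [set i | (i < n)%N])
    (E i @^-1` [set y | in_cell (I i) y] `&` Y i @^-1` C i).
Proof. by apply/seteqP; split => w h j jn; have [] := h j jn. Qed.

Lemma measurable_limit_cells n (I : nat -> R * option R) (C : nat -> set F) :
  (forall j, borel_sets (C j)) ->
  measurable [set w | in_cells n I C ((fun j => E j w, fun j => Y j w) : SZ)].
Proof.
move=> bC; rewrite limit_cellsE; apply: bigcap_measurableType => j _.
by apply: measurableI; [apply: mEB; exact: measurable_in_cell|exact: mYC].
Qed.

Lemma pr_limit_cells n (I : nat -> R * option R) (C : nat -> set F) :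
  (forall j, cell_valid (I j)) -> (forall j, borel_sets (C j)) ->
  pr P' [set w | in_cells n I C ((fun j => E j w, fun j => Y j w) : SZ)] =
  \prod_(j < n) (cell_mass (I j) * pr P' (Y j @^-1` C j)).
Proof.
move=> vI bC; rewrite limit_cellsE /pr indEY//; last by move=> j; exact: measurable_in_cell.
transitivity (fine (\prod_(j < n) (cell_mass (I j) * pr P' (Y j @^-1` C j)))%:E) => //.
congr fine; rewrite -prodEFin; apply: eq_bigr => j _.
rewrite EFinM -(pr_in_cell j (vI j)) !EFin_pr//; first exact: mYC.
by apply: mEB; exact: measurable_in_cell.
Qed.

End LimitCells.

(** * Cell probabilities of the return process, under [mu_{A_l}] and under [mu] *)

Section CellAsymptotics.
Context (R : realType) (d : measure_display) (X : measurableType d)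
  (mu : probability X R) (T : X -> X) (F : pseudoMetricType R)
  (dO : measure_display) (Om : measurableType dO) (P : probability Om R)
  (psi : Om -> F) (A : nat -> set X) (psiA : nat -> X -> F).
Hypotheses (mpT : measure_preserving mu T) (ergT : ergodic mu T)
  (mpsi : borel_measurable_on setT psi)
  (mA : forall l, measurable (A l)) (A0 : forall l, (0 < mu (A l))%E)
  (Arare : (fun l => mu (A l)) @ \oo --> 0%E)
  (mpsiA : forall l, borel_measurable_on (A l) (psiA l))
  (psi_cvg : wconv mu A psiA P psi).
Hypothesis hypA : forall s : R, 0 <= s ->
    exists (K : set (set X -> \bar R)) (nu : nat -> set X -> \bar R)
           (tau : nat -> X -> nat),
      compactP mu K /\ (forall l, inP mu (nu l)) /\
        (fun l => dP (nu l) (condm mu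
           (A l `&` [set x | (s%:E < mu (A l) * phi (R:=R) T (A l) x)%E]))) @ \oo --> 0 /\
        (forall l, measurable_nat (tau l)) /\
        (fun l => nu l [set x | ((tau l x)%:R%:E < phi (R:=R) T (A l) x)%E])
          @ \oo --> 1%E /\
        (forall l, K (pushT T (tau l) (nu l))).
Variable G : set (set F).
Hypotheses (GI : setI_closed G) (GB : <<s G >> = @borel_sets F) (GT : G setT)
  (Gnull : forall B, G B -> P (psi @^-1` (closure B `\` interior B)) = 0%E).
Hypothesis hypB : forall B, G B -> (0 < P (psi @^-1` B))%E ->
        exists (K : set (set X -> \bar R)) (nu : nat -> set X -> \bar R)
               (tau : nat -> X -> nat),
          compactP mu K /\ (forall l, inP mu (nu l)) /\
            (fun l => dP (nu l)
               (condm mu (A l `&` (psiA l @^-1` B)))) @ \oo --> 0 /\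
            (forall l, measurable_nat (tau l)) /\
            (forall eps : R, 0 < eps ->
               (fun l => nu l [set x | (eps%:E < mu (A l) * (tau l x)%:R%:E)%E])
                 @ \oo --> 0%E) /\
            (fun l => nu l [set x | ((tau l x)%:R%:E < phi (R:=R) T (A l) x)%E])
              @ \oo --> 1%E /\
            (forall l, K (pushT T (tau l) (nu l))).

Local Notation pr_of := pr.
Local Notation pr := (pr mu).
Local Notation law C := (pr_of P (psi @^-1` C)).
Local Notation nohit l := (nohit T (A l)).
Local Notation after_hit l := (after_hit T (A l)).
Local Notation thr t l := (Num.truncn (t / pr (A l))).
Local Notation good C := (borel_sets C /\ null_boundary P psi C).

Let pA0 l : 0 < pr (A l) := prA_gt0 (mA l) (A0 l).
Let mnh := measurable_nohits mpT mA.
Let mQ := measurable_after_hits mpT mA.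
Let mpC l C : borel_sets C -> measurable (A l `&` psiA l @^-1` C) := @mpsiA l C.
Let bG C : G C -> borel_sets C.
Proof. by move=> GC; rewrite -GB; exact: sub_gen_smallest. Qed.

Lemma observable_hit (C : set F) : G C -> (0 < P (psi @^-1` C))%E ->
  forall (n : nat -> nat) (V : nat -> set X), (forall l, measurable (V l)) ->
  (pr (A l `&` psiA l @^-1` C `&` (nohit l (n l) `&` after_hit l (V l)))
      / pr (A l `&` psiA l @^-1` C)
    - pr (nohit l (n l) `&` after_hit l (V l))) @[l --> \oo] --> 0.
Proof.
move=> GC PC n V mV.
have [K [nu [tau [cK [nuP [dB [mtau [tau0 [nutau Kpush]]]]]]]]] := hypB GC PC.
have mB l : measurable (A l `&` psiA l @^-1` C) by apply: mpC; exact: bG.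
exact: (cond_nohit_after_hit mpT ergT mA A0 Arare cK nuP mB dB mtau nutau Kpush tau0 n mV).
Qed.

Lemma return_hit (n : nat -> nat) (V : nat -> set X) : (forall l, measurable (V l)) ->
  (pr (A l `&` (nohit l (n l) `&` after_hit l (V l))) / pr (A l)
    - pr (nohit l (n l) `&` after_hit l (V l))) @[l --> \oo] --> 0.
Proof.
move=> mV; have PT : (0 < P (psi @^-1` setT))%E by rewrite preimage_setT probability_setT.
have := observable_hit GT PT n mV.
by under eq_cvg do rewrite preimage_setT setIT.
Qed.

Lemma return_indep (t : R) (V : nat -> set X) : 0 <= t ->
  (forall l, measurable (V l)) ->
  (pr (A l `&` nohit l (thr t l) `&` after_hit l (V l)) / pr (A l `&` nohit l (thr t l))
    - pr (after_hit l (V l))) @[l --> \oo] --> 0.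
Proof.
move=> t0 mV.
have [K [nu [tau [cK [nuP [dB [mtau [nutau Kpush]]]]]]]] := hypA t0.
have mB l : measurable (A l `&` nohit l (thr t l)) by exact: measurableI.
have BE l : A l `&` [set x | (t%:E < mu (A l) * phi (R:=R) T (A l) x)%E] =
    A l `&` nohit l (thr t l).
  by congr (_ `&` _); apply/seteqP; split => x /=; rewrite lt_mu_phi.
have dB' : dP (nu l) (condm mu (A l `&` nohit l (thr t l))) @[l --> \oo] --> 0.
  by under eq_cvg do rewrite -BE.
exact: (cond_after_hit mpT ergT mA Arare cK nuP mB dB' mtau nutau Kpush mV).
Qed.

(** (B) concerns sets of [G] only, while the cells are general continuity sets. With the event [E]
    fixed, both terms are measures in [C], so [null_boundary_extension] applies with [c l] as the
    mass factor. *)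
Lemma observable_asymptotics (C : set F) (t : R) (V : nat -> set X) : good C ->
  0 <= t -> (forall l, measurable (V l)) -> (forall l, V l `<=` A l) ->
  (pr (A l `&` psiA l @^-1` C `&` (nohit l (thr t l) `&` after_hit l (V l))) / pr (A l) -
    law C * (expR (- t) * (pr (V l) / pr (A l)))) @[l --> \oo] --> 0.
Proof.
move=> [bC nC] t0 mV VA.
pose E l := nohit l (thr t l) `&` after_hit l (V l).
have mE l : measurable (A l `&` E l).
  by apply: measurableI => //; apply: measurableI; [exact: mnh|exact: mQ].
pose c l : R := expR (- t) * (pr (V l) / pr (A l)).
have c01 l : 0 <= c l <= 1.
  apply/andP; split; first by rewrite mulr_ge0 ?expR_ge0// divr_ge0 ?pr_ge0.
  apply: mulr_ile1; rewrite ?expR_ge0 ?divr_ge0 ?pr_ge0//.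
    by rewrite -expR0 ler_expR oppr_le0.
  by rewrite ler_pdivrMr// mul1r; exact: le_pr (VA l).
have EC l C' : A l `&` psiA l @^-1` C' `&` E l = A l `&` E l `&` psiA l @^-1` C'.
  exact: setIAC.
have Gcvg C' : G C' ->
    (pr (A l `&` E l `&` psiA l @^-1` C') / pr (A l) - law C' * c l) @[l --> \oo] --> 0.
  move=> GC'; under eq_cvg do rewrite -EC.
  have mB l : measurable (A l `&` psiA l @^-1` C') by apply: mpC; exact: bG.
  have BA l : A l `&` psiA l @^-1` C' `<=` A l by move=> x [].
  have Bp := portmanteau mpsi mA A0 mpsiA psi_cvg (bG GC') (Gnull GC').
  apply: (return_asymptotics mpT ergT mA A0 Arare return_hit return_indep t0 mV VA mB BA Bp).
  have [p0|p0] := eqVneq (law C') 0; [by left|right => n V' mV'].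
  apply: observable_hit => //; rewrite lt0e measure_ge0 andbT.
  by apply: contra_neq p0; rewrite /pr_of => ->.
have := @null_boundary_extension _ _ _ _ _ _ _ _ _ _ _ mpsi mA A0 mpsiA psi_cvg
  G (fun l => A l `&` E l) c GI GB GT Gnull mE (fun l x h => h.1) c01 Gcvg C bC nC.
by under eq_cvg do rewrite -EC.
Qed.

Definition cell_event l (I : R * option R) : set X :=
  [set x | in_cell I (mu (A l) * phi T (A l) x)%E].

Lemma cell_eventE l (I : R * option R) : cell_valid I -> cell_event l I =
  nohit l (thr I.1 l) `\` (if I.2 is Some b then nohit l (thr b l) else set0).
Proof.
move=> [I1 I2]; apply/seteqP; split => x /=; rewrite /cell_event /in_cell /= lt_mu_phi//.
- move=> [ax xb]; split => //; case: I.2 xb I2 => [b /(_ b erefl) xb /(_ b erefl) Ib|_ _ []].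
  by rewrite -lt_mu_phi ?(le_trans I1)// ltNge xb.
- move=> [ax xb]; split => // b Ib; have b0 : 0 <= b by rewrite (le_trans I1)// I2.
  move: xb; rewrite Ib -lt_mu_phi// => /negP.
  by rewrite -leNgt.
Qed.

Lemma measurable_cell_event l (I : R * option R) : cell_valid I ->
  measurable (cell_event l I).
Proof.
move=> vI; rewrite cell_eventE//; apply: measurableD; first exact: mnh.
by case: I.2 => [b|//]; exact: mnh.
Qed.

Lemma pr_cell_event l (I : R * option R) (B D : set X) : cell_valid I ->
  measurable B -> measurable D ->
  pr (B `&` (cell_event l I `&` D)) = pr (B `&` (nohit l (thr I.1 l) `&` D)) -
    (if I.2 is Some b then pr (B `&` (nohit l (thr b l) `&` D)) else 0).
Proof.
move=> vI mB mD; rewrite cell_eventE//; have [I1 I2] := vI.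
case: I.2 I2 => [b /(_ b erefl) Ib|_]; last by rewrite setD0 subr0.
have mb t : measurable (nohit l (thr t l)) by exact: mnh.
have ab : nohit l (thr b l) `<=` nohit l (thr I.1 l).
  by apply: nohit_le; apply: le_truncn; rewrite ler_pM2r ?invr_gt0.
have mBD : measurable (B `&` (nohit l (thr I.1 l) `&` D)).
  by apply: measurableI => //; exact: measurableI.
have := prDI mu mBD (mb b).
rewrite (_ : _ `&` nohit l (thr b l) = B `&` (nohit l (thr b l) `&` D)); last first.
  by apply/seteqP; split => x /= [] => [[Bx [ax Dx] bx]|Bx [bx Dx]]; do ?split => //; exact: ab.
rewrite (_ : B `&` (nohit l (thr I.1 l) `&` D) `\` nohit l (thr b l) =
  B `&` ((nohit l (thr I.1 l) `\` nohit l (thr b l)) `&` D)); last first.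
  by apply/seteqP; split => x /= [] => [[Bx [ax Dx] bx]|Bx [[ax bx] Dx]]; do ?split.
by move=> ->; ring.
Qed.

Lemma cell_difference (f : R -> nat -> R) (I : R * option R) (c : nat -> R) :
  cell_valid I ->
  (forall t, 0 <= t -> (f t l - expR (- t) * c l) @[l --> \oo] --> 0) ->
  ((f I.1 l - (if I.2 is Some b then f b l else 0)) - cell_mass I * c l)
    @[l --> \oo] --> 0.
Proof.
move=> [I1 I2] fc; rewrite /cell_mass; case: I.2 I2 => [b /(_ b erefl) Ib|_].
  apply: (cvg0_ext _ (cvg0B (fc _ I1) (fc b (le_trans I1 Ib)))) => l; ring.
by apply: (cvg0_ext _ (fc _ I1)) => l; ring.
Qed.

Lemma return_cell (C : set F) (I : R * option R) (V : nat -> set X) :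
  good C -> cell_valid I -> (forall l, measurable (V l)) -> (forall l, V l `<=` A l) ->
  (pr (A l `&` psiA l @^-1` C `&` (cell_event l I `&` after_hit l (V l))) / pr (A l) -
    cell_mass I * (law C * (pr (V l) / pr (A l)))) @[l --> \oo] --> 0.
Proof.
move=> gC vI mV VA; have [bC _] := gC.
pose f t l := pr (A l `&` psiA l @^-1` C `&` (nohit l (thr t l) `&` after_hit l (V l))) / pr (A l).
have fc t : 0 <= t ->
    (f t l - expR (- t) * (law C * (pr (V l) / pr (A l)))) @[l --> \oo] --> 0.
  move=> t0; apply: (cvg0_ext _ (observable_asymptotics gC t0 mV VA)) => l.
  by rewrite /f mulrCA.
apply: (cvg0_ext _ (cell_difference vI fc)) => l; rewrite /f.
rewrite pr_cell_event//; [|exact: mpC|exact: mQ].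
by rewrite mulrBl; case: I.2 => [b//|]; rewrite mul0r.
Qed.

Lemma hit_cell (I : R * option R) (V : nat -> set X) :
  cell_valid I -> (forall l, measurable (V l)) -> (forall l, V l `<=` A l) ->
  (pr (cell_event l I `&` after_hit l (V l)) -
    cell_mass I * (pr (V l) / pr (A l))) @[l --> \oo] --> 0.
Proof.
move=> vI mV VA.
pose f t l := pr (nohit l (thr t l) `&` after_hit l (V l)).
have fc t : 0 <= t -> (f t l - expR (- t) * (pr (V l) / pr (A l))) @[l --> \oo] --> 0.
  by move=> t0; exact: (hit_asymptotics mpT ergT mA A0 Arare return_hit return_indep t0 mV VA).
apply: (cvg0_ext _ (cell_difference vI fc)) => l; rewrite /f.
have := @pr_cell_event l I setT (after_hit l (V l)) vI measurableT (mQ l (mV l)).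
by rewrite !setTI => ->; case: I.2 => [b|//]; rewrite setTI.
Qed.

(** The cylinder seen from [A l], nested through [after_hit] so that the condition on the later
    returns is again a subset of [A l], ready to play the role of [V l]. *)
Fixpoint cell_set n (I : nat -> R * option R) (C : nat -> set F) l : set X :=
  if n is n'.+1 then
    A l `&` psiA l @^-1` C 0 `&`
      (cell_event l (I 0) `&` after_hit l (cell_set n' (I \o S) (C \o S) l))
  else A l.

Lemma cell_set_sub n I C l : cell_set n I C l `<=` A l.
Proof. by case: n => [//|n] x [[]]. Qed.

Lemma measurable_cell_set n I C l : (forall j, cell_valid (I j)) ->
  (forall j, borel_sets (C j)) -> measurable (cell_set n I C l).
Proof.
elim: n I C => [//|n IH] I C vI bC /=.
apply: measurableI; first exact: mpC.
apply: measurableI; first exact: measurable_cell_event.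
by apply: mQ; apply: IH => j /=.
Qed.

(** [return_cell] splits off the first coordinate and leaves the relative mass of the cylinder of
    the tail, which is covered by induction because [V l] is allowed to depend on [l]. *)
Lemma cell_set_cvg n I C : (forall j, cell_valid (I j)) -> (forall j, good (C j)) ->
  pr (cell_set n I C l) / pr (A l) @[l --> \oo]
    --> \prod_(j < n) (cell_mass (I j) * law (C j)).
Proof.
elim: n I C => [|n IH] I C vI gC.
  rewrite big_ord0; under eq_cvg do rewrite /= divff ?gt_eqF//.
  exact: cvg_cst.
have vI' j : cell_valid ((I \o S) j) by exact: vI.
have gC' j : good ((C \o S) j) by exact: gC.
have mV l : measurable (cell_set n (I \o S) (C \o S) l).
  by apply: measurable_cell_set => // j; have [] := gC' j.
have h := return_cell (gC 0%N) (vI 0%N) mV (@cell_set_sub n _ _).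
apply/cvg_cvg0; apply: (cvg0_trans h); apply/cvg_cvg0.
rewrite big_ord_recl /= -mulrA; apply: cvgM; first exact: cvg_cst.
by apply: cvgM; [exact: cvg_cst|exact: (IH _ _ vI' gC')].
Qed.

Local Notation SZ := ({ptws nat -> \bar R} * {ptws nat -> F})%type.
Local Notation Zt l x := ((muPhi mu T (A l) x, Psit T (A l) (psiA l) x) : SZ).
Local Notation Z l x := ((muPhi mu T (A l) x, Psi T (A l) (psiA l) x) : SZ).
Local Notation TA l := (TA T (A l)).
Local Notation recurrent_set l := (recurrent_set T (A l)).

Lemma cell_setP n I C l x : A l x -> recurrent_set l x ->
  cell_set n I C l x <-> in_cells n I C (Zt l x).
Proof.
elim: n I C x => [//|n IH] I C x Ax rx /=.
have rTx := recurrent_set_TA rx; have ATx := TA_mem rx.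
have {}IH := IH (I \o S) (C \o S) _ ATx rTx.
split=> [[[_ Cx] [Ix [_ /IH h]]] [_|j jn]|h]; first by [].
- have [h1 h2] := h j jn; split.
    by move: h1; rewrite /= /muPhi -iterSr.
  by move: h2; rewrite /= /Psit -iterSr.
- have [h1 h2] := h 0%N isT; split => //; split => //; split.
    exact: recurrent_set_returns.
  apply/IH => j jn; have [k1 k2] := h j.+1 jn; split.
    by move: k1; rewrite /= /muPhi -iterSr.
  by move: k2; rewrite /= /Psit -iterSr.
Qed.

(* The process seen from [x] is one waiting time followed by the process seen
   from [TA x], whose last waiting time is left free: [(0, None)] is the cell
   [0 < t <= +oo], of mass [1]. *)
Lemma in_cells_TA n I C l x : recurrent_set l x ->
  in_cells n.+1 I C (Z l x) <->
  cell_event l (I 0) x /\ after_hit l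
    (cell_set n.+1 (fun j => if (j < n)%N then I j.+1 else (0, None)) C l) x.
Proof.
move=> rx; have rTx := recurrent_set_TA rx; have ATx := TA_mem rx.
have cP := cell_setP n.+1 (fun j => if (j < n)%N then I j.+1 else (0, None)) C ATx rTx.
split=> [h|[Ix [_ /cP h]] j jn].
- split; first by have [] := h 0%N isT.
  split; first exact: recurrent_set_returns.
  apply/cP => j jn; have [_ Cj] := h j jn; split; last first.
    by move: Cj; rewrite /= /Psi /Psit -iterSr.
  rewrite /= /muPhi -iterSr; case: ifP => jn'; first by have [] := h j.+1 jn'.
  by split => //; exact: mu_phi_gt0.
- have [_ Cj] := h j jn; split; last first.
    by move: Cj; rewrite /= /Psi /Psit -iterSr.
  case: j jn {Cj} => [//|j] jn; have [+ _] := h j (ltnW jn).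
  by rewrite /= -[(j < n)%N]/(j.+1 < n.+1)%N jn /muPhi -iterSr.
Qed.

Lemma return_cells_cvg n I C : (forall j, cell_valid (I j)) -> (forall j, good (C j)) ->
  pr (A l `&` recurrent_set l `&` [set x | in_cells n I C (Zt l x)]) / pr (A l)
    @[l --> \oo] --> \prod_(j < n) (cell_mass (I j) * law (C j)).
Proof.
move=> vI gC; have := @cell_set_cvg n _ _ vI gC; apply: cvg_trans; apply: near_eq_cvg.
near=> l; congr (_ / _).
rewrite -(pr_recurrentI mpT (mA l) (A0 l) ergT); last first.
  by apply: measurable_cell_set => // j; have [] := gC j.
congr pr; apply/seteqP; split => x.
- move=> [rx Vx]; have Ax := cell_set_sub Vx; split => //; exact/cell_setP.
- by move=> [[Ax rx] /(cell_setP _ _ _ Ax rx)].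
Unshelve. all: by end_near.
Qed.

Lemma hit_cells_cvg n I C : (forall j, cell_valid (I j)) -> (forall j, good (C j)) ->
  pr (recurrent_set l `&` [set x | in_cells n I C (Z l x)])
    @[l --> \oo] --> \prod_(j < n) (cell_mass (I j) * law (C j)).
Proof.
move=> vI gC; case: n => [|n].
  rewrite big_ord0; apply: cvg_near_cst; near=> l.
  rewrite -(pr_recurrent_set mpT (mA l) (A0 l) ergT); congr pr.
  by apply/seteqP; split => x // [].
pose I' j := if (j < n)%N then I j.+1 else (0, None).
have vI' j : cell_valid (I' j) by rewrite /I'; case: ifP.
have mV l : measurable (cell_set n.+1 I' C l).
  by apply: measurable_cell_set => // j; have [] := gC j.
have h := hit_cell (vI 0%N) mV (@cell_set_sub n.+1 I' C).
have E l : pr (recurrent_set l `&` [set x | in_cells n.+1 I C (Z l x)]) =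
    pr (cell_event l (I 0%N) `&` after_hit l (cell_set n.+1 I' C l)).
  rewrite -[RHS](pr_recurrentI mpT (mA l) (A0 l) ergT); last first.
    by apply: measurableI; [exact: measurable_cell_event|exact: mQ].
  by congr pr; apply/seteqP; split => x [rx /(in_cells_TA _ _ _ rx)].
under eq_cvg do rewrite E.
apply/cvg_cvg0; apply: (cvg0_trans h); apply/cvg_cvg0.
(* The first time is split off and the others are shifted by one against unchanged observables; the
   free last slot [(0, None)] has mass 1. *)
have -> : \prod_(j < n.+1) (cell_mass (I j) * law (C j)) =
    cell_mass (I 0%N) * \prod_(j < n.+1) (cell_mass (I' j) * law (C j)).
  rewrite !big_split /= mulrA; congr (_ * _).
  rewrite big_ord_recl big_ord_recr /=; congr (_ * _).
  have -> : cell_mass (I' n) = 1 by rewrite /I' ltnn /cell_mass /= !oppr0 expR0 addr0.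
  by rewrite mulr1; apply: eq_bigr => j _; rewrite /I' ltn_ord.
apply: cvgM; first exact: cvg_cst.
exact: cell_set_cvg.
Unshelve. all: by end_near.
Qed.

Lemma measurable_return_cells n I C l : (forall j, cell_valid (I j)) ->
  (forall j, borel_sets (C j)) ->
  measurable (A l `&` recurrent_set l `&` [set x | in_cells n I C (Zt l x)]).
Proof.
move=> vI bC; have mD := measurable_recurrent_set mpT (mA l).
rewrite (_ : _ `&` _ = recurrent_set l `&` cell_set n I C l).
  by apply: measurableI => //; exact: measurable_cell_set.
apply/seteqP; split => x.
- by move=> [[Ax rx] /(cell_setP _ _ _ Ax rx)].
- move=> [rx Vx]; have Ax := cell_set_sub Vx; split => //; exact/cell_setP.
Qed.

Lemma measurable_hit_cells n I C l : (forall j, cell_valid (I j)) ->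
  (forall j, borel_sets (C j)) ->
  measurable (recurrent_set l `&` [set x | in_cells n I C (Z l x)]).
Proof.
move=> vI bC; have mD := measurable_recurrent_set mpT (mA l).
case: n => [|n].
  by rewrite (_ : _ `&` _ = recurrent_set l)//; apply/seteqP; split => x // [].
pose I' j := if (j < n)%N then I j.+1 else (0, None).
have vI' j : cell_valid (I' j) by rewrite /I'; case: ifP.
rewrite (_ : _ `&` _ = recurrent_set l `&`
    (cell_event l (I 0%N) `&` after_hit l (cell_set n.+1 I' C l))).
  apply: measurableI => //; apply: measurableI; first exact: measurable_cell_event.
  by apply: mQ; exact: measurable_cell_set.
by apply/seteqP; split => x [rx /(in_cells_TA _ _ _ rx)].
Qed.

End CellAsymptotics.

(** * Both weak convergences, from the cell asymptotics *)

Theorem mainTheorem9 (R : realType)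
  (d : measure_display) (X : measurableType d) (mu : probability X R)
  (T : X -> X)
  (F : pseudoMetricType R)
  (dO : measure_display) (Om : measurableType dO) (P : probability Om R)
  (psi : Om -> F)
  (A : nat -> set X) (psiA : nat -> X -> F) :
  (* ergodic probability preserving system *)
  measure_preserving mu T -> ergodic mu T ->
  (* (F, d_F) compact metric space *)
  hausdorff_space F -> compact [set: F] ->
  (* psi random element of F *)
  borel_measurable_on setT psi ->
  (* (A_l) asymptotically rare *)
  (forall l, measurable (A l)) -> (forall l, (0 < mu (A l))%E) ->
  (fun l => mu (A l)) @ \oo --> 0%E ->
  (* local observables psi_{A_l} : A_l -> F, converging in law *)
  (forall l, borel_measurable_on (A l) (psiA l)) ->
  wconv mu A psiA P psi ->
  (* assumption (A) *)
  (forall s : R, 0 <= s ->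
    exists (K : set (set X -> \bar R)) (nu : nat -> set X -> \bar R)
           (tau : nat -> X -> nat),
      compactP mu K /\ (forall l, inP mu (nu l)) /\
        (fun l => dP (nu l) (condm mu
           (A l `&` [set x | (s%:E < mu (A l) * phi (R:=R) T (A l) x)%E]))) @ \oo --> 0 /\
        (forall l, measurable_nat (tau l)) /\
        (fun l => nu l [set x | ((tau l x)%:R%:E < phi (R:=R) T (A l) x)%E])
          @ \oo --> 1%E /\
        (forall l, K (pushT T (tau l) (nu l)))) ->
  (* assumption (B) *)
  (exists G : set (set F),
    setI_closed G /\ <<s G >> = @borel_sets F /\ G setT /\
      (forall B, G B -> P (psi @^-1` (closure B `\` interior B)) = 0%E) /\
      forall B, G B -> (0 < P (psi @^-1` B))%E ->
        exists (K : set (set X -> \bar R)) (nu : nat -> set X -> \bar R)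
               (tau : nat -> X -> nat),
          compactP mu K /\ (forall l, inP mu (nu l)) /\
            (fun l => dP (nu l)
               (condm mu (A l `&` (psiA l @^-1` B)))) @ \oo --> 0 /\
            (forall l, measurable_nat (tau l)) /\
            (forall eps : R, 0 < eps ->
               (fun l => nu l [set x | (eps%:E < mu (A l) * (tau l x)%:R%:E)%E])
                 @ \oo --> 0%E) /\
            (fun l => nu l [set x | ((tau l x)%:R%:E < phi (R:=R) T (A l) x)%E])
              @ \oo --> 1%E /\
            (forall l, K (pushT T (tau l) (nu l)))) ->
  (* conclusion: convergence to an independent pair of iid processes *)
  exists (d' : measure_display) (Om' : measurableType d') (P' : probability Om' R)
         (E : nat -> Om' -> \bar R) (Y : nat -> Om' -> F),
    (forall i, measurable_fun setT (E i)) /\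
        (forall i, borel_measurable_on setT (Y i)) /\
        (forall i, std_exp P' (E i)) /\
        (forall i B, borel_sets B -> P' (Y i @^-1` B) = P (psi @^-1` B)) /\
        indep_family P' E Y /\
        wconv mu (fun _ => setT)
          (fun l x => ((muPhi mu T (A l) x, Psi T (A l) (psiA l) x)
              : {ptws nat -> \bar R} * {ptws nat -> F}))
          P' (fun w => ((fun j => E j w, fun j => Y j w)
              : {ptws nat -> \bar R} * {ptws nat -> F})) /\
        wconv mu A
          (fun l x => ((muPhi mu T (A l) x, Psit T (A l) (psiA l) x)
              : {ptws nat -> \bar R} * {ptws nat -> F}))
          P' (fun w => ((fun j => E j w, fun j => Y j w)
              : {ptws nat -> \bar R} * {ptws nat -> F})).
Proof.
move=> mpT ergT hF cF mpsi mA A0 Arare mpsiA psi_cvg hypA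
  [G [GI [GB [GT [Gnull hypB]]]]].
have [d' [Om' [P' [E [Y [mE [Epos [mY [expE [lawY indEY]]]]]]]]]] :=
  limit_process_exists P mpsi.
exists d', Om', P', E, Y.
split; first exact: mE.
split; first exact: mY.
split; first exact: expE.
split; first exact: lawY.
split; first exact: indEY.
pose good C := borel_sets C /\ null_boundary P psi C.
have part (e : R) (e0 : 0 < e) := small_continuity_partition P mpsi cF e0.
(* Recurrent points serve as the full-measure domain [D l] in [wconv_cells], intersected with [A l]
   for the second convergence; there the cell events are measurable. *)
have mD l := measurable_recurrent_set mpT (mA l).
have nD l (B : set X) : measurable B -> mu (B `\` recurrent_set T (A l)) = 0%E.
  move=> mB; have mBD : measurable (B `\` recurrent_set T (A l)) by exact: measurableD.
  rewrite -(EFin_pr mu mBD); congr EFin.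
  have := prDI mu mB (mD l); rewrite setIC (pr_recurrentI mpT (mA l) (A0 l) ergT mB).
  by lra.
have lim_cells n I C : (forall j, cell_valid (I j)) -> (forall j, good (C j)) ->
    pr P' [set w | in_cells n I C ((fun j => E j w, fun j => Y j w)
      : {ptws nat -> \bar R} * {ptws nat -> F})] =
    \prod_(j < n) (cell_mass (I j) * pr P (psi @^-1` C j)).
  move=> vI gC; rewrite (pr_limit_cells mE mY expE indEY)//; last by move=> j; have [] := gC j.
  by apply: eq_bigr => j _; rewrite /pr lawY//; have [] := gC j.
have m0 n I C : (forall j, cell_valid (I j)) -> (forall j, good (C j)) ->
    measurable [set w | in_cells n I C ((fun j => E j w, fun j => Y j w)
      : {ptws nat -> \bar R} * {ptws nat -> F})].
  by move=> _ gC; apply: (measurable_limit_cells mE mY) => j; have [] := gC j.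
split.
- apply: (@wconv_cells _ _ _ _ _ _ _ _ _ (fun l => recurrent_set T (A l)) _ _ good cF part).
  + by move=> l.
  + by move=> l; rewrite pr_setT.
  + exact: mD.
  + by move=> l x.
  + by move=> l; exact: nD.
  + by move=> l x _ j; exact: mu_phi_gt0.
  + by move=> w j; exact: Epos.
  + move=> l n I C vI gC; apply: (measurable_hit_cells mpT mA A0 mpsiA) => // j.
    by have [] := gC j.
  + exact: m0.
  + move=> n I C vI gC; rewrite lim_cells//; under eq_cvg do rewrite pr_setT divr1.
    exact: (hit_cells_cvg mpT ergT mpsi mA A0 Arare mpsiA psi_cvg hypA GI GB GT Gnull hypB).
- apply: (@wconv_cells _ _ _ _ _ _ _ _ _ (fun l => A l `&` recurrent_set T (A l)) _ _ good cF part).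
  + exact: mA.
  + by move=> l; exact: prA_gt0.
  + by move=> l; exact: measurableI.
  + by move=> l x [].
  + by move=> l; rewrite setDIr setDv set0U; exact: nD.
  + by move=> l x _ j; exact: mu_phi_gt0.
  + by move=> w j; exact: Epos.
  + move=> l n I C vI gC; apply: (measurable_return_cells mpT mA A0 mpsiA) => // j.
    by have [] := gC j.
  + exact: m0.
  + move=> n I C vI gC; rewrite lim_cells//.
    exact: (return_cells_cvg mpT ergT mpsi mA A0 Arare mpsiA psi_cvg hypA GI GB GT Gnull hypB).
Qed.
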